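(* There exist infinitely many $\alpha\in\mathcal{A}$ such that the Hurwitz zeta-function $\zeta(s,\alpha)$ has infinitely many zeros in the strip $D$.
   Context: Write $s=\sigma+it$. For $0<\alpha\le1$, $\zeta(s,\alpha)$ is the Hurwitz zeta-function, defined by $\sum_{n=0}^\infty (n+\alpha)^{-s}$ for $\sigma>1$ and continued meromorphically to $\mathbb{C}$. $D=\{s\in\mathbb{C}: 1/2<\sigma<1\}$, and $\mathcal{A}=\{0<\alpha<1: \alpha \text{ is algebraic and irrational}\}$. *)

(* Defs.v *)
From HB Require Import structures.
From mathcomp Require Import all_boot all_order all_algebra.
From mathcomp Require Import all_classical all_reals all_analysis.
From mathcomp Require Import complex.
Set Implicit Arguments.
Unset Strict Implicit.
Unset Printing Implicit Defensive.
Import Order.TTheory GRing.Theory Num.Theory.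
Import numFieldNormedType.Exports.
Local Open Scope classical_set_scope.
Local Open Scope ring_scope.
Local Open Scope complex_scope.

(* The topological structures are attached to the regular module R[i]^o, not
   to R[i] itself.  Since the scalars are R[i], [derivable f s 1] for
   f : Cplx R -> Cplx R is complex differentiability at s. *)
Notation Cplx R := (R[i]^o).

(* The principal value of x ^ s; it is only meaningful for 0 < x. *)
Definition cpowR (R : realType) (x : R) (s : R[i]) : R[i] :=
  (x `^ complex.Re s)%:C *
  (cos (complex.Im s * ln x) +i* sin (complex.Im s * ln x)).

(* The value of f at p itself is unconstrained. *)
Definition meromorphic_at (R : realType) (f : Cplx R -> Cplx R) (p : Cplx R) :=
  exists (n : nat) (g : Cplx R -> Cplx R),
    (\forall w \near p, derivable g w 1) /\
    (\forall w \near p^', f w = g w / (w - p) ^+ n).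

(* Z is the meromorphic continuation to the plane, with no pole outside s = 1,
   of the series \sum_n (n + alpha)^-s.  By the identity theorem this determines
   Z on the complement of {1}; Z 1 is a junk value. *)
Definition is_hurwitz_zeta (R : realType) (alpha : R)
    (Z : Cplx R -> Cplx R) :=
  [/\ forall s : Cplx R, 1 < complex.Re s ->
        series (fun n => cpowR (n%:R + alpha) (- s) : Cplx R) @ \oo --> Z s,
      forall s : Cplx R, s != 1 -> derivable Z s 1
    & meromorphic_at Z 1].

Definition algebraic_irrationals (R : realType) : set R :=
  [set alpha | [/\ 0 < alpha < 1,
                   algebraicOver (@ratr R) alpha & irrational alpha]].

Definition critical_half_strip (R : realType) : set R[i] :=
  [set s | 2^-1 < complex.Re s < 1].

(* Main.v *)
(* For phases (n + alpha)^-it close to the signs w_0 = -1, w_n = 1 (1 <= n <= K) of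
   ln (n + alpha), the partial sum of zeta(s, alpha) over n <= K is near s0 + it close
   to \sum_n w_n (n + alpha)^-s0 with slope close to -\sum_n |ln (n + alpha)| (n + alpha)^-s0.
   An alpha0 in (0, 1) annihilates the first sum, and for large K and s0 near 1 the slope
   beats the error terms for all alpha near alpha0, so that a Newton iteration finds a
   zero of zeta(s, alpha) near s0 + it.
   A suitable t in [T, 2T] exists because, weighted by a product of Fejer kernels
   concentrated at the signs, the mean of the phase errors and of the energy of the tail
   n > K is small.  These means are computed by expanding trigonometric polynomials;
   this needs ln (n + alpha), n < N, to have no nontrivial integer relation with
   coefficients bounded by J, which excludes only finitely many alpha.  No independence
   of the full sequence is required, so any algebraic irrational outside a finite set,
   such as most q * sqrt 2 with q rational, will do. *)
From HB Require Import structures.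
Require Import Defs.
From mathcomp Require Import all_boot all_order all_algebra.
From mathcomp Require Import all_classical all_reals all_analysis.
From mathcomp Require Import complex ring lra.
Set Implicit Arguments.
Unset Strict Implicit.
Unset Printing Implicit Defensive.
Import Order.TTheory GRing.Theory Num.Theory.
Import numFieldNormedType.Exports.
Local Open Scope classical_set_scope.
Local Open Scope ring_scope.
Local Open Scope complex_scope.
Import ComplexField.
Local Notation modc := Normc.normc.

(** * Complex exponential and mean value inequality *)

Section ComplexBasics.
Context {R : realType}.
Implicit Types (z w : R[i]) (x y : R).

(** The statement asks for a function satisfying [is_hurwitz_zeta], so the continuation is
    constructed: times [s - 1], the Euler-Maclaurin approximations converge to an entire function,
    and reaching every half-plane takes all orders. The quantitative estimates, in Re s >= 3/4, use
    order 1 only. The delicate point is the order of choices: the interval around alpha0 and the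
    polynomial of exceptional values precede alpha, so all bounds are uniform in alpha. The slope is
    at least of order log K, while the terms n <= K are nearly linear only on a disc of radius of
    order 1 / log K. The product of the two stays above an absolute constant, and each error is
    brought below a smaller absolute constant. Independence is available for n < N only. Beyond N
    the weight is replaced by its maximum; the ratio of this maximum to the mean depends on J and K
    alone, so N can be chosen afterwards such that the remaining energy is small enough to absorb
    the loss. *)

Lemma modcM z w : modc (z * w) = modc z * modc w.
Proof. exact: Normc.normcM. Qed.

Lemma modcV z : modc z^-1 = (modc z)^-1.
Proof. exact: Normc.normcV. Qed.

Lemma modcD z w : modc (z + w) <= modc z + modc w.
Proof. exact: le_normcD. Qed.

Lemma modcN z : modc (- z) = modc z.
Proof. exact: normcN. Qed.

Lemma modcB z w : modc (z - w) <= modc z + modc w.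
Proof. by rewrite -(modcN w); apply: modcD. Qed.

Lemma modc_distC z w : modc (z - w) = modc (w - z).
Proof. by rewrite -modcN opprB. Qed.

Lemma modc_ge0 z : 0 <= modc z.
Proof. by case: z => a b; apply: sqrtr_ge0. Qed.

Lemma modcR x : modc x%:C = `|x|.
Proof. by rewrite /= expr0n addr0 sqrtr_sqr. Qed.

Lemma modc_nat n : modc (n%:R : R[i]) = n%:R.
Proof. by rewrite -(rmorph_nat (real_complex R)) modcR ger0_norm ?ler0n. Qed.

Lemma modc_Re z : `|complex.Re z| <= modc z.
Proof.
case: z => a b /=; rewrite -sqrtr_sqr ler_wsqrtr // lerDl; exact: sqr_ge0.
Qed.

Lemma modc_Im z : `|complex.Im z| <= modc z.
Proof.
case: z => a b /=; rewrite -sqrtr_sqr ler_wsqrtr // lerDr; exact: sqr_ge0.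
Qed.

Lemma modc_le z : modc z <= `|complex.Re z| + `|complex.Im z|.
Proof.
case: z => a b; rewrite (_ : a +i* b = a%:C + b%:C * 'i); last first.
  by rewrite [RHS]/=; simpc.
apply: (le_trans (modcD _ _)); rewrite modcM modcR modcR /=.
by rewrite expr0n expr1n add0r sqrtr1 !mulr0 !mulr1 subr0 !addr0 add0r.
Qed.

Lemma modc_eq0 z : (modc z == 0) = (z == 0).
Proof. by apply/eqP/eqP => [/Normc.eq0_normc|->]; rewrite ?Normc.normc0. Qed.

Lemma modcE z : `|z| = (modc z)%:C.
Proof. by []. Qed.

Lemma sqr_modc z : modc z ^+ 2 = complex.Re z ^+ 2 + complex.Im z ^+ 2.
Proof. by case: z => a b /=; rewrite sqr_sqrtr // addr_ge0 // sqr_ge0. Qed.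

Lemma modc_sum (I : Type) (r : seq I) (P : pred I) (F : I -> R[i]) :
  modc (\sum_(i <- r | P i) F i) <= \sum_(i <- r | P i) modc (F i).
Proof.
elim/big_rec2: _ => [|i y x _ h]; first by rewrite Normc.normc0.
by apply: (le_trans (modcD _ _)); rewrite lerD2l.
Qed.

Lemma modcX z n : modc (z ^+ n) = modc z ^+ n.
Proof.
by elim: n => [|n IH]; rewrite ?expr0 ?Normc.normc1 // !exprS modcM IH.
Qed.

Fact cexp_key : unit. Proof. exact: tt. Qed.

(** The lock keeps simplification from exposing the two real coordinates. *)
Definition cexp z : R[i] := locked_with cexp_key (
  (expR (complex.Re z))%:C * (cos (complex.Im z) +i* sin (complex.Im z))).

Lemma cexpE z : cexp z = (expR (complex.Re z) * cos (complex.Im z))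
   +i* (expR (complex.Re z) * sin (complex.Im z)).
Proof. by rewrite /cexp unlock /=; simpc. Qed.

Lemma cexpD z w : cexp (z + w) = cexp z * cexp w.
Proof.
case: z w => [a b] [c d]; rewrite !cexpE /= expRD cosD sinD.
apply/eqP; rewrite eq_complex /=; apply/andP; split; apply/eqP; ring.
Qed.

Lemma cexp0 : cexp 0 = 1.
Proof. by rewrite cexpE /= expR0 cos0 sin0 mulr1 mulr0. Qed.

Lemma modc_cexp z : modc (cexp z) = expR (complex.Re z).
Proof.
case: z => a b; rewrite cexpE /=.
rewrite (_ : _ + _ = expR a ^+ 2 * (cos b ^+ 2 + sin b ^+ 2)); last by ring.
by rewrite cos2Dsin2 mulr1 sqrtr_sqr ger0_norm // expR_ge0.
Qed.

Lemma cpowRE x (s : R[i]) : 0 < x -> cpowR x s = cexp (s * (ln x)%:C).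
Proof.
move=> x0; case: s => a b; rewrite cexpE /cpowR /powR gt_eqF //=.
by rewrite mulr0 subr0 mulr0 add0r; simpc.
Qed.

(** Differentiation in a real variable is taken by coordinates, so that the real derivation rules
    and the real mean value theorem apply. *)
Definition cderiv (f : R -> R[i]) x (d : R[i]) :=
  is_derive x (1 : R) (fun y => complex.Re (f y)) (complex.Re d) /\
  is_derive x (1 : R) (fun y => complex.Im (f y)) (complex.Im d).

Lemma cderivD f g x d e : cderiv f x d -> cderiv g x e ->
  cderiv (fun y => f y + g y) x (d + e).
Proof.
move=> [f1 f2] [g1 g2]; split.
- rewrite (_ : (fun y => _) = (fun y => complex.Re (f y)) + (fun y => complex.Re (g y))).
    by rewrite raddfD; apply: is_deriveD.
  by apply/funext => y; rewrite /= raddfD.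
- rewrite (_ : (fun y => _) = (fun y => complex.Im (f y)) + (fun y => complex.Im (g y))).
    by rewrite raddfD; apply: is_deriveD.
  by apply/funext => y; rewrite /= raddfD.
Qed.

Lemma is_derive_eq2 (f g : R -> R) x d e : is_derive x (1 : R) f d ->
  f =1 g -> d = e -> is_derive x (1 : R) g e.
Proof. by move=> h /funext <- <-. Qed.

Lemma cderivMl (c : R[i]) f x d : cderiv f x d -> cderiv (fun y => c * f y) x (c * d).
Proof.
move=> [f1 f2]; case: c => a b; split.
- apply: (@is_derive_eq2 (fun y => a *: complex.Re (f y) - b *: complex.Im (f y)) _ _
    (a *: complex.Re d - b *: complex.Im d)).
  + by move=> y /=; case: (f y).
  + by case: (d).
- apply: (@is_derive_eq2 (fun y => a *: complex.Im (f y) + b *: complex.Re (f y)) _ _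
    (a *: complex.Im d + b *: complex.Re d)).
  + by move=> y /=; case: (f y).
  + by case: (d).
Qed.

Lemma cderiv_cst c x : cderiv (fun=> c) x 0.
Proof. by split; apply: is_derive_cst. Qed.

Lemma cderiv_eq f g x d e : cderiv f x d -> f =1 g -> d = e -> cderiv g x e.
Proof. by move=> h /funext <- <-. Qed.

Lemma cderivN f x d : cderiv f x d -> cderiv (fun y => - f y) x (- d).
Proof.
move=> h; apply: (cderiv_eq (cderivMl (-1) h)) => [y|]; by rewrite mulN1r.
Qed.

Lemma cderivB f g x d e : cderiv f x d -> cderiv g x e ->
  cderiv (fun y => f y - g y) x (d - e).
Proof. by move=> hf hg; apply: cderivD hf (cderivN hg). Qed.

Lemma cderiv_real (u : R -> R) x d : is_derive x (1 : R) u d ->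
  cderiv (fun y => (u y)%:C) x d%:C.
Proof. by move=> h; split => //=; apply: is_derive_cst. Qed.

Lemma cderiv_sum n (F : nat -> R -> R[i]) (D : nat -> R[i]) x :
  (forall i, (i < n)%N -> cderiv (F i) x (D i)) ->
  cderiv (fun y => \sum_(i < n) F i y) x (\sum_(i < n) D i).
Proof.
elim: n => [|n IH] h.
  rewrite big_ord0; apply: (cderiv_eq (cderiv_cst 0 x)) => // y.
  by rewrite big_ord0.
rewrite big_ord_recr /=; apply: (cderiv_eq (cderivD (IH _) (h n _))) => //.
  by move=> i in_; apply: h; apply: ltnW.
by move=> y; rewrite big_ord_recr.
Qed.

Lemma cderiv_cexp (s : R[i]) (u : R -> R) x d : is_derive x (1 : R) u d ->
  cderiv (fun y => cexp (s * (u y)%:C)) x (s * d%:C * cexp (s * (u x)%:C)).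
Proof.
case: s => a b hu.
have h1 : is_derive x (1 : R) (fun y => a * u y) (a * d) by apply: is_deriveZ.
have h2 : is_derive x (1 : R) (fun y => b * u y) (b * d) by apply: is_deriveZ.
have h3 : is_derive x (1 : R) (fun y => expR (a * u y)) (expR (a * u x) * (a * d)).
  exact: (@is_derive1_comp R expR _ x _ _ (is_derive_expR _) h1).
have h4 : is_derive x (1 : R) (fun y => cos (b * u y)) (- sin (b * u x) * (b * d)).
  exact: (@is_derive1_comp R (@cos R) _ x _ _ (is_derive_cos _) h2).
have h5 : is_derive x (1 : R) (fun y => sin (b * u y)) (cos (b * u x) * (b * d)).
  exact: (@is_derive1_comp R (@sin R) _ x _ _ (is_derive_sin _) h2).
split.
- apply: (is_derive_eq2 (is_deriveM h3 h4)).
  + by move=> y; rewrite cexpE /= !mulr0 subr0 add0r.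
  + by rewrite cexpE /GRing.scale /= !mulr0 !subr0 !add0r; ring.
- apply: (is_derive_eq2 (is_deriveM h3 h5)).
  + by move=> y; rewrite cexpE /= !mulr0 subr0 add0r.
  + by rewrite cexpE /GRing.scale /= !mulr0 !subr0 !add0r; ring.
Qed.

(* Apply the real mean value theorem to the projection of [g] on the direction
   of the increment of [g]. *)
Lemma cmean_value (g g' : R -> R[i]) (phi phi' : R -> R) a b : a <= b ->
  (forall x, a <= x <= b -> cderiv g x (g' x)) ->
  (forall x, a <= x <= b -> is_derive x (1 : R) phi (phi' x)) ->
  (forall x, a <= x <= b -> modc (g' x) <= phi' x) ->
  modc (g b - g a) <= phi b - phi a.
Proof.
move=> ab hg hphi hle.
have [->|ne0] := eqVneq (g b - g a) 0.
  rewrite Normc.normc0.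
  have [||c cab ->] := @MVT_segment R phi phi' a b ab.
  - by move=> c; rewrite in_itv /= => /andP[c1 c2]; apply: hphi; rewrite !ltW.
  - by apply: derivable_within_continuous => c; rewrite in_itv /= => h; have [] := hphi _ h.
  - rewrite mulr_ge0 ?subr_ge0 //; apply: (le_trans (modc_ge0 (g' c))).
    by apply: hle; move: cab; rewrite in_itv.
pose D := g b - g a.
pose u := (conjc D) * ((modc D)^-1)%:C.
have uD : complex.Re (u * D) = modc D.
  have D0 : modc D != 0 by rewrite modc_eq0.
  have: modc D ^+ 2 = complex.Re D ^+ 2 + complex.Im D ^+ 2 by apply: sqr_modc.
  rewrite /u; case: (D) D0 => p q; set m := modc _ => D0 /= h.
  rewrite !mulr0 subr0 add0r.
  have -> : p * m^-1 * p - - q * m^-1 * q = (p ^+ 2 + q ^+ 2) / m by ring.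
  by rewrite -h expr2 mulfK.
have um : modc u = 1.
  rewrite /u modcM modcR ger0_norm ?invr_ge0 ?modc_ge0 //.
  have -> : modc (conjc D) = modc D by case: (D) => p q /=; rewrite sqrrN.
  by rewrite divff // modc_eq0.
pose F x := phi x - complex.Re (u * g x).
pose F' x := phi' x - complex.Re (u * g' x).
have hF x : a <= x <= b -> is_derive x (1 : R) F (F' x).
  by move=> hx; apply: is_deriveB; [exact: hphi|have [] := cderivMl u (hg _ hx)].
have [||c cab E] := @MVT_segment R F F' a b ab.
- by move=> c; rewrite in_itv /= => /andP[c1 c2]; apply: hF; rewrite !ltW.
- by apply: derivable_within_continuous => c; rewrite in_itv /= => h; have [] := hF _ h.
- have : 0 <= F b - F a.
    rewrite E mulr_ge0 ?subr_ge0 //.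
    have hc : a <= c <= b by move: cab; rewrite in_itv.
    apply: le_trans (hle _ hc).
    apply: (le_trans (ler_norm _)); apply: (le_trans (modc_Re _)).
    by rewrite modcM um mul1r.
  rewrite /F => h; rewrite -uD /D mulrBr raddfB /=.
  by move: h; set A := complex.Re (u * g b); set B := complex.Re (u * g a); lra.
Qed.

(** Mean value inequality along the segment from [w] to [z]: the real part of an intermediate point
    is a convex combination of the two, so the modulus of the exponential stays below [M]. *)
Lemma cexp_lip z w M : expR (complex.Re z) <= M -> expR (complex.Re w) <= M ->
  modc (cexp z - cexp w) <= modc (z - w) * M.
Proof.
move=> hz hw.
have := @cmean_value (fun h => cexp (w + (z - w) * h%:C))
  (fun h => (z - w) * cexp (w + (z - w) * h%:C))
  (fun h => (modc (z - w) * M) * h) (fun h => modc (z - w) * M) 0 1 ler01.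
rewrite !mulr0 subr0 addr0 !mulr1 addrCA subrr addr0; apply.
- move=> x _.
  have := cderivMl (cexp w) (cderiv_cexp (z - w) (is_derive_id x (1 : R))).
  move/cderiv_eq; apply => [y|]; first by rewrite cexpD.
  by rewrite cexpD mulr1 mulrCA.
- move=> x _; have := is_deriveZ (modc (z - w) * M) (is_derive_id x (1 : R)).
  by move/is_derive_eq2; apply => //; rewrite /GRing.scale /= mulr1.
- move=> x /andP[x0 x1]; rewrite modcM ler_wpM2l ?modc_ge0 // modc_cexp.
  have -> : complex.Re (w + (z - w) * x%:C) = (1 - x) * complex.Re w + x * complex.Re z.
    by case: (z) (w) => p q [p' q'] /=; ring.
  have [h|h] := leP (complex.Re w) (complex.Re z).
  + apply: le_trans hz; rewrite ler_expR.
    have : (1 - x) * complex.Re w <= (1 - x) * complex.Re z by rewrite ler_wpM2l // subr_ge0.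
    lra.
  + apply: le_trans hw; rewrite ler_expR.
    have : x * complex.Re z <= x * complex.Re w by rewrite ler_wpM2l // ltW.
    lra.
Qed.

Lemma cexp_sub1 z : modc (cexp z - 1) <= expR (modc z) - 1.
Proof.
have := @cmean_value (fun h => cexp (z * h%:C)) (fun h => z * cexp (z * h%:C))
  (fun h => expR (modc z * h)) (fun h => expR (modc z * h) * modc z) 0 1 ler01.
rewrite !mulr0 !mulr1 cexp0 expR0; apply.
- move=> x _; have := cderiv_cexp z (is_derive_id x (1 : R)).
  by move/cderiv_eq; apply => //; rewrite mulr1.
- move=> x _.
  apply: (@is_derive1_comp R expR _ x _ _ (is_derive_expR _)).
  have := is_deriveZ (modc z) (is_derive_id x (1 : R)).
  by move/is_derive_eq2; apply => //; rewrite /GRing.scale /= mulr1.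
- move=> x /andP[x0 x1]; rewrite modcM mulrC ler_wpM2r ?modc_ge0 // modc_cexp ler_expR.
  apply: (le_trans (ler_norm _)); apply: (le_trans (modc_Re _)).
  by rewrite modcM modcR ger0_norm.
Qed.

(** The derivative of [cexp z - z] is [cexp z - 1], of modulus at most [expR rho - 1] on the disc.
    The bound between two arbitrary points serves both differentiability and the contraction in the
    Newton iteration. *)
Lemma cexp_sub_id_lip z w rho : modc z <= rho -> modc w <= rho ->
  modc (cexp z - cexp w - (z - w)) <= modc (z - w) * (expR rho - 1).
Proof.
move=> hz hw.
have := @cmean_value (fun h => cexp (w + (z - w) * h%:C) - (z - w) * h%:C)
  (fun h => (z - w) * cexp (w + (z - w) * h%:C) - (z - w))
  (fun h => (modc (z - w) * (expR rho - 1)) * h) (fun h => modc (z - w) * (expR rho - 1)) 0 1 ler01.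
rewrite !mulr0 !subr0 addr0 !mulr1 addrCA subrr addr0 addrAC; apply.
- move=> x _; apply: cderivB.
    have := cderivMl (cexp w) (cderiv_cexp (z - w) (is_derive_id x (1 : R))).
    move/cderiv_eq; apply => [y|]; first by rewrite cexpD.
    by rewrite cexpD mulr1 mulrCA.
  have := cderivMl (z - w) (cderiv_real (is_derive_id x (1 : R))).
  by move/cderiv_eq; apply => //; rewrite mulr1.
- move=> x _; have := is_deriveZ (modc (z - w) * (expR rho - 1)) (is_derive_id x (1 : R)).
  by move/is_derive_eq2; apply => //; rewrite /GRing.scale /= mulr1.
- move=> x /andP[x0 x1]; rewrite -[X in _ - X]mulr1 -mulrBr modcM ler_wpM2l ?modc_ge0 //.
  apply: (le_trans (cexp_sub1 _)); rewrite lerD2r ler_expR.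
  have -> : w + (z - w) * x%:C = (1 - x)%:C * w + x%:C * z by rewrite rmorphB /=; ring.
  apply: (le_trans (modcD _ _)); rewrite !modcM !modcR !ger0_norm ?subr_ge0 //.
  have : (1 - x) * modc w <= (1 - x) * rho by rewrite ler_wpM2l // subr_ge0.
  have : x * modc z <= x * rho by rewrite ler_wpM2l.
  lra.
Qed.

End ComplexBasics.

(** * Convergence by telescoping majorants, Newton iteration and real powers *)

Section Elementary.
Context {R : realType}.
Implicit Types (z w s : R[i]) (x y h e d q r : R).

(** From [N] on, [a + phi] decreases and [a - phi] increases, and the gap between them tends to
    0. *)
Lemma real_majorant (a phi : nat -> R) N :
  (forall n, (N <= n)%N -> a n - a n.+1 <= phi n - phi n.+1) ->
  (forall n, (N <= n)%N -> a n.+1 - a n <= phi n - phi n.+1) ->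
  (forall n, 0 <= phi n) ->
  (forall e, 0 < e -> exists n0, forall n, (n0 <= n)%N -> phi n <= e) ->
  exists l, forall e, 0 < e -> exists n0, forall n, (n0 <= n)%N -> `|a n - l| <= e.
Proof.
move=> h1 h2 h3 h4.
pose b n := a (n + N)%N + phi (n + N)%N.
have bdec : nonincreasing_seq b.
  apply/nonincreasing_seqP => n; rewrite /b addSn.
  have := h2 (n + N)%N (leq_addl _ _); lra.
have blow : has_lbound (range b).
  exists (a N - phi N) => _ [n _ <-]; rewrite /b.
  elim: n => [|n IH]; first by rewrite add0n; have := h3 N; lra.
  have : a N - phi N <= a (n + N)%N - phi (n + N)%N.
    elim: {IH} n => [|n IH]; first by rewrite add0n.
    by rewrite addSn; have := h1 (n + N)%N (leq_addl _ _); lra.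
  rewrite addSn; have := h1 (n + N)%N (leq_addl _ _); have := h3 (n+N).+1; lra.
have bc := nonincreasing_is_cvgn bdec blow.
exists (limn b) => e e0.
have e2 : 0 < e / 2 by rewrite divr_gt0.
have [n1 H1] := h4 _ e2.
have /cvgrPdist_le /(_ _ e2) [n2 _ H2] := bc.
exists (n1 + n2 + N)%N => n hn.
have Nn : (N <= n)%N by apply: leq_trans hn; apply: leq_addl.
have := H2 (n - N)%N; rewrite /= /b subnK //.
have -> : (n2 <= n - N)%N by rewrite leq_subRL // addnC; apply: leq_trans hn; rewrite -addnA leq_addl.
have p1 : phi n <= e / 2 by apply: H1; apply: leq_trans hn; rewrite -addnA leq_addr.
have p0 := h3 n.
move=> /(_ isT); rewrite !ler_norml => /andP[? ?]; apply/andP; split; lra.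
Qed.

(** Comparing increments with those of a vanishing [phi] replaces summability by telescoping and
    yields the rate [phi n]. The Newton iteration, the Euler-Maclaurin limit and termwise
    differentiation all rest on it. *)
Lemma cauchy_majorant (u : nat -> R[i]) (phi : nat -> R) N :
  (forall n, (N <= n)%N -> modc (u n.+1 - u n) <= phi n - phi n.+1) ->
  (forall n, 0 <= phi n) ->
  (forall e, 0 < e -> exists n0, forall n, (n0 <= n)%N -> phi n <= e) ->
  exists l, forall n, (N <= n)%N -> modc (u n - l) <= phi n.
Proof.
move=> hu h0 hphi.
have decm n m : (N <= n)%N -> (n <= m)%N -> modc (u m - u n) <= phi n - phi m.
  move=> Nn; elim: m => [|m IH]; first by rewrite leqn0 => /eqP ->; rewrite !subrr Normc.normc0.
  rewrite leq_eqVlt => /orP[/eqP->|]; first by rewrite !subrr Normc.normc0.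
  rewrite ltnS => nm; have h2 := IH nm.
  have Nm : (N <= m)%N by apply: leq_trans nm.
  rewrite (_ : _ - _ = (u m.+1 - u m) + (u m - u n)); last by ring.
  apply: (le_trans (modcD _ _)); have := hu _ Nm; lra.
have [a ha] : exists l, forall e, 0 < e -> exists n0, forall n, (n0 <= n)%N ->
    `|complex.Re (u n) - l| <= e.
  apply: (@real_majorant _ phi N) => // n Nn; apply: (le_trans _ (hu _ Nn)).
  - rewrite modc_distC -raddfB; exact: le_trans (ler_norm _) (modc_Re _).
  - rewrite -raddfB; exact: le_trans (ler_norm _) (modc_Re _).
have [b hb] : exists l, forall e, 0 < e -> exists n0, forall n, (n0 <= n)%N ->
    `|complex.Im (u n) - l| <= e.
  apply: (@real_majorant _ phi N) => // n Nn; apply: (le_trans _ (hu _ Nn)).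
  - rewrite modc_distC -raddfB; exact: le_trans (ler_norm _) (modc_Im _).
  - rewrite -raddfB; exact: le_trans (ler_norm _) (modc_Im _).
exists (a +i* b) => n Nn; apply/ler_addgt0Pr => e e0.
have e2 : 0 < e / 2 by rewrite divr_gt0.
have [n1 H1] := ha _ e2; have [n2 H2] := hb _ e2.
pose m := (n + n1 + n2)%N.
have := H1 m; rewrite /m addnAC leq_addl => /(_ isT) {}H1.
have := H2 m; rewrite /m leq_addl => /(_ isT) {}H2.
rewrite (_ : _ - _ = (u n - u m) + (u m - (a +i* b))); last by ring.
apply: (le_trans (modcD _ _)); rewrite modc_distC.
have nm : (n <= m)%N by rewrite /m -addnA leq_addr.
have := decm _ _ Nn nm; have := h0 m.
have := modc_le (u m - (a +i* b)); rewrite !raddfB /=.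
have E : (n + n2 + n1)%N = m by rewrite /m addnAC.
rewrite E in H1; rewrite -/m in H2.
move=> h1 h2 h3; lra.
Qed.

Lemma geometric_small r e : 0 < r -> 0 < e ->
  exists n0, forall n, (n0 <= n)%N -> r / 2 ^+ n <= e.
Proof.
move=> r0 e0; exists (Num.bound (r / e)) => n hn.
rewrite ler_pdivrMr ?exprn_gt0 // mulrC -ler_pdivrMr //.
have h := archi_boundP (ltW (divr_gt0 r0 e0)).
apply: (le_trans (ltW h)); rewrite -natrX ler_nat.
by apply: (leq_trans hn); apply: ltnW; apply: ltn_expl.
Qed.

(* Newton iteration with the constant slope [c]. *)
Lemma newton_zero (F : R[i] -> R[i]) (c : R[i]) (r : R) : 0 < r -> c != 0 ->
  (forall z w, modc z <= r -> modc w <= r ->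
    modc (F z - F w - c * (z - w)) <= modc c / 2 * modc (z - w)) ->
  modc (F 0) <= modc c / 2 * r ->
  exists2 z, modc z <= r & F z = 0.
Proof.
move=> r0 c0 hF hF0.
have c1 : 0 < modc c by rewrite lt_def modc_eq0 c0 modc_ge0.
pose u := fix u (n : nat) : R[i] := if n is n'.+1 then u n' - F (u n') / c else 0.
have uS n : u n.+1 - u n = - (F (u n) / c) by rewrite /=; ring.
(* The residual halves at each step, so the steps sum to at most [r] and the iterates stay in the
   disc. *)
have inv n : modc (u n) <= r - r / 2 ^+ n /\ modc (F (u n)) <= modc c * (r / 2 ^+ n.+1).
  elim: n => [|n [IH1 IH2]].
    rewrite [u 0%N]/= Normc.normc0 expr0 divr1 subrr; split => //.
    by rewrite expr1; apply: le_trans hF0 _; lra.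
  have hstep : modc (u n.+1 - u n) <= r / 2 ^+ n.+1.
    by rewrite uS modcN modcM modcV ler_pdivrMr // mulrC.
  have p1 : 0 < r / 2 ^+ n.+1 by rewrite divr_gt0 // exprn_gt0.
  have E1 : r / 2 ^+ n = r / 2 ^+ n.+1 + r / 2 ^+ n.+1.
    by rewrite exprS invfM; field; rewrite expf_neq0 // pnatr_eq0.
  have E2 : r / 2 ^+ n.+1 = r / 2 ^+ n.+2 + r / 2 ^+ n.+2.
    by rewrite (exprS _ n.+1) invfM; field; rewrite expf_neq0 // pnatr_eq0.
  have h1 : modc (u n.+1) <= r - r / 2 ^+ n.+1.
    rewrite -(subrK (u n) (u n.+1)); apply: (le_trans (modcD _ _)).
    lra.
  split => //.
  have := @hF (u n.+1) (u n).
  (* By the choice of the step, [c * (u n.+1 - u n) = - F (u n)], so the linearization error is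
     exactly [F (u n.+1)]. *)
  rewrite {1}uS mulrN opprK mulrCA divff // mulr1 subrK.
  have h2 : modc (u n.+1) <= r by lra.
  have h3 : modc (u n) <= r by lra.
  move=> /(_ h2 h3) h4; apply: (le_trans h4).
  have : modc c / 2 * modc (u n.+1 - u n) <= modc c / 2 * (r / 2 ^+ n.+1).
    by rewrite ler_wpM2l // divr_ge0 // modc_ge0.
  move=> h5; apply: (le_trans h5); rewrite E2; lra.
have [z hz] : exists z, forall n, (0 <= n)%N -> modc (u n - z) <= r / 2 ^+ n.
  apply: (@cauchy_majorant u (fun n => r / 2 ^+ n) 0).
  - move=> n _; have E1 : r / 2 ^+ n = r / 2 ^+ n.+1 + r / 2 ^+ n.+1.
      by rewrite exprS invfM; field; rewrite expf_neq0 // pnatr_eq0.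
    rewrite uS modcN modcM modcV ler_pdivrMr // mulrC E1 addrK.
    by have [_] := inv n.
  - by move=> n; rewrite divr_ge0 ?exprn_ge0 // ltW.
  - by move=> e; apply: geometric_small.
have zr : modc z <= r.
  have := hz 0 isT; rewrite /= sub0r modcN expr0 divr1; lra.
exists z => //; apply/eqP; rewrite -modc_eq0 eq_le modc_ge0 andbT.
apply/ler_addgt0Pr => e e0; rewrite add0r.
have e1 : 0 < e / (modc c * 3) by rewrite divr_gt0 // mulr_gt0.
have [n0 h0] := geometric_small r0 e1.
have hn := h0 n0 (leqnn _); have [i1 i2] := inv n0.
have p0 : 0 < r / 2 ^+ n0 by rewrite divr_gt0 // exprn_gt0.
have unr : modc (u n0) <= r by lra.
have E1 : r / 2 ^+ n0 = r / 2 ^+ n0.+1 + r / 2 ^+ n0.+1.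
  by rewrite exprS invfM; field; rewrite expf_neq0 // pnatr_eq0.
have k1 := hF _ _ zr unr.
have k2 : modc (z - u n0) <= r / 2 ^+ n0 by rewrite modc_distC; apply: hz.
have k3 : modc (c * (z - u n0)) <= modc c * (r / 2 ^+ n0) by rewrite modcM ler_wpM2l // ltW.
have k4 : modc c / 2 * modc (z - u n0) <= modc c / 2 * (r / 2 ^+ n0) by rewrite ler_wpM2l // divr_ge0 // ltW.
have k5 : modc c * (r / 2 ^+ n0) <= e / 3.
  by rewrite mulrC -ler_pdivlMr //; apply: (le_trans hn); rewrite le_eqVlt; apply/orP; left; apply/eqP; field; rewrite gt_eqF.
have -> : F z = (F z - F (u n0) - c * (z - u n0)) + c * (z - u n0) + F (u n0) by ring.
apply: (le_trans (modcD _ _)).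
have := modcD (F z - F (u n0) - c * (z - u n0)) (c * (z - u n0)).
have k6 : modc c * (r / 2 ^+ n0.+1) <= modc c * (r / 2 ^+ n0) by rewrite ler_wpM2l ?(ltW c1) // E1 lerDl divr_ge0 ?exprn_ge0 // ltW.
lra.
Qed.

(** The difference on the right is d c^(-d-1) for some c <= x + 1 <= 2x. This turns powers into the
    telescoping majorants that [cauchy_majorant] needs. *)
Lemma powR_tele d x : 0 < d -> 1 <= x ->
  x `^ (- d - 1) <= 2 `^ (d + 1) / d * (x `^ (- d) - (x + 1) `^ (- d)).
Proof.
move=> d0 x1; have x0 : 0 < x by lra.
have [|||c cab E] := @MVT_segment R (fun y => y `^ (- d)) (fun y => - d * y `^ (- d - 1)) x (x + 1) _.
- by rewrite lerDl.
- move=> c; rewrite in_itv /= => /andP[c1 c2]; apply: is_derive1_powR; lra.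
- apply: derivable_within_continuous => c; rewrite in_itv /= => /andP[c1 c2].
  have c0 : 0 < c by lra.
  by have [] := is_derive1_powR (- d) c0.
have /andP[c1 c2] : x <= c <= x + 1 by move: cab; rewrite in_itv.
have -> : x `^ (- d) - (x + 1) `^ (- d) = d * c `^ (- d - 1).
  by rewrite -opprB E; ring.
rewrite mulrA divfK ?gt_eqF // -opprD powRN.
have -> : - (d + 1) = - (d + 1) by [].
rewrite powRN -ler_pdivrMl ?powR_gt0 // mulrC -invfM ?lef_pV2 ?posrE ?mulr_gt0 ?powR_gt0 //; try lra.
rewrite -powRM; try lra.
apply: ge0_ler_powR; rewrite ?nnegrE; lra.
Qed.

Lemma powR_small d e : 0 < d -> 0 < e -> exists2 N, 1 <= N & forall x, N <= x -> x `^ (- d) <= e.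
Proof.
move=> d0 e0; exists (1 + e `^ (- d^-1)); first by rewrite lerDl powR_ge0.
move=> x hx.
have p : 0 < e `^ (- d^-1) by rewrite powR_gt0.
have x0 : 0 < x by lra.
rewrite powRN -[leRHS]invrK lef_pV2 ?posrE ?invr_gt0 ?powR_gt0 //.
have -> : e^-1 = (e `^ (- d^-1)) `^ d.
  by rewrite -powRrM mulNr mulVf ?gt_eqF // powR_inv1 // ltW.
apply: ge0_ler_powR; rewrite ?nnegrE; lra.
Qed.

(** From y <= exp y at y = e ln (2x), and (2x)^e <= 2 x^e because e <= 1. Logarithms produced by
    varying s are absorbed into a small power in this way. *)
Lemma log_powR e x : 0 < e -> e <= 1 -> 1 <= x -> 1 + ln (x + 1) <= (1 + 2 / e) * x `^ e.
Proof.
move=> e0 e1 x1.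
have x0 : 0 < x by lra.
have h1 : e * ln (x + 1) <= 2 * x `^ e.
  have l1 : e * ln (x + 1) <= e * ln (2 * x).
    by rewrite ler_wpM2l ?(ltW e0) // ler_ln ?posrE; lra.
  have l2 : e * ln (2 * x) <= (2 * x) `^ e.
    rewrite /powR gt_eqF; last by lra.
    have := expR_ge1Dx (e * ln (2 * x)); lra.
  apply: (le_trans l1); apply: (le_trans l2).
  rewrite powRM; try lra.
  rewrite ler_wpM2r ?powR_ge0 //.
  have -> : (2 : R) = 2 `^ 1 by rewrite powRr1 //; lra.
  rewrite {1}powRr1; last by lra.
  apply: ler_powR; lra.
have h2 : 1 <= x `^ e.
  have E1 : 1 `^ e = 1 :> R by rewrite powR1.
  rewrite -E1; apply: ge0_ler_powR; rewrite ?nnegrE; lra.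
have h3 : ln (x + 1) <= 2 / e * x `^ e.
  by rewrite mulrAC ler_pdivlMr // mulrC.
lra.
Qed.

Fact xpow_key : unit. Proof. exact: tt. Qed.

(** The exponent is [- s], as in the terms of the zeta series. *)
Definition xpow x s : R[i] := locked_with xpow_key (cexp (- s * (ln x)%:C)).

Lemma xpowE x s : xpow x s = cexp (- s * (ln x)%:C).
Proof. by rewrite /xpow unlock. Qed.

Lemma modc_xpow x s : 0 < x -> modc (xpow x s) = x `^ (- complex.Re s).
Proof.
move=> x0; rewrite xpowE modc_cexp /powR gt_eqF //.
by case: s => a b /=; rewrite mulr0 subr0.
Qed.

Lemma xpowD x s w : xpow x (s + w) = xpow x s * xpow x w.
Proof. by rewrite !xpowE opprD mulrDl cexpD. Qed.

Lemma cexpR x : cexp (x%:C) = (expR x)%:C.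
Proof. by rewrite cexpE /= cos0 sin0 mulr1 mulr0. Qed.

Lemma xpow1 x : 0 < x -> xpow x 1 = (x^-1)%:C.
Proof.
move=> x0; rewrite xpowE mulN1r -rmorphN cexpR.
by rewrite -lnV // lnK // posrE invr_gt0.
Qed.

Lemma xpow_lip x s w q : 1 <= x -> q <= complex.Re s -> q <= complex.Re w ->
  modc (xpow x s - xpow x w) <= modc (s - w) * (ln x * x `^ (- q)).
Proof.
move=> x1 hs hw; have x0 : 0 < x by lra.
have l0 : 0 <= ln x by apply: ln_ge0.
have key t : q <= complex.Re t -> expR (complex.Re (- t * (ln x)%:C)) <= x `^ (- q).
  move=> ht; rewrite /powR gt_eqF // ler_expR; case: t ht => a b /= ht.
  by rewrite mulr0 subr0 ler_wpM2r // lerN2.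
rewrite !xpowE; apply: (le_trans (cexp_lip (key _ hs) (key _ hw))).
by rewrite -mulrBl opprK modcM addrC modc_distC modcR ger0_norm // mulrA.
Qed.

End Elementary.

(** * Taylor remainders of powers *)

Section Remainder.
Context {R : realType}.
Implicit Types (z w s : R[i]) (x y h e d q r S M : R).

(* [cbin k s] is the binomial coefficient of [1 - s] over [k]. *)
Definition cbin k s : R[i] := \prod_(i < k) (1 - s - i%:R) / k`!%:R.

Lemma cbin0 s : cbin 0 s = 1.
Proof. by rewrite /cbin big_ord0 fact0 divr1. Qed.

Lemma cbin1 s : cbin 1 s = 1 - s.
Proof. by rewrite /cbin big_ord1 subr0 divr1. Qed.

Lemma natc_neq0 n : (n.+1%:R : R[i]) != 0.
Proof. by rewrite pnatr_eq0. Qed.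

(** Absorption (k + 1) C(a, k + 1) = a C(a - 1, k) with a = 1 - s: raising [s] by 1 lowers a by
    1. *)
Lemma cbinS k s : k.+1%:R * cbin k.+1 s = (1 - s) * cbin k (s + 1).
Proof.
have h : (k`!%:R : R[i]) != 0 by rewrite pnatr_eq0 -lt0n fact_gt0.
rewrite /cbin big_ord_recl subr0 factS natrM invfM.
have -> : \prod_(i < k) (1 - s - (lift ord0 i)%:R) = \prod_(i < k) (1 - (s + 1) - i%:R) :> R[i].
  apply: eq_bigr => i _; rewrite lift0 -natr1; ring.
move: (natc_neq0 k); move: (k.+1%:R : R[i]) => n h2.
by field; rewrite h h2.
Qed.

(** Trinomial revision C(a, j) C(a - j, k) = C(j + k, j) C(a, j + k) with a = 1 - s. It lets the
    double sum in [em_step] be collected by powers of x. *)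
Lemma cbinM j k s : cbin j s * cbin k (s + j%:R) = 'C(j + k, j)%:R * cbin (j + k) s.
Proof.
have h n : (n`!%:R : R[i]) != 0 by rewrite pnatr_eq0 -lt0n fact_gt0.
have E : ('C(j + k, j)%:R : R[i]) = (j + k)`!%:R / (j`!%:R * k`!%:R).
  apply: (canRL (mulfK _)); first by rewrite mulf_neq0.
  have := bin_fact (leq_addr k j); rewrite addKn => <-.
  by rewrite !natrM.
rewrite E /cbin big_split_ord /=.
have -> : \prod_(i < k) (1 - s - (j + i)%:R) = \prod_(i < k) (1 - (s + j%:R) - i%:R) :> R[i].
  by apply: eq_bigr => i _; rewrite natrD; ring.
by field; rewrite !h.
Qed.

(** Remainder of order [p] in the Taylor expansion of (x + h)^(1 - s) at h = 0. The exponent is that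
    of a primitive of u^(-s), the leading boundary term of Euler-Maclaurin summation. *)
Definition taylor_rem p x s h : R[i] :=
  xpow (x + h) (s - 1) - \sum_(k < p.+1) cbin k s * xpow x (s - 1 + k%:R) * (h ^+ k)%:C.

Lemma cmean_value0 (g g' : R -> R[i]) M h : 0 <= h <= 1 -> g 0 = 0 ->
  (forall x, 0 <= x <= 1 -> cderiv g x (g' x)) ->
  (forall x, 0 <= x <= 1 -> modc (g' x) <= M) ->
  modc (g h) <= M.
Proof.
move=> /andP[h0 h1] g0 dg bg.
have M0 : 0 <= M by apply: le_trans (modc_ge0 _) (bg 0 _); rewrite lexx ler01.
have := @cmean_value R g g' (fun y => M * y) (fun=> M) 0 h h0.
rewrite g0 subr0 mulr0 subr0 => H; apply: le_trans (H _ _ _) _.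
- by move=> x /andP[x0 xh]; apply: dg; rewrite x0 (le_trans xh).
- move=> x _; have := is_deriveZ M (is_derive_id x (1 : R)).
  by move/is_derive_eq2; apply => //; rewrite /GRing.scale /= mulr1.
- by move=> x /andP[x0 xh]; apply: bg; rewrite x0 (le_trans xh).
- by rewrite -[leRHS]mulr1 ler_wpM2l.
Qed.

Lemma cderiv_xpow_shift x s h : 0 < x + h ->
  cderiv (fun y => xpow (x + y) (s - 1)) h ((1 - s) * xpow (x + h) s).
Proof.
move=> xh.
have hu : is_derive h (1 : R) (fun y => ln (x + y)) ((x + h)^-1).
  have h1 : is_derive h (1 : R) (fun y => x + y) 1.
    apply: (is_derive_eq2 (is_deriveD (is_derive_cst x h (1 : R)) (is_derive_id h (1 : R)))) => //.
    by rewrite add0r.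
  have := @is_derive1_comp R (@ln R) (fun y => x + y) h _ _ (is_derive1_ln xh) h1.
  by rewrite mulr1.
apply: (cderiv_eq (cderiv_cexp (- (s - 1)) hu)) => [y|]; first by rewrite xpowE.
have E : xpow (x + h) s = xpow (x + h) (s - 1) * xpow (x + h) 1 by rewrite -xpowD subrK.
by rewrite E xpow1 // !xpowE opprB -mulrA [_%:C * _]mulrC.
Qed.

Lemma taylor_rem00 p x s : taylor_rem p x s 0 = 0.
Proof.
rewrite /taylor_rem addr0 big_ord_recl cbin0 expr0 mul1r addr0 mulr1 big1 ?addr0 ?subrr //.
by move=> i _; rewrite lift0 expr0n mulr0.
Qed.

Lemma cderiv_taylor_rem0 x s h : 0 < x + h ->
  cderiv (taylor_rem 0 x s) h ((1 - s) * xpow (x + h) s).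
Proof.
move=> xh; have := cderivB (cderiv_xpow_shift s xh) (cderiv_cst (xpow x (s - 1)) h).
move/cderiv_eq; apply => [y|]; last by rewrite subr0.
by rewrite /taylor_rem big_ord1 cbin0 mul1r addr0 expr0 mulr1.
Qed.

(** Differentiating in [h] trades one order for a shift of [s] by 1. Both bounds on the remainder
    follow from this by induction, since it vanishes at h = 0. *)
Lemma cderiv_taylor_remS p x s h : 0 < x + h ->
  cderiv (taylor_rem p.+1 x s) h ((1 - s) * taylor_rem p x (s + 1) h).
Proof.
move=> xh.
have hs : cderiv (fun y => \sum_(k < p.+2) cbin k s * xpow x (s - 1 + k%:R) * (y ^+ k)%:C) h
   (\sum_(k < p.+2) cbin k s * xpow x (s - 1 + k%:R) * (k%:R * h ^+ k.-1)%:C).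
  apply: (@cderiv_sum R p.+2 (fun k y => cbin k s * xpow x (s - 1 + k%:R) * (y ^+ k)%:C)
     (fun k => cbin k s * xpow x (s - 1 + k%:R) * (k%:R * h ^+ k.-1)%:C)) => k _.
  apply: cderivMl; apply: cderiv_real.
  apply: (is_derive_eq2 (@is_deriveX _ _ _ k _ _ _ (is_derive_id h (1 : R)))) => [y|].
    by elim: (k) => [|i /= IHi]; rewrite ?expr0 // !exprS -IHi.
  by rewrite /GRing.scale /= mulr1 mulr_natl.
apply: (cderiv_eq (cderivB (cderiv_xpow_shift s xh) hs)) => //.
rewrite /taylor_rem mulrBr addrK; congr (_ - _).
rewrite big_ord_recl mul0r mulr0 add0r mulr_sumr; apply: eq_bigr => k _.
rewrite lift0 /= rmorphM /= rmorph_nat.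
have -> : s - 1 + k.+1%:R = s + k%:R by rewrite -natr1; ring.
transitivity ((k.+1%:R * cbin k.+1 s) * xpow x (s + k%:R) * (h ^+ k)%:C); first by ring.
by rewrite cbinS; ring.
Qed.

(** Bounds the product of |1 - (s + i)| over i <= p for |s| <= S. Starting at S + 2 instead of S + 1
    leaves room for the extra term in [taylor_rem_lip]. *)
Definition rem_cst p S : R := \prod_(i < p.+1) (S + 2 + i%:R).

Lemma rem_cst0 S : rem_cst 0 S = S + 2.
Proof. by rewrite /rem_cst big_ord1 addr0. Qed.

Lemma rem_cstS p S : rem_cst p.+1 S = (S + 2) * rem_cst p (S + 1).
Proof.
rewrite /rem_cst big_ord_recl addr0; congr (_ * _).
by apply: eq_bigr => i _; rewrite lift0 -natr1; ring.
Qed.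

Lemma rem_cst_ge0 p S : 0 <= S -> 0 <= rem_cst p S.
Proof. by move=> S0; apply: prodr_ge0 => i _; rewrite !addr_ge0. Qed.

Lemma Re1 : complex.Re (1 : R[i]) = 1. Proof. by []. Qed.

Lemma modc_add1 s S : modc s <= S -> modc (s + 1) <= S + 1.
Proof.
by move=> h; apply: (le_trans (modcD _ _)); rewrite Normc.normc1 lerD2r.
Qed.

Lemma modc_1sub s S : modc s <= S -> modc (1 - s) <= S + 1.
Proof. by move=> h; rewrite addrC; apply: modc_add1; rewrite modcN. Qed.

Lemma powR_antimono q x y : 0 <= q -> 0 < x -> x <= y -> y `^ (- q) <= x `^ (- q).
Proof.
move=> q0 x0 xy; rewrite !powRN lef_pV2 ?posrE ?powR_gt0 //; last exact: lt_le_trans xy.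
apply: ge0_ler_powR => //; rewrite nnegrE ltW //; exact: lt_le_trans xy.
Qed.

Lemma xpow_shift_le q s x h : 1 <= x -> 0 <= h -> 0 <= q -> q <= complex.Re s ->
  modc (xpow (x + h) s) <= x `^ (- q).
Proof.
move=> x1 h0 q0 qs; rewrite modc_xpow; last by lra.
apply: (@le_trans _ _ (x `^ (- complex.Re s))).
  apply: powR_antimono; lra.
by apply: ler_powR => //; rewrite lerN2.
Qed.

(** Each differentiation adds 1 to the lower bound [q] on Re s. The condition 0 <= q + p makes the
    final power nonincreasing, so its value at x + h is bounded by that at x. *)
Lemma taylor_rem_bound p q S x s h : 1 <= x -> 0 <= h <= 1 -> q <= complex.Re s ->
  modc s <= S -> 0 <= q + p%:R ->
  modc (taylor_rem p x s h) <= rem_cst p S * x `^ (- (q + p%:R)).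
Proof.
move=> x1; elim: p q S s h => [|p IH] q S s h h01 qs sS qp.
  have S0 : 0 <= S by apply: le_trans sS; apply: modc_ge0.
  apply: (@cmean_value0 _ (fun h => (1 - s) * xpow (x + h) s)) => //.
  - exact: taylor_rem00.
  - by move=> y /andP[y0 y1]; apply: cderiv_taylor_rem0; lra.
  - move=> y /andP[y0 y1]; rewrite modcM rem_cst0; apply: ler_pM; rewrite ?modc_ge0 //.
      by have := modc_1sub sS; lra.
    by apply: xpow_shift_le => //; rewrite addr0 in qp *.
have S0 : 0 <= S by apply: le_trans sS; apply: modc_ge0.
apply: (@cmean_value0 _ (fun h => (1 - s) * taylor_rem p x (s + 1) h)) => //.
- exact: taylor_rem00.
- by move=> y /andP[y0 y1]; apply: cderiv_taylor_remS; lra.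
- move=> y /andP[y0 y1]; rewrite modcM rem_cstS -mulrA; apply: ler_pM; rewrite ?modc_ge0 //.
    by have := modc_1sub sS; lra.
  have -> : q + p.+1%:R = (q + 1) + p%:R by rewrite -natr1; ring.
  apply: IH; rewrite ?y0 //.
  + by rewrite raddfD /= lerD2r.
  + exact: modc_add1.
  + by move: qp; rewrite -natr1; lra.
Qed.

(** The same induction on a difference: shifting by 1 preserves [s - w], the factor [1 - s]
    contributes its own variation, and the logarithm comes from the base case. *)
Lemma taylor_rem_lip p q S x s w h : 1 <= x -> 0 <= h <= 1 ->
  q <= complex.Re s -> q <= complex.Re w -> modc s <= S -> modc w <= S -> 0 <= q + p%:R ->
  modc (taylor_rem p x s h - taylor_rem p x w h) <=
    modc (s - w) * (rem_cst p S * (1 + ln (x + 1)) * x `^ (- (q + p%:R))).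
Proof.
move=> x1; elim: p q S s w h => [|p IH] q S s w h h01 qs qw sS wS qp.
  have S0 : 0 <= S by apply: le_trans sS; apply: modc_ge0.
  apply: (@cmean_value0 (fun h => taylor_rem 0 x s h - taylor_rem 0 x w h)
     (fun h => (1 - s) * xpow (x + h) s - (1 - w) * xpow (x + h) w)) => //.
  - by rewrite !taylor_rem00 subrr.
  - by move=> y /andP[y0 y1]; apply: cderivB; apply: cderiv_taylor_rem0; lra.
  - move=> y /andP[y0 y1].
    have -> : (1 - s) * xpow (x + y) s - (1 - w) * xpow (x + y) w =
      (1 - s) * (xpow (x + y) s - xpow (x + y) w) + (w - s) * xpow (x + y) w by ring.
    apply: (le_trans (modcD _ _)); rewrite !modcM (modc_distC w s) rem_cst0.
    rewrite addr0 in qp *.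
    have h1 : modc (xpow (x + y) s - xpow (x + y) w) <= modc (s - w) * (ln (x + 1) * x `^ (- q)).
      apply: (le_trans (xpow_lip _ qs qw)); first by lra.
      rewrite ler_wpM2l ?modc_ge0 //; apply: ler_pM; rewrite ?powR_ge0 ?ln_ge0 //; try lra.
        by rewrite ler_ln ?posrE; lra.
      by apply: powR_antimono; lra.
    have h2 := @xpow_shift_le q w x y x1 y0 qp qw.
    have h3 := modc_1sub sS.
    set P := x `^ (- q) in h1 h2 *; have P0 : 0 <= P by rewrite powR_ge0.
    have L0 : 0 <= ln (x + 1) by rewrite ln_ge0 //; lra.
    have m0 := modc_ge0 (s - w).
    apply: (@le_trans _ _ ((S + 1) * (modc (s - w) * (ln (x + 1) * P)) + modc (s - w) * P)).
      by apply: lerD; [apply: ler_pM; rewrite ?modc_ge0|rewrite ler_wpM2l].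
    have -> : modc (s - w) * ((S + 2) * (1 + ln (x + 1)) * P) = (S + 1) * (modc (s - w) * (ln (x + 1) * P)) + modc (s - w) * P + (modc (s-w) * (S + 1) * P + modc (s-w) * ln (x+1) * P) by ring.
    by rewrite lerDl !addr_ge0 // !mulr_ge0 // addr_ge0.
have S0 : 0 <= S by apply: le_trans sS; apply: modc_ge0.
apply: (@cmean_value0 (fun h => taylor_rem p.+1 x s h - taylor_rem p.+1 x w h)
     (fun h => (1 - s) * taylor_rem p x (s + 1) h - (1 - w) * taylor_rem p x (w + 1) h)) => //.
- by rewrite !taylor_rem00 subrr.
- by move=> y /andP[y0 y1]; apply: cderivB; apply: cderiv_taylor_remS; lra.
- move=> y /andP[y0 y1].
  have -> : (1 - s) * taylor_rem p x (s + 1) y - (1 - w) * taylor_rem p x (w + 1) y =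
      (1 - s) * (taylor_rem p x (s + 1) y - taylor_rem p x (w + 1) y) +
      (w - s) * taylor_rem p x (w + 1) y by ring.
  apply: (le_trans (modcD _ _)); rewrite !modcM (modc_distC w s) rem_cstS.
  have y01 : 0 <= y <= 1 by rewrite y0.
  have qs1 : q + 1 <= complex.Re (s + 1) by rewrite raddfD /= lerD2r.
  have qw1 : q + 1 <= complex.Re (w + 1) by rewrite raddfD /= lerD2r.
  have qp1 : 0 <= q + 1 + p%:R by move: qp; rewrite -natr1; lra.
  have h1 := IH (q + 1) (S + 1) (s + 1) (w + 1) y y01 qs1 qw1 (modc_add1 sS) (modc_add1 wS) qp1.
  have h2 := @taylor_rem_bound p (q + 1) (S + 1) x (w + 1) y x1 y01 qw1 (modc_add1 wS) qp1.
  have E : q + p.+1%:R = (q + 1) + p%:R by rewrite -natr1; ring.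
  rewrite E; have E2 : s + 1 - (w + 1) = s - w by ring.
  rewrite E2 in h1.
  have C0 : 0 <= rem_cst p (S + 1) by apply: rem_cst_ge0; lra.
  set P := x `^ _ in h1 h2 *; have P0 : 0 <= P by rewrite powR_ge0.
  set C := rem_cst _ _ in h1 h2 C0 *.
  have L0 : 0 <= ln (x + 1) by rewrite ln_ge0 //; lra.
  have m0 := modc_ge0 (s - w); have h3 := modc_1sub sS.
  set m := modc (s - w) in h1 m0 *; set L := ln _ in h1 L0 *.
  apply: (@le_trans _ _ ((S + 1) * (m * (C * (1 + L) * P)) + m * (C * P))).
    by apply: lerD; [apply: ler_pM; rewrite ?modc_ge0|rewrite ler_wpM2l].
  have -> : m * ((S + 2) * C * (1 + L) * P) = (S + 1) * (m * (C * (1 + L) * P)) + m * (C * P)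
     + m * C * L * P by ring.
  by rewrite lerDl !mulr_ge0.
Qed.

End Remainder.

(** * Limits of families of holomorphic functions *)

Section Differentiability.
Context {R : realType}.
Implicit Types (z w s : R[i]) (x y h e d q r S M : R) (f g : R[i] -> R[i]).

Definition ccvg (u : nat -> R[i]) (l : R[i]) :=
  forall e, 0 < e -> exists n0, forall n, (n0 <= n)%N -> modc (u n - l) <= e.

Lemma ccvg_unique u k l : ccvg u k -> ccvg u l -> k = l.
Proof.
move=> hk hl; apply/eqP; rewrite -subr_eq0 -modc_eq0 eq_le modc_ge0 andbT.
apply/ler_addgt0Pr => e e0; rewrite add0r.
have e2 : 0 < e / 2 by rewrite divr_gt0.
have [n1 H1] := hk _ e2; have [n2 H2] := hl _ e2.
have := H1 (n1 + n2)%N (leq_addr _ _); have := H2 (n1 + n2)%N (leq_addl _ _).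
rewrite modc_distC => h2 h1.
rewrite (_ : k - l = (k - u (n1 + n2)%N) + (u (n1 + n2)%N - l)); last by ring.
apply: (le_trans (modcD _ _)); rewrite modc_distC (modc_distC _ l); lra.
Qed.

Lemma ccvgB u v k l : ccvg u k -> ccvg v l -> ccvg (fun n => u n - v n) (k - l).
Proof.
move=> hk hl e e0; have e2 : 0 < e / 2 by rewrite divr_gt0.
have [n1 H1] := hk _ e2; have [n2 H2] := hl _ e2.
exists (n1 + n2)%N => n hn.
have h1 := H1 n (leq_trans (leq_addr _ _) hn); have h2 := H2 n (leq_trans (leq_addl _ _) hn).
rewrite (_ : _ - _ = (u n - k) - (v n - l)); last by ring.
by apply: (le_trans (modcB _ _)); lra.
Qed.

Lemma ccvg_majorant u l (phi : nat -> R) N : ccvg u l ->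
  (forall n, (N <= n)%N -> modc (u n.+1 - u n) <= phi n - phi n.+1) ->
  (forall n, 0 <= phi n) ->
  (forall e, 0 < e -> exists n0, forall n, (n0 <= n)%N -> phi n <= e) ->
  forall n, (N <= n)%N -> modc (u n - l) <= phi n.
Proof.
move=> ul hu h0 hphi; have [k hk] := cauchy_majorant hu h0 hphi.
suff -> : l = k by [].
apply: ccvg_unique ul _ => e e0; have [n0 H] := hphi _ e0.
exists (n0 + N)%N => n hn; apply: (le_trans (hk _ (leq_trans (leq_addl _ _) hn))).
exact: H (leq_trans (leq_addr _ _) hn).
Qed.

(** Complex differentiability with real epsilon and delta, so that the estimates stay in real
    arithmetic; [cdiff_derivable] transfers it to [derivable]. *)
Definition cdiff f s (D : R[i]) := forall e, 0 < e -> exists2 d, 0 < d &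
  forall w, modc (w - s) <= d -> modc (f w - f s - D * (w - s)) <= e * modc (w - s).

Lemma cdiff_eq f g s D E : cdiff f s D -> f =1 g -> D = E -> cdiff g s E.
Proof. by move=> h /funext <- <-. Qed.

Lemma cdiff_cst c s : cdiff (fun=> c) s 0.
Proof.
move=> e e0; exists 1 => // w _; rewrite subrr mul0r subrr Normc.normc0.
by rewrite mulr_ge0 ?modc_ge0 // ltW.
Qed.

Lemma cdiff_id s : cdiff id s 1.
Proof.
move=> e e0; exists 1 => // w _; rewrite mul1r subrr Normc.normc0.
by rewrite mulr_ge0 ?modc_ge0 // ltW.
Qed.

Lemma cdiffD f g s D E : cdiff f s D -> cdiff g s E ->
  cdiff (fun w => f w + g w) s (D + E).
Proof.
move=> hf hg e e0; have e2 : 0 < e / 2 by rewrite divr_gt0.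
have [d1 d10 H1] := hf _ e2; have [d2 d20 H2] := hg _ e2.
exists (Num.min d1 d2); first by rewrite lt_min d10.
move=> w; rewrite le_min => /andP[/H1 h1 /H2 h2].
rewrite (_ : _ - _ = (f w - f s - D * (w - s)) + (g w - g s - E * (w - s))); last by ring.
apply: (le_trans (modcD _ _)); lra.
Qed.

Lemma cdiff_lip f s D : cdiff f s D -> exists2 d, 0 < d &
  forall w, modc (w - s) <= d -> modc (f w - f s) <= (modc D + 1) * modc (w - s).
Proof.
move=> /(_ _ ltr01)[d d0 H]; exists d => // w /H h.
rewrite (_ : _ - _ = (f w - f s - D * (w - s)) + D * (w - s)); last by ring.
by apply: (le_trans (modcD _ _)); rewrite modcM; lra.
Qed.

Lemma cdiffM f g s D E : cdiff f s D -> cdiff g s E ->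
  cdiff (fun w => f w * g w) s (D * g s + f s * E).
Proof.
move=> hf hg e e0.
have [dL dL0 HL] := cdiff_lip hf.
pose L := modc D + 1; pose A := modc (f s) + modc (g s) + L * (modc E + 1) + 1.
have D0 := modc_ge0 D; have E0 := modc_ge0 E; have f0 := modc_ge0 (f s); have g0 := modc_ge0 (g s).
have L0 : 0 <= L by rewrite /L; lra.
have LE0 : 0 <= L * (modc E + 1) by rewrite mulr_ge0 //; lra.
have A0 : 0 < A by rewrite /A; lra.
have eA : 0 < e / A by rewrite divr_gt0.
have [d1 d10 H1] := hf _ eA; have [d2 d20 H2] := hg _ eA.
have [d3 d30 H3] := cdiff_lip hg.
(* The entry [e / A] handles the product of the two increments, which is quadratic in [w - s]. *)
exists (Num.min (Num.min dL d3) (Num.min (Num.min d1 d2) (e / A))).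
  by rewrite !lt_min dL0 d30 d10 d20 eA.
move=> w; rewrite !le_min => /andP[/andP[/HL h /H3 h3] /andP[/andP[/H1 h1 /H2 h2] h4]].
rewrite (_ : _ - _ = (f w - f s - D * (w - s)) * g s + f s * (g w - g s - E * (w - s))
   + (f w - f s) * (g w - g s)); last by ring.
apply: (le_trans (modcD _ _)); apply: (@le_trans _ _
   (e / A * modc (w - s) * modc (g s) + modc (f s) * (e / A * modc (w - s)) + e / A * (L * (modc E + 1) * modc (w - s)))).
  apply: lerD.
    apply: (le_trans (modcD _ _)); rewrite !modcM; apply: lerD.
      by rewrite ler_wpM2r.
    by rewrite ler_wpM2l.
  rewrite modcM; apply: (@le_trans _ _ ((L * modc (w - s)) * ((modc E + 1) * modc (w - s)))).
    by apply: ler_pM; rewrite ?modc_ge0.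
  rewrite (_ : _ * _ = modc (w - s) * (L * (modc E + 1) * modc (w - s))); last by ring.
  by rewrite ler_wpM2r // mulr_ge0 ?modc_ge0.
rewrite [leLHS](_ : _ = e / A * (A - 1) * modc (w - s)); last by rewrite /A; ring.
rewrite ler_wpM2r ?modc_ge0 //.
have : e / A * (A - 1) = e - e / A by field; rewrite gt_eqF.
by move=> ->; rewrite lerBlDr lerDl ltW.
Qed.

Lemma cdiff_sum n (F : nat -> R[i] -> R[i]) (D : nat -> R[i]) s :
  (forall i, (i < n)%N -> cdiff (F i) s (D i)) ->
  cdiff (fun w => \sum_(i < n) F i w) s (\sum_(i < n) D i).
Proof.
elim: n => [|n IH] h.
  rewrite big_ord0; apply: (cdiff_eq (cdiff_cst 0 s)) => // y.
  by rewrite big_ord0.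
rewrite big_ord_recr /=; apply: (cdiff_eq (cdiffD (IH _) (h n _))) => //.
  by move=> i in_; apply: h; apply: ltnW.
by move=> y; rewrite big_ord_recr.
Qed.

(** It suffices to test increments in the real direction. *)
Lemma cdiff_modc_le f s D L r : 0 < r -> cdiff f s D ->
  (forall w, modc (w - s) <= r -> modc (f w - f s) <= modc (w - s) * L) -> modc D <= L.
Proof.
move=> r0 hf hL; apply/ler_addgt0Pr => e e0.
have [d d0 H] := hf _ e0.
pose m := Num.min d r; have m0 : 0 < m by rewrite lt_min d0.
pose w := s + m%:C; have ws : w - s = m%:C by rewrite /w addrC addKr.
have wm : modc (w - s) = m by rewrite ws modcR ger0_norm // ltW.
have h1 := H w; have h2 := hL w; rewrite wm in h1 h2.
have md : m <= d by rewrite /m ge_min lexx.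
have mr : m <= r by rewrite /m ge_min lexx orbT.
have {}h1 := h1 md; have {}h2 := h2 mr.
rewrite -(ler_pM2r m0) -[X in modc D * X]wm -modcM.
rewrite (_ : D * (w - s) = (f w - f s) - (f w - f s - D * (w - s))); last by ring.
apply: (le_trans (modcB _ _)); rewrite mulrDl; lra.
Qed.

(* Termwise differentiation needs only summable Lipschitz constants of the terms. *)
Lemma cdiff_lim (F : nat -> R[i] -> R[i]) (H : R[i] -> R[i]) (D : nat -> R[i]) s r
    (phi : nat -> R) N : 0 < r ->
  (forall n, cdiff (F n) s (D n)) ->
  (forall n w, (N <= n)%N -> modc (w - s) <= r ->
     modc ((F n.+1 w - F n w) - (F n.+1 s - F n s)) <= modc (w - s) * (phi n - phi n.+1)) ->
  (forall n, 0 <= phi n) ->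
  (forall e, 0 < e -> exists n0, forall n, (n0 <= n)%N -> phi n <= e) ->
  (forall w, modc (w - s) <= r -> ccvg (F ^~ w) (H w)) ->
  exists d : R[i], cdiff H s d.
Proof.
move=> r0 hF hL h0 hphi hH.
(* The Lipschitz constant of [F n.+1 - F n] at [s] also bounds its derivative there, so the
   derivatives [D n] converge. *)
have hDn n : (N <= n)%N -> modc (D n.+1 - D n) <= phi n - phi n.+1.
  move=> Nn; apply: (@cdiff_modc_le (fun w => F n.+1 w - F n w) s _ _ r) => //.
    have hm : cdiff (fun w => -1 * F n w) s (0 * F n s + -1 * D n).
      exact: cdiffM (cdiff_cst _ _) (hF n).
    apply: (cdiff_eq (cdiffD (hF n.+1) hm)) => [w|]; ring.
  by move=> w; apply: hL.
have [d hd] := cauchy_majorant hDn h0 hphi.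
exists d => e e0; have e4 : 0 < e / 4 by rewrite divr_gt0.
have [n0 Hn0] := hphi _ e4.
pose n := (n0 + N)%N.
have Nn : (N <= n)%N by apply: leq_addl.
have pn : phi n <= e / 4 by apply: Hn0; apply: leq_addr.
have [d1 d10 H1] := hF n _ e4.
exists (Num.min d1 r); first by rewrite lt_min d10.
move=> w; rewrite le_min => /andP[/H1 h1 wr].
have h2 := hd n Nn.
have h3 : modc ((F n w - F n s) - (H w - H s)) <= modc (w - s) * phi n.
  have ss : modc (s - s) <= r by rewrite subrr Normc.normc0 ltW.
  apply: (@ccvg_majorant (fun n => F n w - F n s) (H w - H s) (fun n => modc (w - s) * phi n) N) => //.
  - exact: ccvgB (hH w wr) (hH s ss).
  - move=> k Nk; rewrite -mulrBr (_ : _ - _ = F k.+1 w - F k w - (F k.+1 s - F k s)); last by ring.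
    exact: hL.
  - by move=> k; rewrite mulr_ge0 ?modc_ge0.
  - move=> e' e'0.
    have e3 : 0 < e' / (modc (w - s) + 1) by rewrite divr_gt0 // ltr_wpDl ?modc_ge0.
    have [n1 Hn1] := hphi _ e3; exists n1 => k /Hn1 hk.
    have m0 := modc_ge0 (w - s).
    apply: (@le_trans _ _ ((modc (w - s) + 1) * phi k)).
      by rewrite ler_wpM2r // lerDl.
    by rewrite mulrC -ler_pdivlMr // ltr_wpDl.
have m0 := modc_ge0 (w - s).
have h4 : modc ((D n - d) * (w - s)) <= e / 4 * modc (w - s).
  by rewrite modcM ler_wpM2r //; apply: le_trans h2 pn.
have h5 : modc (w - s) * phi n <= e / 4 * modc (w - s) by rewrite mulrC ler_wpM2r.
rewrite (_ : _ - _ = (F n w - F n s - D n * (w - s)) - ((F n w - F n s) - (H w - H s))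
   + (D n - d) * (w - s)); last by ring.
apply: (le_trans (modcD _ _)).
have h6 := modcB (F n w - F n s - D n * (w - s)) ((F n w - F n s) - (H w - H s)).
have h7 : 0 <= e * modc (w - s) by rewrite mulr_ge0 // ltW.
lra.
Qed.

Lemma cdiff_cexpM (l : R) (c : R[i]) s : cdiff (fun w => cexp (- (w + c) * l%:C)) s (- l%:C * cexp (- (s + c) * l%:C)).
Proof.
move=> e e0.
pose A := `|l| * expR (complex.Re (- (s + c) * l%:C)).
have A0 : 0 <= A by rewrite mulr_ge0 // expR_ge0.
have eA : 0 < e / (A + 1) by rewrite divr_gt0 // ltr_wpDl.
have h1 : 0 < ln (1 + e / (A + 1)) by apply: ln_gt0; rewrite ltrDl.
(* Within this radius the increment [a] of the exponent satisfies
   [expR (modc a) - 1 <= e / (A + 1)], the relative error that [cexp_sub_id_lip] produces. *)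
exists (ln (1 + e / (A + 1)) / (`|l| + 1)).
  by rewrite divr_gt0 // ltr_wpDl.
move=> w hw.
pose a := - (w - s) * l%:C.
have -> : - (w + c) * l%:C = - (s + c) * l%:C + a by rewrite /a; ring.
rewrite cexpD.
rewrite (_ : _ - _ = cexp (- (s + c) * l%:C) * (cexp a - cexp 0 - (a - 0))); last by rewrite cexp0 /a; ring.
rewrite modcM modc_cexp.
have ha : modc a = modc (w - s) * `|l| by rewrite /a modcM modcN modcR.
have ha2 : modc a <= ln (1 + e / (A + 1)).
  rewrite ha; move: hw; rewrite ler_pdivlMr ?ltr_wpDl // => hw; apply: le_trans hw.
  by rewrite ler_wpM2l ?modc_ge0 // lerDl.
have := @cexp_sub_id_lip R a 0 _ ha2; rewrite Normc.normc0 => /(_ (ltW h1)) h2.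
apply: (@le_trans _ _ (expR (complex.Re (- (s + c) * l%:C)) * (modc (a - 0) * (expR (ln (1 + e / (A + 1))) - 1)))).
  by rewrite ler_wpM2l ?expR_ge0.
rewrite lnK ?posrE; last by rewrite addrC ltr_wpDl ?ltW.
rewrite subr0 ha [1 + _]addrC addrK.
rewrite [leLHS](_ : _ = (e * (A / (A + 1))) * modc (w - s)); last by rewrite /A; ring.
rewrite ler_wpM2r ?modc_ge0 // -[leRHS]mulr1 ler_wpM2l ?(ltW e0) //.
by rewrite ler_pdivrMr ?ltr_wpDl // mul1r lerDl.
Qed.

Lemma cdiff_xpow x c s : cdiff (fun w => xpow x (w + c)) s (- (ln x)%:C * xpow x (s + c)).
Proof.
apply: (cdiff_eq (cdiff_cexpM (ln x) c s)) => [w|]; by rewrite xpowE.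
Qed.

Lemma cdiff_derivable (f : Cplx R -> Cplx R) (s : Cplx R) D : cdiff f s D -> derivable f s 1.
Proof.
move=> hf; rewrite /derivable; apply/cvg_ex; exists D.
apply/cvgrPdist_le => e; rewrite ltcE /= => /andP[/eqP ei er].
have [d d0 H] := hf _ er.
near=> h.
have hh : modc h <= d.
  have : `|h| <= d%:C.
    by near: h; apply: (@dnbhs0_le _ (Cplx R)); rewrite ltcR.
  by rewrite modcE lecR.
have h0 : h != 0 by near: h; exact: (@nbhs_dnbhs_neq (Cplx R) 0).
have := H (h *: 1 + s); rewrite addrK.
have -> : h *: (1 : Cplx R) = h by rewrite /GRing.scale /= mulr1.
move=> /(_ hh) h1.
have m0 : 0 < modc h by rewrite lt_def modc_eq0 h0 modc_ge0.
have -> : e = (complex.Re e)%:C by apply/eqP; rewrite eq_complex /= eqxx ei eqxx.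
rewrite modcE lecR.
have -> : D - h^-1 *: (f (h + s) - f s) = - (h^-1 * (f (h + s) - f s - D * h)).
  by rewrite /GRing.scale /=; field.
rewrite modcN modcM modcV mulrC ler_pdivrMr //.
Unshelve. all: by end_near.
Qed.

End Differentiability.

(** * Euler-Maclaurin summation and continuation *)

Section EulerMaclaurin.
Context {R : realType}.
Implicit Types (z w s : R[i]) (x y h e d q r S M C : R) (f g : R[i] -> R[i]).

(* [bernf n] tabulates the first [n] Bernoulli numbers. *)
Fixpoint bernf n : nat -> R[i] := if n is m.+1 then
  fun j => if j == m then (if m == 0 then 1 else
    - (\sum_(i < m) 'C(m.+1, i)%:R * bernf m i) / m.+1%:R) else bernf m j
  else fun=> 0.

Definition bern m := bernf m.+1 m.

Lemma bernfE n j : (j < n)%N -> bernf n j = bern j.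
Proof.
elim: n => // n IH; rewrite ltnS leq_eqVlt => /orP[/eqP->//|jn].
by rewrite /= ltn_eqF // IH.
Qed.

Lemma bern0 : bern 0 = 1. Proof. by rewrite /bern /=. Qed.

(** Together with [bern0], the only property of the Bernoulli numbers used below; it corresponds to
    the convention B_1 = -1/2. *)
Lemma bern_sum n : \sum_(j < n.+1) 'C(n.+1, j)%:R * bern j = (n == 0)%:R.
Proof.
case: n => [|n]; first by rewrite big_ord1 bern0 bin0 mulr1.
rewrite big_ord_recr /= {2}/bern [bernf n.+2 _]/= eqxx /=.
have -> : (\sum_(i < n.+1) 'C(n.+2, i)%:R * bernf n.+1 i) = (\sum_(i < n.+1) 'C(n.+2, i)%:R * bern i).
  by apply: eq_bigr => i _; rewrite bernfE.
rewrite binSn mulrCA divff ?pnatr_eq0 // mulr1 subrr //.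
Qed.

(** Euler-Maclaurin boundary terms for (s - 1) times the sum of (x + k)^(-s) over k >= 0. The term j
    = 0 is the integral; the binomials put it on the same footing as the corrections. *)
Definition em_main m x s := \sum_(j < m) bern j * cbin j s * xpow x (s - 1 + j%:R).

(** With order m - j at the point s + j, every Taylor remainder has the same decay x^(-(Re s +
    m)). *)
Definition em_rem m x s :=
  \sum_(j < m) bern j * cbin j s * taylor_rem (m - j) x (s + j%:R) 1.

Lemma sum_triangle m (F : nat -> nat -> R[i]) :
  \sum_(j < m) \sum_(k < (m - j).+1) F j (j + k)%N =
  \sum_(i < m.+1) \sum_(j < m | (j <= i)%N) F j i.
Proof.
have -> : \sum_(j < m) \sum_(k < (m - j).+1) F j (j + k)%N =
   \sum_(j < m) \sum_(i < m.+1 | (j <= i)%N) F j i.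
  apply: eq_bigr => j _; rewrite -(big_mkord xpredT (fun k => F j (j + k)%N)).
  have E : \sum_(j <= i < m.+1) F j i = \sum_(0 <= i < m.+1 - j) F j (i + j)%N.
    by rewrite -{1}[nat_of_ord j]add0n big_addn.
  rewrite subSn ?(ltnW (ltn_ord j)) // in E.
  rewrite -(big_geq_mkord (nat_of_ord j) m.+1 xpredT (fun i => F j i)) E.
  by apply: eq_bigr => i _; rewrite addnC.
exact: (exchange_big_dep xpredT).
Qed.

(** Expanding the boundary terms at x + 1 around x, the coefficient of x^(1 - s - i) is C(1 - s, i)
    times the sum of C(i, j) B_j over j <= i with j < m. By [bern_sum] this sum is B_i for i < m and
    0 for i = m, plus 1 when i = 1. The B_i rebuild [em_main m x s], and the extra 1 gives (1 - s)
    x^(-s), which cancels the new summand. *)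
Lemma em_step m x s : (0 < m)%N -> 
  (s - 1) * xpow x s + em_main m (x + 1) s - em_main m x s = em_rem m x s.
Proof.
move=> m0; rewrite /em_rem /taylor_rem.
have -> : \sum_(j < m) bern j * cbin j s * (xpow (x + 1) (s + j%:R - 1) -
      \sum_(k < (m - j).+1) cbin k (s + j%:R) * xpow x (s + j%:R - 1 + k%:R) * (1 ^+ k)%:C) =
   em_main m (x + 1) s - \sum_(j < m) \sum_(k < (m - j).+1)
      ('C(j + k, j)%:R * bern j * (cbin (j + k) s * xpow x (s - 1 + (j + k)%:R))).
  rewrite /em_main -sumrB; apply: eq_bigr => j _.
  rewrite mulrBr; congr (_ - _); first by congr (_ * xpow _ _); ring.
  rewrite mulr_sumr; apply: eq_bigr => k _; rewrite expr1n mulr1.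
  have -> : s + j%:R - 1 + k%:R = s - 1 + (j + k)%:R by rewrite natrD; ring.
  transitivity ((cbin j s * cbin k (s + j%:R)) * (bern j * xpow x (s - 1 + (j + k)%:R))); first by ring.
  by rewrite cbinM; ring.
rewrite (sum_triangle m (fun j i => 'C(i, j)%:R * bern j * (cbin i s * xpow x (s - 1 + i%:R)))).
set G := fun i : nat => cbin i s * xpow x (s - 1 + i%:R).
have -> : \sum_(i < m.+1) \sum_(j < m | (j <= i)%N) 'C(i, j)%:R * bern j * (cbin i s * xpow x (s - 1 + i%:R))
   = \sum_(i < m) bern i * G i + \sum_(i < m.+1) (nat_of_ord i == 1)%:R * G i.
  rewrite !(big_ord_recr m) /= addrA; congr (_ + _).
    rewrite -big_split /=; apply: eq_bigr => i _.
    have -> : \sum_(j < m | (j <= i)%N) 'C(i, j)%:R * bern j * (cbin i s * xpow x (s - 1 + i%:R)) =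
        \sum_(j < i.+1) 'C(i, j)%:R * bern j * G i.
      by rewrite (big_ord_widen m (fun j => 'C(i, j)%:R * bern j * G i)).
    rewrite big_ord_recr /= binn mul1r addrC; congr (_ + _).
    rewrite -mulr_suml; congr (_ * _).
    case: (nat_of_ord i) => [|n]; first by rewrite big_ord0.
    by rewrite bern_sum eqSS.
  have -> : \sum_(j < m | (j <= m)%N) 'C(m, j)%:R * bern j * (cbin m s * xpow x (s - 1 + m%:R)) =
     \sum_(j < m) 'C(m, j)%:R * bern j * G m.
    by apply: eq_bigl => j; rewrite ltnW.
  rewrite -mulr_suml; congr (_ * _); case: (m) m0 => // n _.
  by rewrite bern_sum eqSS.
have -> : \sum_(i < m.+1) (nat_of_ord i == 1)%:R * G i = (1 - s) * xpow x s.
  have l1 : (1 < m.+1)%N by [].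
  rewrite (bigD1 (Ordinal l1)) //= big1 ?addr0; last first.
    move=> i hi; rewrite (_ : (nat_of_ord i == 1) = false) ?mul0r //.
    by apply: contraNF hi => /eqP hi; apply/eqP/val_inj.
  by rewrite mul1r /G cbin1 subrK.
have -> : \sum_(i < m) bern i * G i = em_main m x s.
  by apply: eq_bigr => i _; rewrite /G mulrA.
ring.
Qed.

Definition good S (f : R[i] -> R[i]) C := forall s w, modc s <= S -> modc w <= S ->
  modc (f s) <= C /\ modc (f s - f w) <= modc (s - w) * C.

Lemma cbinSr k s : cbin k.+1 s = cbin k s * ((1 - s - k%:R) / k.+1%:R).
Proof.
rewrite /cbin big_ord_recr /= factS natrM invfM.
move: (\prod_(i < k) _) (k.+1%:R^-1) (k`!%:R^-1) => *; ring.
Qed.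

Lemma cbin_good S j : 0 <= S -> exists2 C, 0 <= C & good S (cbin j) C.
Proof.
move=> S0; elim: j => [|j [C C0 hC]].
  exists 1 => // s w _ _; rewrite !cbin0 Normc.normc1 subrr Normc.normc0 mulr1.
  by rewrite modc_ge0.
have k0 : 0 <= S + 1 + j%:R by rewrite !addr_ge0.
exists (C * (S + 1 + j%:R) + C); first by rewrite addr_ge0 // mulr_ge0.
move=> s w sS wS; have [h1 h2] := hC _ _ sS wS; have [h3 _] := hC _ _ wS wS.
have i1 : modc (j.+1%:R^-1 : R[i]) <= 1.
  by rewrite modcV modc_nat invf_le1 ?ltr0n // ler1n.
have hl t : modc t <= S -> modc ((1 - t - j%:R) / j.+1%:R) <= S + 1 + j%:R.
  move=> tS; rewrite modcM -[leRHS]mulr1; apply: ler_pM; rewrite ?modc_ge0 //.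
  apply: (le_trans (modcB _ _)); rewrite modc_nat lerD2r.
  by apply: modc_1sub.
have M0 := modc_ge0 (s - w).
split.
  rewrite cbinSr modcM; apply: (@le_trans _ _ (C * (S + 1 + j%:R))); last by rewrite lerDl.
  by apply: ler_pM; rewrite ?modc_ge0 // hl.
rewrite !cbinSr.
have -> : cbin j s * ((1 - s - j%:R) / j.+1%:R) - cbin j w * ((1 - w - j%:R) / j.+1%:R) =
  (cbin j s - cbin j w) * ((1 - s - j%:R) / j.+1%:R) + cbin j w * ((w - s) / j.+1%:R).
  move: (j.+1%:R^-1) => *; ring.
apply: (le_trans (modcD _ _)); rewrite !modcM -!modcM mulrDr; apply: lerD.
  rewrite [leRHS]mulrA modcM; apply: ler_pM; rewrite ?modc_ge0 // hl //.
rewrite [leRHS]mulrC modcM; apply: ler_pM; rewrite ?modc_ge0 //.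
rewrite modcM modc_distC -[leRHS]mulr1; apply: ler_pM; rewrite ?modc_ge0 //.
Qed.

(** Bounding differences is enough: [em_rem] vanishes at s = 1 ([em_rem1]), so w = 1 yields a bound
    on the size. The constant does not depend on [x]. *)
Lemma em_rem_bound m S : 0 <= S -> exists2 C, 0 <= C & forall x q s w, 1 <= x ->
  modc s <= S -> modc w <= S -> q <= complex.Re s -> q <= complex.Re w -> 0 <= q + m%:R ->
  modc (em_rem m x s - em_rem m x w) <= modc (s - w) * (C * (1 + ln (x + 1)) * x `^ (- (q + m%:R))).
Proof.
move=> S0.
(* The condition [j < m] stands behind the constant so that [choice] can range over all [j]. *)
have hj : forall j : nat, exists C, 0 <= C /\ ((j < m)%N -> forall x q s w, 1 <= x ->
  modc s <= S -> modc w <= S -> q <= complex.Re s -> q <= complex.Re w -> 0 <= q + m%:R ->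
  modc (bern j * cbin j s * taylor_rem (m - j) x (s + j%:R) 1 - 
    bern j * cbin j w * taylor_rem (m - j) x (w + j%:R) 1) <=
    modc (s - w) * (C * (1 + ln (x + 1)) * x `^ (- (q + m%:R)))).
  move=> j; have [C C0 hC] := cbin_good j S0.
  have Sj : 0 <= S + j%:R by rewrite addr_ge0.
  have T0 := rem_cst_ge0 (m - j) Sj; set T := rem_cst _ _ in T0.
  have b0 := modc_ge0 (bern j).
  exists (modc (bern j) * (C * T + C * T)); split; first by rewrite mulr_ge0 // addr_ge0 // mulr_ge0.
  move=> jm x q s w x1 sS wS qs qw qm.
  have [h1 h2] := hC _ _ sS wS; have [h3 _] := hC _ _ wS wS.
  have aux t : modc t <= S -> modc (t + j%:R) <= S + j%:R.
    by move=> h; apply: (le_trans (modcD _ _)); rewrite modc_nat lerD2r.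
  have aux2 t : q <= complex.Re t -> q + j%:R <= complex.Re (t + j%:R).
    by rewrite raddfD /= => h; rewrite -(rmorph_nat (real_complex R)) lerD2r.
  have E : q + j%:R + (m - j)%:R = q + m%:R by rewrite -addrA -natrD subnKC // ltnW.
  have i01 : 0 <= (1 : R) <= 1 by rewrite ler01 lexx.
  have h4 := @taylor_rem_bound R (m - j) (q + j%:R) (S + j%:R) x (w + j%:R) 1 x1 i01 (aux2 _ qw) (aux _ wS).
  have h5 := @taylor_rem_lip R (m - j) (q + j%:R) (S + j%:R) x (s + j%:R) (w + j%:R) 1 x1 i01
     (aux2 _ qs) (aux2 _ qw) (aux _ sS) (aux _ wS).
  rewrite E in h4 h5; have {}h4 := h4 qm; have {}h5 := h5 qm; rewrite -/T in h4 h5.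
  have E2 : s + j%:R - (w + j%:R) = s - w by ring.
  rewrite E2 in h5.
  have -> : bern j * cbin j s * taylor_rem (m - j) x (s + j%:R) 1 - 
    bern j * cbin j w * taylor_rem (m - j) x (w + j%:R) 1 =
    bern j * (cbin j s * (taylor_rem (m - j) x (s + j%:R) 1 - taylor_rem (m - j) x (w + j%:R) 1)
      + (cbin j s - cbin j w) * taylor_rem (m - j) x (w + j%:R) 1) by ring.
  rewrite modcM.
  set P := x `^ _ in h4 h5 *; have P0 : 0 <= P by rewrite powR_ge0.
  have L0 : 0 <= ln (x + 1) by rewrite ln_ge0 //; lra.
  set L := ln _ in h5 L0 *.
  set mm := modc (s - w) in h2 h5 *; have mm0 : 0 <= mm by rewrite modc_ge0.
  have -> : mm * (modc (bern j) * (C * T + C * T) * (1 + L) * P) =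
     modc (bern j) * (C * (mm * (T * (1 + L) * P)) + mm * C * (T * P) + mm * C * (T * P) * L) by ring.
  rewrite ler_wpM2l //; apply: (le_trans (modcD _ _)).
  rewrite (modcM (cbin j s)) (modcM (cbin j s - cbin j w)) -[X in _ <= X]addrA; apply: lerD.
    by apply: ler_pM; rewrite ?modc_ge0.
  apply: (@le_trans _ _ (mm * C * (T * P))).
    by apply: ler_pM; rewrite ?modc_ge0.
  by rewrite lerDl !mulr_ge0.
have [C hC] := choice hj.
exists (\sum_(j < m) C j).
  by apply: sumr_ge0 => j _; have [] := hC j.
move=> x q s w x1 sS wS qs qw qm.
rewrite /em_rem -sumrB; apply: (le_trans (modc_sum _ _ _)).
rewrite !mulr_suml mulr_sumr; apply: ler_sum => j _.
have [_ H] := hC j; exact: H.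
Qed.

Lemma cdiff_cbin j s : exists d : R[i], cdiff (cbin j) s d.
Proof.
elim: j => [|j [d hd]].
  exists 0; apply: (cdiff_eq (cdiff_cst 1 s)) => // w; by rewrite cbin0.
have h : cdiff (fun w => (1 - j%:R) / j.+1%:R + (- 1 / j.+1%:R) * w) s (0 + (0 * s + (- 1 / j.+1%:R) * 1)).
  exact: cdiffD (cdiff_cst _ _) (cdiffM (cdiff_cst _ _) (cdiff_id _)).
eexists; apply: (cdiff_eq (cdiffM hd h)); last reflexivity.
by move=> w; rewrite cbinSr; congr (_ * _); move: (j.+1%:R^-1) => *; ring.
Qed.

Lemma cdiff_em_main m x s : exists d : R[i], cdiff (em_main m x) s d.
Proof.
have H : forall j, exists d : R[i], cdiff (fun w => bern j * cbin j w * xpow x (w - 1 + j%:R)) s d.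
  move=> j; have [d hd] := cdiff_cbin j s.
  eexists; apply: (cdiff_eq (cdiffM (cdiffM (cdiff_cst (bern j) s) hd) (cdiff_xpow x (- 1 + j%:R) s))).
    by move=> w; rewrite addrA.
  reflexivity.
have [d hd] := choice H.
exists (\sum_(j < m) d j).
by apply: (@cdiff_sum R m (fun j w => bern j * cbin j w * xpow x (w - 1 + j%:R)) d) => j _; apply: hd.
Qed.

End EulerMaclaurin.

(** * Construction of the Hurwitz zeta function through its entire part *)

Section Hurwitz.
Context {R : realType}.
Implicit Types (z w s : R[i]) (x y h e d q r S M C : R) (f g : R[i] -> R[i]).

Lemma Re_nat n : complex.Re (n%:R : R[i]) = n%:R.
Proof. by rewrite -(rmorph_nat (real_complex R)). Qed.

Lemma powR_add x q r : 0 < x -> x `^ q * x `^ r = x `^ (q + r).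
Proof. by move=> x0; rewrite powRD // lt0r_neq0 ?implybT. Qed.

(** The factor [s - 1] removes the pole, so that the limit is entire. *)
Definition em_sum m (alpha : R) n s :=
  (s - 1) * \sum_(k < n) xpow (k%:R + alpha) s + em_main m (n%:R + alpha) s.

Lemma em_sumS m alpha n s : (0 < m)%N ->
  em_sum m alpha n.+1 s - em_sum m alpha n s = em_rem m (n%:R + alpha) s.
Proof.
move=> m0; rewrite -(em_step _ _ m0) /em_sum big_ord_recr /= -natr1.
have -> : n%:R + 1 + alpha = n%:R + alpha + 1 by ring.
ring.
Qed.

(** At s = 1 only the term j = 0 of [em_main] survives, and it is the constant 1. *)
Lemma em_rem1 m x : (0 < m)%N -> em_rem m x 1 = 0.
Proof.
move=> m0; rewrite -em_step // subrr mul0r add0r.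
have E y : em_main m y 1 = 1.
  rewrite /em_main; case: m m0 => // n _; rewrite big_ord_recl big1 => [|i _].
    by rewrite bern0 cbin0 subrr !mul1r !addr0 xpowE oppr0 mul0r cexp0.
  by rewrite lift0 /cbin big_ord_recl !subrr !mul0r mulr0 mul0r.
by rewrite !E subrr.
Qed.

Lemma natr_unbounded x : exists n : nat, x <= n%:R.
Proof.
exists (Num.bound `|x|); apply: (le_trans (ler_norm _)).
by apply: ltW; apply: archi_boundP.
Qed.

Lemma powR_small_nat d e C alpha : 0 < alpha -> 0 < d -> 0 < e -> 0 <= C ->
  exists n0, forall n, (n0 <= n)%N -> C * (n%:R + alpha) `^ (- d) <= e.
Proof.
move=> a0 d0 e0 C0.
have eC : 0 < e / (C + 1) by rewrite divr_gt0 // ltr_wpDl.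
have [N N1 H] := powR_small d0 eC.
have [n0 hn0] := natr_unbounded N.
exists n0 => n nn.
have h : N <= n%:R + alpha.
  apply: (le_trans hn0); apply: (@le_trans _ _ n%:R); first by rewrite ler_nat.
  by rewrite lerDl ltW.
have := H _ h; rewrite ler_pdivlMr ?ltr_wpDl // => h2; apply: le_trans h2.
by rewrite mulrC ler_wpM2l ?powR_ge0 // lerDl.
Qed.

(** The condition Re s + m >= 3 provides x^(-3); the logarithm takes one power, and x^(-2)
    telescopes against 1 / x. *)
Lemma em_sum_lip m alpha S : (0 < m)%N -> 0 < alpha -> 0 <= S ->
  exists2 C, 0 <= C & forall n s w, (0 < n)%N -> modc s <= S -> modc w <= S ->
    3 <= complex.Re s + m%:R -> 3 <= complex.Re w + m%:R ->
    modc (em_rem m (n%:R + alpha) s - em_rem m (n%:R + alpha) w) <=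
     modc (s - w) * (C * (n%:R + alpha) `^ (- 1) - C * (n.+1%:R + alpha) `^ (- 1)).
Proof.
move=> m0 a0 S0; have [C C0 hC] := em_rem_bound m S0.
(* The 3 is 1 + 2 / e of [log_powR] at e = 1; the last factor is the constant of [powR_tele] at d =
   1. *)
exists (C * 3 * (2 `^ (1 + 1) / 1)).
  by rewrite !mulr_ge0 ?divr_ge0 ?powR_ge0.
move=> n s w n0 sS wS s3 w3.
have x1 : 1 <= n%:R + alpha by rewrite -[leLHS]addr0 lerD ?ler1n // ltW.
have E : n.+1%:R + alpha = n%:R + alpha + 1 by rewrite -natr1; ring.
rewrite E; set x := n%:R + alpha in x1 *.
have x0 : 0 < x by lra.
have p3 : 0 <= (3 : R) by [].
have := hC x (3 - m%:R) s w x1 sS wS.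
rewrite subrK !lerBlDr => /(_ s3 w3 p3) h.
apply: (le_trans h).
rewrite ler_wpM2l ?modc_ge0 // -mulrBr -!mulrA ler_wpM2l //.
have t := @powR_tele R 1 x ltr01 x1.
have l := @log_powR R 1 x ltr01 (lexx _) x1.
apply: (@le_trans _ _ (3 * x `^ (- 1 - 1))); last by rewrite ler_wpM2l // mulrA.
have -> : 3 * x `^ (- 1 - 1) = (3 * x `^ 1) * x `^ (- 3).
  by rewrite -mulrA powR_add //; congr (3 * powR x _); ring.
rewrite ler_wpM2r ?powR_ge0 //; apply: (le_trans l).
by rewrite ler_wpM2r ?powR_ge0 // divr1; lra.
Qed.

(** Consecutive orders differ by a multiple of x^(1 - s - m), which tends to 0. Hence the limit does
    not depend on the order. *)
Lemma em_main_step m alpha s : 0 < alpha -> 1 < complex.Re s + m%:R ->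
  ccvg (fun n => em_sum m.+1 alpha n s - em_sum m alpha n s) 0.
Proof.
move=> a0 h e e0.
have d0 : 0 < complex.Re s + m%:R - 1 by lra.
have [n0 H] := powR_small_nat a0 d0 e0 (modc_ge0 (bern m * cbin m s)).
exists n0.+1 => n hn; rewrite subr0 /em_sum /em_main big_ord_recr /=.
rewrite opprD addrACA subrr add0r addrAC subrr add0r.
rewrite modcM modc_xpow; last by rewrite ltr_wpDl.
have -> : - complex.Re (s - 1 + m%:R) = - (complex.Re s + m%:R - 1).
  by rewrite !raddfD raddfN /= Re_nat; ring.
by apply: H; apply: ltnW.
Qed.

(** The Lipschitz bound is applied between [s] and 1, where the increments vanish; the last
    condition puts the point 1 in the admissible half-plane. *)
Lemma em_sum_cvg_exists m alpha s : (0 < m)%N -> 0 < alpha -> 3 <= complex.Re s + m%:R ->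
  3 <= 1 + m%:R :> R ->
  exists l, ccvg (fun n => em_sum m alpha n s) l.
Proof.
move=> m0 a0 s3 m3.
have S0 : 0 <= modc s + 1 by rewrite addr_ge0 // modc_ge0.
have [C C0 hC] := em_sum_lip m0 a0 S0.
pose phi n := modc (s - 1) * (C * (n%:R + alpha) `^ (- 1)).
have p0 n : 0 <= phi n by rewrite !mulr_ge0 ?modc_ge0 ?powR_ge0.
have p1 e : 0 < e -> exists n0, forall n, (n0 <= n)%N -> phi n <= e.
  move=> e0; have [n0 H] := @powR_small_nat 1 e (modc (s - 1) * C) alpha a0 ltr01 e0 (mulr_ge0 (modc_ge0 _) C0).
  by exists n0 => n /H; rewrite /phi mulrA.
have [l hl] : exists l, forall n, (1 <= n)%N -> modc (em_sum m alpha n s - l) <= phi n.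
  apply: cauchy_majorant => // n n0.
  have h1 : modc s <= modc s + 1 by rewrite lerDl.
  have h2 : modc (1 : R[i]) <= modc s + 1 by rewrite Normc.normc1 lerDr modc_ge0.
  have := hC n s 1 n0 h1 h2 s3 m3.
  by rewrite em_rem1 // subr0 em_sumS // /phi mulrBr.
exists l => e e0; have [n0 H] := p1 e e0.
exists n0.+1 => n hn; apply: (le_trans (hl n _)); first exact: leq_trans hn.
by apply: H; apply: ltnW.
Qed.

Lemma ccvg_near (u v : nat -> R[i]) l : ccvg u l -> ccvg (fun n => v n - u n) 0 -> ccvg v l.
Proof.
move=> hu huv e e0; have e2 : 0 < e / 2 by rewrite divr_gt0.
have [n1 H1] := hu _ e2; have [n2 H2] := huv _ e2.
exists (n1 + n2)%N => n hn.
have h1 := H1 n (leq_trans (leq_addr _ _) hn); have h2 := H2 n (leq_trans (leq_addl _ _) hn).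
rewrite subr0 in h2.
rewrite (_ : v n - l = (v n - u n) + (u n - l)); last by ring.
by apply: (le_trans (modcD _ _)); lra.
Qed.

Lemma ccvg_sub_sym (u v : nat -> R[i]) : ccvg (fun n => u n - v n) 0 -> ccvg (fun n => v n - u n) 0.
Proof.
by move=> h e /h[n0 H]; exists n0 => n /H; rewrite !subr0 modc_distC.
Qed.

Lemma em_sum_cvg_ge m k alpha s l : 0 < alpha -> 1 < complex.Re s + m%:R ->
  ccvg (fun n => em_sum (m + k) alpha n s) l <-> ccvg (fun n => em_sum m alpha n s) l.
Proof.
move=> a0 h; elim: k => [|k IH]; first by rewrite addn0.
have h2 : 1 < complex.Re s + (m + k)%:R by apply: (lt_le_trans h); rewrite lerD2l ler_nat leq_addr.
have E := @em_main_step (m + k) alpha s a0 h2.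
rewrite -IH addnS; split => H; last exact: ccvg_near H E.
exact: ccvg_near H (ccvg_sub_sym E).
Qed.

Lemma hurwitz_entire_exists alpha : 0 < alpha -> exists H : R[i] -> R[i],
  forall s m, (0 < m)%N -> 1 < complex.Re s + m%:R -> ccvg (fun n => em_sum m alpha n s) (H s).
Proof.
move=> a0.
suff h : forall s, exists l, forall m, (0 < m)%N -> 1 < complex.Re s + m%:R ->
    ccvg (fun n => em_sum m alpha n s) l.
  by have [H HH] := choice h; exists H.
move=> s.
have [k hk] := natr_unbounded (3 - complex.Re s).
pose M := (k + 2)%N.
have M3 : 3 <= complex.Re s + M%:R by rewrite /M natrD; lra.
have M1 : 3 <= 1 + M%:R :> R by rewrite /M natrD; have : 0 <= k%:R :> R by []; lra.
have M0 : (0 < M)%N by rewrite /M addn2.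
have [l hl] := em_sum_cvg_exists M0 a0 M3 M1.
exists l => m m0 hm.
(* The orders [m] and [M] are both compared with [m + M]. *)
have h := (em_sum_cvg_ge M l a0 hm).1; apply: h.
have h1 : 1 < complex.Re s + M%:R by lra.
by rewrite addnC; apply: (em_sum_cvg_ge m l a0 h1).2.
Qed.

Lemma cdiff_em_sum m alpha n s : exists d : R[i], cdiff (em_sum m alpha n) s d.
Proof.
have [d hd] := cdiff_em_main m (n%:R + alpha) s.
have h1 : cdiff (fun w => \sum_(k < n) xpow (k%:R + alpha) w) s
    (\sum_(k < n) - (ln (k%:R + alpha))%:C * xpow (k%:R + alpha) s).
  apply: (@cdiff_sum R n (fun k w => xpow (k%:R + alpha) w)
    (fun k => - (ln (k%:R + alpha))%:C * xpow (k%:R + alpha) s)) => k _.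
  by apply: (cdiff_eq (cdiff_xpow (k%:R + alpha) 0 s)) => [w|]; rewrite addr0.
eexists; exact: (cdiffD (cdiffM (cdiffD (cdiff_id s) (cdiff_cst (- 1) s)) h1) hd).
Qed.

Lemma cdiff_hurwitz_entire alpha (H : R[i] -> R[i]) : 0 < alpha ->
  (forall s m, (0 < m)%N -> 1 < complex.Re s + m%:R -> ccvg (fun n => em_sum m alpha n s) (H s)) ->
  forall s, exists d : R[i], cdiff H s d.
Proof.
move=> a0 hH s.
(* One more than the 3 of [em_sum_lip], which leaves room for the disc of radius 1 around [s]. *)
have [k hk] := natr_unbounded (4 - complex.Re s).
pose m := k.+1.
have m4 : 4 <= complex.Re s + m%:R by rewrite /m -natr1; lra.
have S0 : 0 <= modc s + 1 by rewrite addr_ge0 // modc_ge0.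
have [C C0 hC] := @em_sum_lip m alpha _ isT a0 S0.
have [D hD] := choice (fun n => cdiff_em_sum m alpha n s).
have near w : modc (w - s) <= 1 -> modc w <= modc s + 1 /\ 3 <= complex.Re w + m%:R.
  move=> h; split.
    rewrite -(subrK s w); apply: (le_trans (modcD _ _)); lra.
  have := le_trans (modc_Re (w - s)) h; rewrite raddfB /= ler_norml => /andP[h1 _]; lra.
apply: (@cdiff_lim R (fun n => em_sum m alpha n) H D s 1 (fun n => C * (n%:R + alpha) `^ (- 1)) 1) => //.
- move=> n w n0 /near [h1 h2]; rewrite !em_sumS //.
  by apply: hC => //; [rewrite lerDl|lra].
- by move=> n; rewrite mulr_ge0 ?powR_ge0.
- by move=> e e0; apply: powR_small_nat.
- by move=> w /near [h1 h2]; apply: hH => //; lra.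
Qed.

Lemma cdiff_inv_sub1 s : s != 1 -> exists d : R[i], cdiff (fun w => (w - 1)^-1) s d.
Proof.
move=> s1; have n1 : s - 1 != 0 by rewrite subr_eq0.
exists (- (s - 1)^-1 * (s - 1)^-1) => e e0.
set m := modc (s - 1); have m0 : 0 < m by rewrite lt_def modc_eq0 n1 modc_ge0.
(* [m / 2] keeps [w - 1] away from 0. The error is then (w - s)^2 / ((w - 1) (s - 1)^2), at most 2
   |w - s|^2 / m^3, whence the second entry. *)
exists (Num.min (m / 2) (e * (m ^+ 3 / 2))).
  by rewrite lt_min divr_gt0 // mulr_gt0 // divr_gt0 // exprn_gt0.
move=> w; rewrite le_min => /andP[h1 h2].
have hw : m / 2 <= modc (w - 1).
  have : m <= modc (w - s) + modc (w - 1).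
    rewrite /m (_ : s - 1 = (w - 1) - (w - s)); last by ring.
    by apply: (le_trans (modcB _ _)); rewrite addrC.
  lra.
have w0 : w - 1 != 0 by rewrite -modc_eq0 gt_eqF //; apply: lt_le_trans hw; lra.
have -> : (w - 1)^-1 - (s - 1)^-1 - - (s - 1)^-1 * (s - 1)^-1 * (w - s) =
   (w - s) * (w - s) * ((w - 1)^-1 * ((s - 1)^-1 * (s - 1)^-1)).
  by field; rewrite n1 w0.
rewrite 2!modcM -mulrA mulrC ler_wpM2r ?modc_ge0 //.
rewrite 2!modcM !modcV -/m.
apply: (@le_trans _ _ (e * (m ^+ 3 / 2) * ((m / 2)^-1 * (m^-1 * m^-1)))).
  apply: ler_pM => //; rewrite ?modc_ge0 ?mulr_ge0 ?invr_ge0 ?modc_ge0 ?(ltW m0) //.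
  apply: ler_wpM2r; first by rewrite mulr_ge0 ?invr_ge0 ?(ltW m0).
  by rewrite lef_pV2 ?posrE //; [apply: lt_le_trans hw|]; lra.
by rewrite le_eqVlt; apply/orP; left; apply/eqP; field; rewrite gt_eqF.
Qed.

Lemma ccvg_cvg (u : nat -> Cplx R) (l : Cplx R) : ccvg u l -> u @ \oo --> l.
Proof.
move=> hu; apply/cvgrPdist_le => e; rewrite ltcE /= => /andP[/eqP ei er].
have [n0 H] := hu _ er; exists n0 => // n /= /H h.
have -> : e = (complex.Re e)%:C by apply/eqP; rewrite eq_complex /= eqxx ei eqxx.
by rewrite modcE lecR modc_distC.
Qed.

(** For Re s > 1 order 1 suffices: its only boundary term x^(1 - s) tends to 0. At 1, [H] itself
    witnesses a pole of order at most 1. *)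
Lemma is_hurwitz_zetaP alpha (H : R[i] -> R[i]) : 0 < alpha ->
  (forall s m, (0 < m)%N -> 1 < complex.Re s + m%:R -> ccvg (fun n => em_sum m alpha n s) (H s)) ->
  is_hurwitz_zeta alpha (fun s => H s / (s - 1)).
Proof.
move=> a0 hH.
have dH := cdiff_hurwitz_entire a0 hH.
split.
- move=> s s1; apply: ccvg_cvg => e e0.
  have sn : s - 1 != 0.
    by rewrite subr_eq0; apply: contraTneq s1 => ->; rewrite ltxx.
  have ms : 0 < modc (s - 1) by rewrite lt_def modc_eq0 sn modc_ge0.
  have e2 : 0 < e * modc (s - 1) / 2 by rewrite divr_gt0 // mulr_gt0.
  have [|n1 H1] := hH s 1 isT _ _ e2; first by lra.
  have d0 : 0 < complex.Re s - 1 by lra.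
  have [n2 H2] := @powR_small_nat _ _ 1 _ a0 d0 e2 ler01.
  exists (n1 + n2)%N => n hn.
  have h1 := H1 n (leq_trans (leq_addr _ _) hn); have h2 := H2 n (leq_trans (leq_addl _ _) hn).
  have -> : series (fun n => cpowR (n%:R + alpha) (- s) : Cplx R) n = \sum_(k < n) xpow (k%:R + alpha) s.
    rewrite /series /= big_mkord; apply: eq_bigr => k _.
    by rewrite cpowRE ?xpowE // ltr_wpDl.
  rewrite -(ler_pM2r ms) -modcM mulrBl divfK //.
  have -> : (\sum_(k < n) xpow (k%:R + alpha) s) * (s - 1) - H s =
     (em_sum 1 alpha n s - H s) - xpow (n%:R + alpha) (s - 1).
    by rewrite /em_sum /em_main big_ord1 bern0 cbin0 !mul1r addr0; ring.
  apply: (le_trans (modcB _ _)); rewrite modc_xpow; last by rewrite ltr_wpDl.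
  rewrite mul1r in h2; rewrite raddfB /=; lra.
- move=> s s1; have [d hd] := dH s; have [d2 hd2] := cdiff_inv_sub1 s1.
  exact: cdiff_derivable (cdiffM hd hd2).
- exists 1%N, H; split.
    by near=> w; have [d hd] := dH w; apply: cdiff_derivable hd.
  by near=> w; rewrite expr1.
Unshelve. all: by end_near.
Qed.

End Hurwitz.

(** * Approximation by partial sums of length T^2 at height T *)

Section Approximation.
Context {R : realType}.
Implicit Types (z w s : R[i]) (x y h e d q r S M C alpha : R) (f g : R[i] -> R[i]).

(* [H s] is [(s - 1) * zeta(s, alpha)]; the Euler-Maclaurin approximation of order [m]
   converges to it for Re s > 1 - m. *)
Definition is_entire_part alpha (H : R[i] -> R[i]) := forall s m, (0 < m)%N ->
  1 < complex.Re s + m%:R -> ccvg (fun n => em_sum m alpha n s) (H s).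

Lemma em_rem_1 x s : em_rem 1 x s = taylor_rem 1 x s 1.
Proof. by rewrite /em_rem big_ord1 bern0 cbin0 !mul1r addr0. Qed.

Lemma rem_cst1 S : rem_cst 1 S = (S + 2) * (S + 3) :> R.
Proof. by rewrite /rem_cst !big_ord_recl big_ord0 mulr1 addr0 lift0 /= -!addrA. Qed.

(** 17 is 1 + 2 / e of [log_powR] at e = 1/8, the rest is the constant of [powR_tele] at d = 5/8:
    the exponent 3/4 + 1 loses 1/8 to the logarithm. *)
Definition tail_cst : R := 17 * (2 `^ (5 / 8 + 1) / (5 / 8)).

Lemma tail_cst_ge0 : 0 <= tail_cst.
Proof. by rewrite mulr_ge0 ?divr_ge0 ?powR_ge0. Qed.

Lemma log_tele x : 1 <= x -> (1 + ln (x + 1)) * x `^ (- (3 / 4 + 1%:R)) <=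
  tail_cst * x `^ (- (5 / 8)) - tail_cst * (x + 1) `^ (- (5 / 8)).
Proof.
move=> x1; have d0 : (0 : R) < 5 / 8 by lra.
have e0 : (0 : R) < 1 / 8 by lra.
have e1 : (1 / 8 : R) <= 1 by lra.
have t := @powR_tele R (5/8) x d0 x1.
have l := @log_powR R (1 / 8) x e0 e1 x1.
rewrite -mulrBr /tail_cst -mulrA.
apply: (@le_trans _ _ (17 * x `^ (- (5 / 8) - 1))); last by rewrite ler_wpM2l.
have -> : 17 * x `^ (- (5 / 8) - 1) = (17 * x `^ (1 / 8)) * x `^ (- (3 / 4 + 1%:R)).
  rewrite -mulrA powR_add; last by lra.
  by congr (17 * powR x _); lra.
rewrite ler_wpM2r ?powR_ge0 //; apply: (le_trans l).
by rewrite ler_wpM2r ?powR_ge0 //; lra.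
Qed.

Lemma shift1 n alpha : n.+1%:R + alpha = n%:R + alpha + 1 :> R.
Proof. by rewrite -natr1; ring. Qed.

Lemma shift_ge1 n alpha : 0 < alpha -> (0 < n)%N -> 1 <= n%:R + alpha.
Proof. by move=> a0 n0; rewrite -[leLHS]addr0 lerD ?ler1n // ltW. Qed.

(** The dependence on [S] has to be explicit: it is quadratic, and this dictates partial sums of
    length T^2 at height T. *)
Lemma entire_part_lip alpha H n S s w : 0 < alpha -> is_entire_part alpha H -> (0 < n)%N ->
  3 / 4 <= complex.Re s -> 3 / 4 <= complex.Re w -> modc s <= S -> modc w <= S ->
  modc ((em_sum 1 alpha n s - H s) - (em_sum 1 alpha n w - H w)) <=
    modc (s - w) * ((S + 2) * (S + 3) * (tail_cst * (n%:R + alpha) `^ (- (5 / 8)))).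
Proof.
move=> a0 hH n0 rs rw sS wS.
have S0 : 0 <= S by apply: le_trans sS; apply: modc_ge0.
rewrite (_ : _ - _ = (em_sum 1 alpha n s - em_sum 1 alpha n w) - (H s - H w)); last by ring.
pose phi n := modc (s - w) * ((S + 2) * (S + 3) * (tail_cst * (n%:R + alpha) `^ (- (5 / 8)))).
have P0 : 0 <= modc (s - w) * ((S + 2) * (S + 3) * tail_cst).
  by rewrite !mulr_ge0 ?modc_ge0 ?tail_cst_ge0 // addr_ge0.
apply: (@ccvg_majorant _ (fun n => em_sum 1 alpha n s - em_sum 1 alpha n w) _ phi 1) => //.
- by apply: ccvgB; apply: hH => //; lra.
- move=> k k0; rewrite (_ : _ - _ = (em_sum 1 alpha k.+1 s - em_sum 1 alpha k s) - (em_sum 1 alpha k.+1 w - em_sum 1 alpha k w)); last by ring.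
  rewrite !em_sumS // !em_rem_1 /phi shift1.
  have x1 := shift_ge1 a0 k0; set x := k%:R + alpha in x1 *.
  have i01 : 0 <= (1 : R) <= 1 by rewrite ler01 lexx.
  have q0 : 0 <= 3 / 4 + 1%:R :> R by lra.
  have := @taylor_rem_lip R 1 (3 / 4) S x s w 1 x1 i01 rs rw sS wS q0.
  rewrite rem_cst1 => h; apply: (le_trans h).
  rewrite -!mulrBr ler_wpM2l ?modc_ge0 // -mulrA ler_wpM2l ?mulr_ge0 ?addr_ge0 //.
  by apply: (le_trans (log_tele x1)); rewrite mulrBr.
- by move=> k; rewrite !mulr_ge0 ?modc_ge0 ?tail_cst_ge0 ?powR_ge0 // addr_ge0.
- move=> e e0; have d0 : (0 : R) < 5 / 8 by lra.
  have [n1 H1] := powR_small_nat a0 d0 e0 P0.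
  by exists n1 => k /H1; rewrite /phi !mulrA.
Qed.

Lemma entire_part_tail alpha H n S s : 0 < alpha -> is_entire_part alpha H -> (0 < n)%N ->
  3 / 4 <= complex.Re s -> modc s <= S ->
  modc (em_sum 1 alpha n s - H s) <=
    (S + 2) * (S + 3) * (tail_cst * (n%:R + alpha) `^ (- (5 / 8))).
Proof.
move=> a0 hH n0 rs sS.
have S0 : 0 <= S by apply: le_trans sS; apply: modc_ge0.
pose phi n := (S + 2) * (S + 3) * (tail_cst * (n%:R + alpha) `^ (- (5 / 8))).
have P0 : 0 <= (S + 2) * (S + 3) * tail_cst.
  by rewrite !mulr_ge0 ?tail_cst_ge0 // addr_ge0.
apply: (@ccvg_majorant _ (fun n => em_sum 1 alpha n s) _ phi 1) => //.
- by apply: hH => //; lra.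
- move=> k k0; rewrite !em_sumS // !em_rem_1 /phi shift1.
  have x1 := shift_ge1 a0 k0; set x := k%:R + alpha in x1 *.
  have i01 : 0 <= (1 : R) <= 1 by rewrite ler01 lexx.
  have q0 : 0 <= 3 / 4 + 1%:R :> R by lra.
  have := @taylor_rem_bound R 1 (3 / 4) S x s 1 x1 i01 rs sS q0.
  rewrite rem_cst1 => h; apply: (le_trans h).
  rewrite -!mulrBr ler_wpM2l ?mulr_ge0 ?addr_ge0 //.
  rewrite [leRHS]mulrBr; apply: le_trans (log_tele x1).
  have L0 : 0 <= ln (x + 1) by rewrite ln_ge0 //; lra.
  by rewrite -[leLHS]mul1r ler_wpM2r ?powR_ge0 // lerDl.
- by move=> k; rewrite !mulr_ge0 ?tail_cst_ge0 ?powR_ge0 // addr_ge0.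
- move=> e e0; have d0 : (0 : R) < 5 / 8 by lra.
  have [n1 H1] := powR_small_nat a0 d0 e0 P0.
  by exists n1 => k /H1; rewrite /phi !mulrA.
Qed.

(** What zeta(s, alpha) has beyond its first [n] terms ([zeta_remE]), written through the order 1
    error that [entire_part_lip] controls. *)
Definition zeta_rem alpha H n s : R[i] :=
  (xpow (n%:R + alpha) (s - 1) - (em_sum 1 alpha n s - H s)) / (s - 1).

Lemma zeta_remE alpha (H : R[i] -> R[i]) n s : s != 1 ->
  H s / (s - 1) = \sum_(k < n) xpow (k%:R + alpha) s + zeta_rem alpha H n s.
Proof.
move=> s1; have s0 : s - 1 != 0 by rewrite subr_eq0.
apply: (mulIf s0); rewrite mulrDl !divfK //.
by rewrite /em_sum /em_main big_ord1 bern0 cbin0 !mul1r addr0; ring.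
Qed.

(** The first summand pays for x^(1 - s), the second for the Euler-Maclaurin error; the outer 2
    compensates the division by |s - 1| >= T / 2. *)
Definition rem_height_cst : R := 2 * (17 * 4 + 49 * tail_cst).

(** With x close to T^2, the term x^(1 - s) is of order T^(1/2), raised to T^(3/4) to absorb the
    logarithm; the error S^2 x^(-5/8) with S = 4T is of order T^2 T^(-5/4) = T^(3/4). Both are of
    smaller order than |s - 1|. *)
Lemma zeta_rem_numerator alpha H (T : nat) s w : 0 < alpha < 1 -> is_entire_part alpha H ->
  (1 <= T)%N -> 3 / 4 <= complex.Re s -> 3 / 4 <= complex.Re w ->
  modc s <= 4 * T%:R -> modc w <= 4 * T%:R ->
  let G s := xpow ((T ^ 2)%N%:R + alpha) (s - 1) - (em_sum 1 alpha (T ^ 2) s - H s) in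
  modc (G s) <= rem_height_cst / 2 * T%:R `^ (3 / 4) /\
  modc (G s - G w) <= modc (s - w) * (rem_height_cst / 2 * T%:R `^ (3 / 4)).
Proof.
move=> /andP[a0 a1] hH T1 rs rw sT wT G.
have t1 : 1 <= T%:R :> R by rewrite ler1n.
set t := T%:R in t1 sT wT *.
have X0 : (0 < T ^ 2)%N by rewrite expn_gt0 T1.
have Y1 := shift_ge1 a0 X0.
have EY : (T ^ 2)%N%:R + alpha = t ^+ 2 + alpha by rewrite natrX.
rewrite /G EY in Y1 *; set Y := t ^+ 2 + alpha in Y1 *.
have Y0 : 0 < Y by apply: lt_le_trans Y1.
have tt0 : 0 <= t by apply: le_trans t1.
have t2 : t ^+ 2 = t `^ 2 by rewrite powR_mulrn.
have Yt : t ^+ 2 <= Y by rewrite /Y lerDl ltW.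
have tt : 1 <= t ^+ 2 by rewrite expr_ge1.
have Y4 : Y <= 4 * t ^+ 2 by rewrite /Y; clear -tt a1; lra.
have h58 : Y `^ (- (5 / 8)) <= t `^ (- (5 / 4)).
  apply: (@le_trans _ _ ((t ^+ 2) `^ (- (5 / 8)))).
    by apply: powR_antimono => //; clear -tt; lra.
  rewrite t2 -powRrM; apply: ler_powR => //; clear; lra.
have h38 : Y `^ (3 / 8) <= 4 * t `^ (3 / 4).
  apply: (@le_trans _ _ ((4 * t ^+ 2) `^ (3 / 8))).
    by apply: ge0_ler_powR; rewrite ?nnegrE; clear -Y4 Y0; lra.
  rewrite powRM ?ler0n ?sqr_ge0 // t2 -powRrM.
  apply: ler_pM; rewrite ?powR_ge0 //.
    rewrite -[leRHS]powRr1 //; apply: ler_powR; clear; lra.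
  apply: ler_powR => //; clear; lra.
have S2 : (4 * t + 2) * (4 * t + 3) <= 49 * t ^+ 2.
  rewrite expr2; clear -t1; nra.
have K0 := tail_cst_ge0.
have key2 : (4 * t + 2) * (4 * t + 3) * (tail_cst * Y `^ (- (5 / 8))) <= 49 * tail_cst * t `^ (3 / 4).
  apply: (@le_trans _ _ (49 * t ^+ 2 * (tail_cst * t `^ (- (5 / 4))))).
    apply: ler_pM => //; rewrite ?mulr_ge0 ?powR_ge0 ?addr_ge0 ?mulr_ge0 //; try (clear -tt0; lra).
    by rewrite ler_wpM2l.
  have -> : t `^ (3 / 4) = t ^+ 2 * t `^ (- (5 / 4)).
    rewrite t2 powR_add; last by clear -t1; lra.
    by congr (powR t _); clear; lra.
  by rewrite le_eqVlt; apply/orP; left; apply/eqP; ring.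
have key1 : (1 + ln (Y + 1)) * Y `^ (1 / 4) <= 17 * 4 * t `^ (3 / 4).
  have e0 : (0 : R) < 1 / 8 by lra.
  have e1 : (1 / 8 : R) <= 1 by lra.
  have l := @log_powR R (1 / 8) Y e0 e1 Y1.
  apply: (@le_trans _ _ (17 * Y `^ (3 / 8))).
    have -> : Y `^ (3 / 8) = Y `^ (1 / 8) * Y `^ (1 / 4).
      by rewrite powR_add //; congr (powR Y _); clear; lra.
    rewrite mulrA ler_wpM2r ?powR_ge0 //; apply: (le_trans l).
    by rewrite ler_wpM2r ?powR_ge0 //; clear; lra.
  by rewrite -mulrA ler_wpM2l.
have L0 : 0 <= ln (Y + 1) by rewrite ln_ge0 // lerDr ltW.
have P0 : 0 <= Y `^ (1 / 4) by rewrite powR_ge0.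
have EC : rem_height_cst / 2 * t `^ (3 / 4) = 17 * 4 * t `^ (3 / 4) + 49 * tail_cst * t `^ (3 / 4).
  by rewrite /rem_height_cst; field.
have tl := entire_part_lip a0 hH X0 rs rw sT wT.
have tv := entire_part_tail a0 hH X0 rs sT.
rewrite EY -/Y in tl tv.
rewrite EC; split.
  apply: (le_trans (modcB _ _)); apply: lerD; last exact: le_trans tv key2.
  rewrite modc_xpow //; apply: le_trans key1.
  apply: (@le_trans _ _ (Y `^ (1 / 4))).
    by apply: ler_powR => //; rewrite raddfB /=; clear -rs; lra.
  by rewrite -[leLHS]mul1r ler_wpM2r // lerDl.
rewrite (_ : _ - _ = (xpow Y (s - 1) - xpow Y (w - 1)) - ((em_sum 1 alpha (T ^ 2) s - H s) - (em_sum 1 alpha (T ^ 2) w - H w))); last by ring.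
apply: (le_trans (modcB _ _)); rewrite mulrDr; apply: lerD.
  have r1 : - (1 / 4) <= complex.Re (s - 1) by rewrite raddfB /=; clear -rs; lra.
  have r2 : - (1 / 4) <= complex.Re (w - 1) by rewrite raddfB /=; clear -rw; lra.
  apply: (le_trans (xpow_lip Y1 r1 r2)).
  rewrite (_ : s - 1 - (w - 1) = s - w); last by ring.
  rewrite ler_wpM2l ?modc_ge0 //; apply: le_trans key1.
  rewrite opprK ler_wpM2r //; apply: (@le_trans _ _ (ln (Y + 1))); last by rewrite lerDr.
  by rewrite ler_ln ?posrE; clear -Y0; lra.
apply: (le_trans tl); rewrite ler_wpM2l ?modc_ge0 //.
Qed.

(** Dividing by |s - 1| >= T / 2 leaves T^(-1/4), uniformly in alpha. *)
Lemma zeta_rem_small e : 0 < e -> exists T0 : nat, forall (T : nat) alpha H s w, (T0 <= T)%N ->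
  0 < alpha < 1 -> is_entire_part alpha H ->
  3 / 4 <= complex.Re s <= 1 -> 3 / 4 <= complex.Re w <= 1 ->
  T%:R / 2 <= complex.Im s <= 3 * T%:R -> T%:R / 2 <= complex.Im w <= 3 * T%:R ->
  modc (zeta_rem alpha H (T ^ 2) s) <= e /\
  modc (zeta_rem alpha H (T ^ 2) s - zeta_rem alpha H (T ^ 2) w) <= modc (s - w) * e.
Proof.
move=> e0; set C := rem_height_cst.
have C0 : 0 <= C by rewrite /C /rem_height_cst mulr_ge0 // addr_ge0 ?mulr_ge0 ?tail_cst_ge0.
have d0 : (0 : R) < 1 / 4 by lra.
have eC : 0 < e / (2 * C + 1) by rewrite divr_gt0 // ltr_wpDl // mulr_ge0.
have [N N1 HN] := powR_small d0 eC.
have [n0 hn0] := natr_unbounded N.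
exists (n0 + 2)%N => T alpha H s w hT a01 hH /andP[rs rs1] /andP[rw rw1] /andP[is1 is2] /andP[iw1 iw2].
have T2 : (2 <= T)%N by apply: leq_trans hT; apply: leq_addl.
have T1 : (1 <= T)%N by apply: ltnW.
have t2 : 2 <= T%:R :> R by rewrite ler_nat.
have hsm z : 3 / 4 <= complex.Re z -> complex.Re z <= 1 -> T%:R / 2 <= complex.Im z ->
    complex.Im z <= 3 * T%:R -> modc z <= 4 * T%:R.
  clear -t2 => h1 h2 h3 h4; apply: (le_trans (modc_le _)); rewrite !ger0_norm; lra.
have [g1 g2] := @zeta_rem_numerator alpha H T s w a01 hH T1 rs rw (hsm _ rs rs1 is1 is2) (hsm _ rw rw1 iw1 iw2).
have [g3 _] := @zeta_rem_numerator alpha H T w w a01 hH T1 rw rw (hsm _ rw rw1 iw1 iw2) (hsm _ rw rw1 iw1 iw2).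
rewrite -/C in g1 g2 g3.
have small : T%:R `^ (- (1 / 4)) <= e / (2 * C + 1).
  by apply: HN; apply: (le_trans hn0); rewrite ler_nat; apply: leq_trans hT; apply: leq_addr.
set t := T%:R in t2 is1 iw1 small g1 g2 g3 *.
have den z : t / 2 <= complex.Im z -> t / 2 <= modc (z - 1).
  move=> h; apply: (le_trans h); apply: le_trans (modc_Im (z - 1)).
  by rewrite raddfB /= subr0 ler_norm.
have ds := den _ is1; have dw := den _ iw1.
have th : 0 < t / 2 by clear -t2; lra.
have ms : 0 < modc (s - 1) by apply: lt_le_trans ds.
have mw : 0 < modc (w - 1) by apply: lt_le_trans dw.
have s1 : s - 1 != 0 by rewrite -modc_eq0 gt_eqF.
have w1 : w - 1 != 0 by rewrite -modc_eq0 gt_eqF.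
have E34 : t `^ (3 / 4) = t * t `^ (- (1 / 4)).
  rewrite -{2}[t]powRr1; last by clear -t2; lra.
  rewrite powR_add; last by clear -t2; lra.
  by congr (powR t _); clear; lra.
set p := t `^ (- (1 / 4)) in small E34; have p0 : 0 <= p by rewrite powR_ge0.
have Cp : 2 * (C * p) <= e.
  have D0 : 0 < 2 * C + 1 by clear -C0; lra.
  move: small; rewrite ler_pdivlMr // => small; clear -small p0; lra.
have Cp0 : 0 <= C * p by rewrite mulr_ge0.
have quo a b z : t / 2 <= modc (z - 1) -> 0 <= b -> modc a <= b * (C / 2 * t `^ (3 / 4)) -> modc (a / (z - 1)) <= b * (C * p).
  move=> dz b0 h; have mz : 0 < modc (z - 1) by apply: lt_le_trans dz.
  rewrite modcM modcV ler_pdivrMr //; apply: (le_trans h).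
  rewrite E34 (_ : b * _ = b * (C * p) * (t / 2)); last by ring.
  by rewrite ler_wpM2l // mulr_ge0.
split.
  have : modc (zeta_rem alpha H (T ^ 2) s) <= 1 * (C * p) by apply: quo; rewrite ?mul1r.
  clear -Cp Cp0; lra.
rewrite /zeta_rem; move: g1 g2 g3.
set Gs := xpow _ (s - 1) - _; set Gw := xpow _ (w - 1) - _ => g1 g2 g3.
(* The second term is the variation of the denominator; its additional factor 1 / |s - 1| is at most
   1. *)
rewrite (_ : Gs / (s - 1) - Gw / (w - 1) = (Gs - Gw) / (s - 1) + Gw / (w - 1) * (w - s) / (s - 1)); last first.
  by field; rewrite s1 w1.
apply: (le_trans (modcD _ _)).
have q1 : modc ((Gs - Gw) / (s - 1)) <= modc (s - w) * (C * p) by apply: quo; rewrite ?modc_ge0.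
have q2 : modc (Gw / (w - 1)) <= 1 * (C * p) by apply: quo; rewrite ?mul1r.
have q3 : modc (Gw / (w - 1) * (w - s) / (s - 1)) <= modc (s - w) * (C * p).
  rewrite modcM modcV ler_pdivrMr // modcM (modc_distC w s) mulrC -[leRHS]mulrA ler_wpM2l ?modc_ge0 //.
  apply: (le_trans q2); rewrite mul1r -[leLHS]mulr1 ler_wpM2l //.
  by apply: le_trans ds; clear -t2; lra.
have m0 := modc_ge0 (s - w).
apply: (@le_trans _ _ (modc (s - w) * (2 * (C * p)))); last by rewrite ler_wpM2l.
clear -q1 q3; lra.
Qed.

End Approximation.

(** * Mean values of trigonometric polynomials *)

Section MeanValues.
Context {R : realType}.
Implicit Types (z w s : R[i]) (x y h e d r : R).

Definition hasmean (f : R -> R) (m : R) := exists Q : R -> R, exists C : R,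
  (forall t : R, is_derive t (1 : R) Q (f t)) /\ (forall t : R, `|Q t - m * t| <= C).

Lemma hasmean_eq (f g : R -> R) m n : hasmean f m -> f =1 g -> m = n -> hasmean g n.
Proof. by move=> h /funext <- <-. Qed.

Lemma hasmeanD (f g : R -> R) m n : hasmean f m -> hasmean g n ->
  hasmean (fun t => f t + g t) (m + n).
Proof.
move=> [Q [C [h1 h2]]] [Q' [C' [h1' h2']]].
exists (fun t => Q t + Q' t), (C + C'); split.
  by move=> t; apply: is_deriveD.
move=> t; rewrite (_ : _ - _ = (Q t - m * t) + (Q' t - n * t)); last by ring.
by apply: (le_trans (ler_normD _ _)); rewrite lerD.
Qed.

Lemma hasmeanZ (f : R -> R) m c : hasmean f m -> hasmean (fun t => c * f t) (c * m).
Proof.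
move=> [Q [C [h1 h2]]]; exists (fun t => c * Q t), (`|c| * C); split.
  by move=> t; apply: is_deriveZ.
move=> t; rewrite (_ : _ - _ = c * (Q t - m * t)); last by ring.
by rewrite normrM ler_wpM2l.
Qed.

Lemma hasmean_cst c : hasmean (fun=> c) c.
Proof.
exists (fun t => c * t), 0; split.
  move=> t; have := is_deriveZ c (is_derive_id t (1 : R)).
  by move/is_derive_eq2; apply => //; rewrite /GRing.scale /= mulr1.
by move=> t; rewrite subrr normr0.
Qed.

Lemma hasmean_sum (I : Type) (r : seq I) (P : pred I) (F : I -> R -> R) (m : I -> R) :
  (forall i, P i -> hasmean (F i) (m i)) ->
  hasmean (fun t => \sum_(i <- r | P i) F i t) (\sum_(i <- r | P i) m i).
Proof.
move=> h; elim: r => [|i r IH].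
  by apply: (hasmean_eq (hasmean_cst 0)) => [t|]; rewrite big_nil.
case Pi: (P i); last first.
  by apply: (hasmean_eq IH) => [t|]; rewrite big_cons Pi.
by apply: (hasmean_eq (hasmeanD (h i Pi) IH)) => [t|]; rewrite big_cons Pi.
Qed.

Definition cis (x : R) : R[i] := cexp ('i * x%:C).

Lemma cisD x y : cis (x + y) = cis x * cis y.
Proof. by rewrite /cis rmorphD mulrDr cexpD. Qed.

Lemma cis0 : cis 0 = 1.
Proof. by rewrite /cis mulr0 cexp0. Qed.

Lemma modc_cis x : modc (cis x) = 1.
Proof. by rewrite /cis modc_cexp /= mul0r mul1r subr0 expR0. Qed.

Lemma cis_sum (I : Type) (r : seq I) (P : pred I) (F : I -> R) :
  cis (\sum_(i <- r | P i) F i) = \prod_(i <- r | P i) cis (F i).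
Proof. by apply: (big_morph _ cisD); rewrite cis0. Qed.

Lemma cisN x : cis (- x) = conjc (cis x).
Proof.
rewrite /cis !cexpE /= !mul0r !mul1r !subr0 !add0r cosN sinN mulrN.
by [].
Qed.

Lemma conjcM z w : conjc (z * w) = conjc z * conjc w.
Proof. exact: rmorphM. Qed.

Lemma conjcB z w : conjc (z - w) = conjc z - conjc w.
Proof. exact: rmorphB. Qed.

Lemma conjcX z n : conjc (z ^+ n) = conjc z ^+ n.
Proof. exact: rmorphXn. Qed.

Lemma conjc_sum (I : Type) (r : seq I) (P : pred I) (F : I -> R[i]) :
  conjc (\sum_(i <- r | P i) F i) = \sum_(i <- r | P i) conjc (F i).
Proof. exact: rmorph_sum. Qed.

Lemma cisX x n : cis (n%:R * x) = cis x ^+ n.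
Proof.
elim: n => [|n IH]; first by rewrite mul0r cis0 expr0.
by rewrite -natr1 mulrDl mul1r cisD IH exprSr.
Qed.

Lemma hasmean_cis c x : hasmean (fun t => complex.Re (c * cis (t * x))) (if x == 0 then complex.Re c else 0).
Proof.
have [->|x0] := eqVneq x 0.
  by apply: (hasmean_eq (hasmean_cst (complex.Re c))) => // t; rewrite mulr0 cis0 mulr1.
have xc : x%:C != 0 by apply: contra_neq x0 => /complexI.
have i0 : ('i : R[i]) != 0 by rewrite eq_complex /= oner_eq0 andbF.
exists (fun t => complex.Re (c / ('i * x%:C) * cis (t * x))), (modc (c / ('i * x%:C))); split.
  move=> t.
  have hd : is_derive t (1 : R) (fun t => t * x) x.
    have := is_deriveZ x (is_derive_id t (1 : R)).
    by move/is_derive_eq2; apply => [y|]; rewrite /GRing.scale /= ?mulr1 // mulrC.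
  have [h _] := cderivMl (c / ('i * x%:C)) (cderiv_cexp 'i hd).
  apply: (is_derive_eq2 h) => //; rewrite /cis.
  by congr (complex.Re _); rewrite mulrA divfK // mulf_neq0.
move=> t; rewrite mul0r subr0; apply: (le_trans (modc_Re _)).
by rewrite modcM modc_cis mulr1.
Qed.

(** Coefficients in [-O, O] are encoded as [k n - O], so that the candidate relations form a finite
    type. *)
Definition independent_upto (N O : nat) (l : 'I_N -> R) :=
  forall k : {ffun 'I_N -> 'I_(O.*2.+1)},
    \sum_n ((k n)%:R - O%:R) * l n = 0 -> forall n, k n = O :> nat.

(** Degree at most [O]. Of the coefficients only the constant one, [m], is recorded, since under
    independence it alone contributes to means of products. *)
Definition trigpoly (O : nat) (q : R -> R[i]) (m : R[i]) :=
  exists c : 'I_(O.*2.+1) -> R[i], (forall x, q x = \sum_i c i * cis ((i%:R - O%:R) * x)) /\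
    (forall i : 'I_(O.*2.+1), i = O :> nat -> c i = m).

Lemma trigpoly_eq O q q' m m' : trigpoly O q m -> q =1 q' -> m = m' -> trigpoly O q' m'.
Proof. by move=> h /funext <- <-. Qed.

Lemma trigpolyD O q q' m m' : trigpoly O q m -> trigpoly O q' m' ->
  trigpoly O (fun x => q x + q' x) (m + m').
Proof.
move=> [c [h1 h2]] [c' [h1' h2']]; exists (fun i => c i + c' i); split.
  move=> x; under [RHS]eq_bigr => i _ do rewrite mulrDl.
  by rewrite big_split h1 h1'.
by move=> i iO; rewrite h2 // h2'.
Qed.

Lemma trigpolyZ O q m a : trigpoly O q m -> trigpoly O (fun x => a * q x) (a * m).
Proof.
move=> [c [h1 h2]]; exists (fun i => a * c i); split.
  by move=> x; rewrite h1 mulr_sumr; apply: eq_bigr => i _ /=; rewrite mulrA.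
by move=> i iO; rewrite h2.
Qed.

Lemma trigpoly_cis O (a b : nat) : (a <= O + b)%N -> (b <= O + a)%N ->
  trigpoly O (fun x => cis ((a%:R - b%:R) * x)) (a == b)%:R.
Proof.
move=> ab ba.
have lt : (O + a - b < O.*2.+1)%N by rewrite ltnS leq_subLR -addnn addnCA leq_add2l addnC.
exists (fun i => (nat_of_ord i == (O + a - b)%N)%:R); split.
  move=> x; rewrite (bigD1 (Ordinal lt)) //= eqxx mul1r big1 ?addr0.
    have -> : (O + a - b)%N%:R - O%:R = a%:R - b%:R :> R by rewrite natrB // natrD; ring.
    by [].
  move=> i hi; rewrite (_ : (nat_of_ord i == _) = false) ?mul0r //.
  by apply: contraNF hi => /eqP hi; apply/eqP/val_inj.
move=> i ->; congr ((nat_of_bool _)%:R).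
by rewrite -(eqn_add2r b) subnK // eqn_add2l eq_sym.
Qed.

Lemma trigpoly_cst O a : trigpoly O (fun=> a) a.
Proof.
have := trigpolyZ a (@trigpoly_cis O 0 0 (leq0n _) (leq0n _)).
by move/trigpoly_eq; apply => [x|]; rewrite ?subrr ?mul0r ?cis0 ?eqxx mulr1.
Qed.

Lemma trigpoly_sum O (I : Type) (r : seq I) (P : pred I) (F : I -> R -> R[i]) (m : I -> R[i]) :
  (forall i, P i -> trigpoly O (F i) (m i)) ->
  trigpoly O (fun t => \sum_(i <- r | P i) F i t) (\sum_(i <- r | P i) m i).
Proof.
move=> h; elim: r => [|i r IH].
  by apply: (trigpoly_eq (trigpoly_cst O 0)) => [t|]; rewrite big_nil.
case Pi: (P i); last first.
  by apply: (trigpoly_eq IH) => [t|]; rewrite big_cons Pi.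
by apply: (trigpoly_eq (trigpolyD (h i Pi) IH)) => [t|]; rewrite big_cons Pi.
Qed.

(* Expanding the product, independence leaves only the constant terms. *)
Lemma hasmean_prod N O (l : 'I_N -> R) (q : 'I_N -> R -> R[i]) (m : 'I_N -> R[i]) :
  independent_upto O l -> (forall n, trigpoly O (q n) (m n)) ->
  hasmean (fun t => complex.Re (\prod_n q n (t * l n))) (complex.Re (\prod_n m n)).
Proof.
move=> ind hq.
have [c hc] := choice hq.
pose lam (k : {ffun 'I_N -> 'I_(O.*2.+1)}) := \sum_n ((k n)%:R - O%:R) * l n.
pose F (k : {ffun 'I_N -> 'I_(O.*2.+1)}) t := complex.Re ((\prod_n c n (k n)) * cis (t * lam k)).
have hF : hasmean (fun t => \sum_k F k t) (\sum_k (if lam k == 0 then complex.Re (\prod_n c n (k n)) else 0)).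
  by apply: hasmean_sum => k _; apply: hasmean_cis.
apply: (hasmean_eq hF) => [t|].
  rewrite /F -raddf_sum; congr (complex.Re _).
  under [RHS]eq_bigr => n _ do rewrite (hc n).1.
  rewrite bigA_distr_bigA /=; apply: eq_bigr => k _.
  rewrite big_split /= -cis_sum mulr_sumr; congr (_ * cis _).
  by apply: eq_bigr => n _; ring.
have OO : (O < O.*2.+1)%N by rewrite ltnS -addnn leq_addr.
pose k0 : {ffun 'I_N -> 'I_(O.*2.+1)} := [ffun=> Ordinal OO].
rewrite (bigD1 k0) //= [X in _ + X]big1 ?addr0.
  have -> : lam k0 = 0 by rewrite /lam big1 // => n _; rewrite ffunE /= subrr mul0r.
  rewrite eqxx; congr (complex.Re _); apply: eq_bigr => n _.
  by rewrite (hc n).2 // ffunE.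
move=> k kk; case: eqP => // /ind hk.
by case/eqP: kk; apply/ffunP => n; rewrite ffunE; apply/val_inj; rewrite /= hk.
Qed.

(* Fejer kernel concentrated at [cis x = o], for a sign [o]. *)
Definition fejer J o x : R[i] :=
  (\sum_(j < J) (o%:C * cis x) ^+ j) * (\sum_(j < J) (o%:C * cis (- x)) ^+ j).

Lemma fejerE J o x : fejer J o x = ((modc (\sum_(j < J) (o%:C * cis x) ^+ j)) ^+ 2)%:C.
Proof.
rewrite /fejer; set a := \sum_(j < J) _.
have -> : \sum_(j < J) (o%:C * cis (- x)) ^+ j = conjc a.
  rewrite /a conjc_sum; apply: eq_bigr => j _.
  by rewrite conjcX conjcM cisN conjc_real.
by rewrite sqr_modc; case: (a) => p q /=; simpc; congr (_ +i* _); ring.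
Qed.

Lemma fejer_ge0 J o x : 0 <= complex.Re (fejer J o x).
Proof. by rewrite fejerE /= sqr_ge0. Qed.

Lemma fejer_le J o x : `|o| = 1 -> complex.Re (fejer J o x) <= J%:R ^+ 2.
Proof.
move=> o1; rewrite fejerE /=.
have h : modc (\sum_(j < J) (o%:C * cis x) ^+ j) <= J%:R.
  apply: (le_trans (modc_sum _ _ _)).
  rewrite (eq_bigr (fun=> 1)); last by move=> j _; rewrite modcX modcM modcR modc_cis o1 mulr1 expr1n.
  by rewrite sumr_const card_ord.
by rewrite ler_pXn2r // ?nnegrE ?modc_ge0.
Qed.

(** The constant term comes from the diagonal of the double sum, where the signs square to 1. *)
Lemma trigpoly_fejer O J o : o ^+ 2 = 1 -> (J <= O)%N -> trigpoly O (fejer J o) J%:R.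
Proof.
move=> o1 JO.
have := @trigpoly_sum O _ (index_enum 'I_J) xpredT
  (fun j x => \sum_(i < J) (o ^+ (j + i))%:C * cis ((j%:R - i%:R) * x))
  (fun j => \sum_(i < J) (o ^+ (j + i))%:C * (nat_of_ord j == i)%:R).
move=> /(_ _)/trigpoly_eq; apply.
- move=> j _; apply: trigpoly_sum => i _; apply: trigpolyZ.
  by apply: trigpoly_cis; apply: leq_trans (leq_addr _ _); apply: ltnW; apply: leq_trans JO.
- move=> x; rewrite /fejer mulr_suml; apply: eq_bigr => j _.
  rewrite mulr_sumr; apply: eq_bigr => i _.
  by rewrite !exprMn -!cisX exprD rmorphM !rmorphXn mulrBl cisD mulrN; ring.
- rewrite (eq_bigr (fun=> 1)) ?sumr_const ?card_ord // => j _.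
  rewrite (bigD1 j) //= eqxx mulr1 big1 ?addr0.
    by rewrite addnn -mul2n exprM o1 expr1n.
  by move=> i ij; rewrite (_ : (nat_of_ord j == i) = false) ?mulr0 // eq_sym; apply: negbTE.
Qed.

(** The squared distance equals |1 - o cis x|^2, which cancels the denominators of the geometric
    sums and leaves |1 - (o cis x)^J|^2. Its mean is 2 against [J] for the kernel, so the weighted
    mean square distance to the sign is 2 / J. *)
Lemma fejer_dist J o x : o ^+ 2 = 1 ->
  fejer J o x * ((modc (cis x - o%:C)) ^+ 2)%:C =
  2 - (o ^+ J)%:C * cis (J%:R * x) - (o ^+ J)%:C * cis (- (J%:R * x)).
Proof.
move=> o1.
have oc : o%:C * o%:C = 1 :> R[i] by rewrite -rmorphM -expr2 o1.
have cc : cis x * cis (- x) = 1 by rewrite -cisD subrr cis0.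
have -> : ((modc (cis x - o%:C)) ^+ 2)%:C = (1 - o%:C * cis x) * (1 - o%:C * cis (- x)).
  have -> : ((modc (cis x - o%:C)) ^+ 2)%:C = (cis x - o%:C) * conjc (cis x - o%:C).
    rewrite sqr_modc; case: (_ - _) => p q /=; simpc; congr (_ +i* _); ring.
  rewrite conjcB conjc_real -cisN.
  rewrite mulrBl mulrBr cc mulrBl !mulrBr mul1r !mulr1 oc.
  have -> : o%:C * cis x * (o%:C * cis (- x)) = (o%:C * o%:C) * (cis x * cis (- x)) by ring.
  by rewrite oc cc; ring.
rewrite /fejer.
have geo (w : R[i]) : (1 - w) * \sum_(j < J) w ^+ j = 1 - w ^+ J.
  by rewrite -[RHS]opprB subrX1 -mulNr opprB.
rewrite mulrACA ![(\sum_(j < J) _) * _]mulrC !geo !exprMn -!cisX mulrN.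
rewrite -!rmorphXn.
set a := (o ^+ J)%:C; have aa : a * a = 1 by rewrite /a -rmorphM -exprMn -expr2 o1 expr1n.
have cJ : cis (J%:R * x) * cis (- (J%:R * x)) = 1 by rewrite -cisD subrr cis0.
have -> : (1 - a * cis (J%:R * x)) * (1 - a * cis (- (J%:R * x))) =
  1 - a * cis (J%:R * x) - a * cis (- (J%:R * x)) + (a * a) * (cis (J%:R * x) * cis (- (J%:R * x))) by ring.
by rewrite aa cJ; ring.
Qed.

Lemma trigpoly_fejer_dist O J o : o ^+ 2 = 1 -> (0 < J <= O)%N ->
  trigpoly O (fun x => fejer J o x * ((modc (cis x - o%:C)) ^+ 2)%:C) 2.
Proof.
move=> o1 /andP[J0 JO].
have h1 := @trigpoly_cis O J 0 (leq_trans JO (leq_addr _ _)) (leq0n _).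
have h2 := @trigpoly_cis O 0 J (leq0n _) (leq_trans JO (leq_addr _ _)).
have := trigpolyD (trigpolyD (trigpoly_cst O 2) (trigpolyZ (- (o ^+ J)%:C) h1)) (trigpolyZ (- (o ^+ J)%:C) h2).
move/trigpoly_eq; apply.
  by move=> x; rewrite fejer_dist // subr0 sub0r !mulNr.
by rewrite gtn_eqF // ltn_eqF // !mulr0 !addr0.
Qed.

End MeanValues.

(** * Mean squares of Dirichlet polynomials without independence *)

Section MeanSquare.
Context {R : realType}.
Implicit Types (z w s : R[i]) (x y h e d r alpha M : R) (l a : nat -> R).

Lemma Re_cis x : complex.Re (cis x) = cos x.
Proof. by rewrite /cis cexpE /= !mul0r !mul1r subr0 add0r expR0 mul1r. Qed.

Lemma modc_sqr_sum n a (th : nat -> R) :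
  modc (\sum_(j < n) (a j)%:C * cis (th j)) ^+ 2 =
  \sum_(i < n) \sum_(j < n) a i * a j * cos (th i - th j).
Proof.
pose b : R[i] := \sum_(j < n) (a j)%:C * cis (th j); rewrite -/b.
have -> : modc b ^+ 2 = complex.Re (b * conjc b).
  by rewrite sqr_modc; case: (b) => p q /=; ring.
rewrite /b conjc_sum mulr_suml raddf_sum; apply: eq_bigr => i _.
rewrite mulr_sumr raddf_sum; apply: eq_bigr => j _.
rewrite conjcM conjc_real -cisN mulrACA -rmorphM -cisD.
by rewrite -Re_cis; case: (cis _) => p q /=; rewrite mul0r subr0.
Qed.

Lemma is_derive_bigsum (I : Type) (r : seq I) (P : pred I) (F : I -> R -> R) (G : I -> R) (t : R) :
  (forall i, P i -> is_derive t (1 : R) (F i) (G i)) ->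
  is_derive t (1 : R) (fun t => \sum_(i <- r | P i) F i t) (\sum_(i <- r | P i) G i).
Proof.
move=> h; elim: r => [|i r IH].
  by apply: (is_derive_eq2 (is_derive_cst (0 : R) t (1 : R))) => [y|]; rewrite big_nil.
case Pi: (P i); last first.
  by apply: (is_derive_eq2 IH) => [y|]; rewrite big_cons Pi.
by apply: (is_derive_eq2 (is_deriveD (h i Pi) IH)) => [y|]; rewrite big_cons Pi.
Qed.

Definition harm n : R := \sum_(k < n) k.+1%:R^-1.

Lemma harm_ge0 n : 0 <= harm n.
Proof. by apply: sumr_ge0 => k _; rewrite invr_ge0. Qed.

Lemma harm_mono m n : (m <= n)%N -> harm m <= harm n.
Proof.
move=> mn; rewrite /harm -!(big_mkord xpredT (fun k => k.+1%:R^-1 : R)).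
rewrite [X in _ <= X](big_cat_nat (n := m)) //= lerDl; apply: sumr_ge0 => k _.
by rewrite invr_ge0.
Qed.

Lemma ln_ratio x y : 0 < y -> y < x -> (x - y) / x <= ln x - ln y.
Proof.
move=> y0 yx; have x0 : 0 < x by lra.
have yx0 : 0 < y / x by rewrite divr_gt0.
have h : ln (y / x) <= y / x - 1.
  have /le_ln1Dx : -1 < y / x - 1 by lra.
  by rewrite addrCA subrr addr0.
rewrite ln_div ?posrE // in h.
have -> : (x - y) / x = 1 - y / x by rewrite mulrBl divff ?gt_eqF.
lra.
Qed.

Lemma harm_log n : harm n.+1 <= 1 + ln n.+1%:R.
Proof.
elim: n => [|n IH]; first by rewrite /harm big_ord1 invr1 ln1 addr0.
rewrite /harm big_ord_recr /= -/(harm n.+1).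
have h := @ln_ratio n.+2%:R n.+1%:R.
have E : n.+2%:R - n.+1%:R = 1 :> R by rewrite -[n.+2%:R]natr1; ring.
rewrite E mul1r ltr0n ltr_nat ltnS leqnn in h.
have {}h := h (leq0n _) isT.
move: (ln n.+2%:R) (ln n.+1%:R) (n.+2%:R^-1) (harm n.+1) IH h => u v w z; lra.
Qed.

(** The indices below [i] and those above [i] contribute one harmonic sum each. *)
Lemma inner_harm n i : (i < n)%N ->
  \sum_(j < n | nat_of_ord j != i) `|i%:R - j%:R|^-1 <= 2 * harm n.
Proof.
move=> ni; rewrite -(big_mkord (fun j => j != i) (fun j => `|i%:R - j%:R|^-1 : R)).
rewrite (big_cat_nat (n := i)) //=; last exact: ltnW.
rewrite mulrDl mul1r; apply: lerD.
  apply: (@le_trans _ _ (harm i)); last by apply: harm_mono; apply: ltnW.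
  rewrite big_nat_rev /= add0n big_mkord /harm big_mkcond /=; apply: ler_sum => j _.
  case: ifP => _; last by rewrite invr_ge0.
  have -> : i%:R - (i - j.+1)%N%:R = j.+1%:R :> R by rewrite natrB ?ltn_ord //; ring.
  by rewrite ger0_norm.
rewrite big_mkcond big_ltn // eqxx /= add0r -big_mkcond.
apply: (@le_trans _ _ (harm (n - i.+1))); last by apply: harm_mono; apply: leq_subr.
rewrite -{1}[i.+1]add0n big_addn big_mkcond big_mkord /harm; apply: ler_sum => j _.
case: ifP => _; last by rewrite invr_ge0.
have -> : i%:R - (j + i.+1)%N%:R = - j.+1%:R :> R by rewrite natrD -!natr1; ring.
by rewrite normrN ger0_norm.
Qed.

Definition shift_log alpha n : R := ln (n%:R + alpha).

Lemma shift_gt0 alpha n : 0 < alpha -> 0 < n%:R + alpha.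
Proof. by move=> a0; rewrite ltr_wpDl. Qed.

(** By [ln_ratio] the gap is at least |i - j| over the larger shift, replaced here by the sum of
    both for symmetry. *)
Lemma shift_log_dist alpha (i j : nat) : 0 < alpha -> i != j ->
  shift_log alpha i != shift_log alpha j /\
  `|shift_log alpha i - shift_log alpha j|^-1 <=
     ((i%:R + alpha) + (j%:R + alpha)) * `|i%:R - j%:R|^-1.
Proof.
move=> a0.
wlog ij : i j / (j < i)%N.
  move=> H; rewrite neq_ltn => /orP[ij|ij].
    have [] := H j i ij; first by rewrite gtn_eqF.
    by move=> h1 h2; split; [rewrite eq_sym|rewrite (distrC (shift_log alpha i)) (distrC i%:R) [_ + alpha + _]addrC].
  by apply: H => //; rewrite gtn_eqF.
move=> _; have xj := shift_gt0 j a0; have xi := shift_gt0 i a0.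
have hij : j%:R < i%:R :> R by rewrite ltr_nat.
have := @ln_ratio (i%:R + alpha) (j%:R + alpha) xj; rewrite ltrD2r => /(_ hij).
rewrite (_ : i%:R + alpha - (j%:R + alpha) = i%:R - j%:R); last by ring.
rewrite -/(shift_log alpha i) -/(shift_log alpha j) => h.
have p : 0 < (i%:R - j%:R) / (i%:R + alpha) by rewrite divr_gt0 // subr_gt0.
have d0 : 0 < shift_log alpha i - shift_log alpha j by apply: lt_le_trans h.
split; first by rewrite -subr_eq0 gt_eqF.
rewrite (gtr0_norm d0) gtr0_norm ?subr_gt0 //.
apply: (@le_trans _ _ ((i%:R + alpha) / (i%:R - j%:R))).
  by rewrite -[leRHS]invrK invf_div lef_pV2.
by rewrite ler_wpM2r ?invr_ge0 ?subr_ge0 ?(ltW hij) // lerDl ltW.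
Qed.

(** The off-diagonal cosines are integrated explicitly and bounded by the separation of the
    logarithms, so this serves the terms beyond [N]. The 8 collects a 2 from the two sine values, a
    2 from [inner_harm] and a 2 from the symmetry in i and j. *)
Lemma mean_square alpha a n M : 0 < alpha -> (forall j, 0 <= a j) ->
  (forall j, (j < n)%N -> a j * (j%:R + alpha) <= M) ->
  exists Q : R -> R, (forall t : R, is_derive t (1 : R) Q
     (modc (\sum_(j < n) (a j)%:C * cis (- (t * shift_log alpha j))) ^+ 2)) /\
   forall T : R, Q (2 * T) - Q T <= T * (\sum_(j < n) a j ^+ 2) + 8 * M * harm n * \sum_(j < n) a j.
Proof.
move=> a0 apos aM; set l := shift_log alpha.
pose q (i j : nat) (t : R) := if i == j then t else sin (t * (l j - l i)) / (l j - l i).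
exists (fun t => \sum_(i < n) \sum_(j < n) a i * a j * q i j t); split.
  move=> t; rewrite (modc_sqr_sum n a (fun j => - (t * l j))).
  apply: is_derive_bigsum => i _; apply: is_derive_bigsum => j _.
  apply: is_deriveZ; rewrite /q; have [->|ij] := eqVneq (nat_of_ord i) j.
    by rewrite subrr cos0; apply: is_derive_id.
  have lij : l j - l i != 0 by rewrite subr_eq0; have [] := @shift_log_dist alpha j i a0; rewrite // eq_sym.
  have hd : is_derive t (1 : R) (fun t => t * (l j - l i)) (l j - l i).
    have := is_deriveZ (l j - l i) (is_derive_id t (1 : R)).
    by move/is_derive_eq2; apply => [y|]; rewrite /GRing.scale /= ?mulr1 // mulrC.
  have h1 := @is_derive1_comp R (@sin R) _ t _ _ (is_derive_sin _) hd.
  have h2 := is_deriveZ (l j - l i)^-1 h1.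
  apply: (is_derive_eq2 h2) => [y|]; first by rewrite /GRing.scale /=; exact: mulrC.
  rewrite /GRing.scale /= mulrCA mulVf // mulr1; congr cos.
  by rewrite /l; ring.
move=> T; rewrite -sumrB.
have qd i j : (i < n)%N -> (j < n)%N -> a i * a j * q i j (2 * T) - a i * a j * q i j T <=
   (if i == j then T * a i ^+ 2 else 0) + (if i == j then 0 else 2 * M * (a i * `|i%:R - j%:R|^-1 + a j * `|j%:R - i%:R|^-1)).
  move=> ni nj; rewrite /q; have [->|ij] := eqVneq i j.
    rewrite addr0 le_eqVlt; apply/orP; left; apply/eqP; ring.
  rewrite add0r -mulrBr -mulrBl.
  have [lij hij] := @shift_log_dist alpha j i a0 (contra_neq (@esym _ _ _) ij).
  have aij : 0 <= a i * a j by rewrite mulr_ge0.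
  apply: (@le_trans _ _ (a i * a j * (2 * `|l j - l i|^-1))).
    rewrite ler_wpM2l //; apply: (le_trans (ler_norm _)).
    rewrite normrM normfV ler_wpM2r ?invr_ge0 //.
    apply: (le_trans (ler_normB _ _)).
    have s1 (y : R) : `|sin y| <= 1 by rewrite ler_norml sin_geN1 sin_le1.
    by have := s1 (2 * T * (l j - l i)); have := s1 (T * (l j - l i)); lra.
  apply: (@le_trans _ _ (a i * a j * (2 * ((j%:R + alpha + (i%:R + alpha)) * `|j%:R - i%:R|^-1)))).
    by rewrite ler_wpM2l // ler_wpM2l.
  rewrite (distrC i%:R); set D := `|_ - _|^-1; have D0 : 0 <= D by rewrite invr_ge0.
  rewrite (_ : a i * a j * _ = 2 * (a j * (j%:R + alpha) * (a i * D) + a i * (i%:R + alpha) * (a j * D))); last by ring.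
  rewrite (_ : 2 * M * _ = 2 * (M * (a i * D) + M * (a j * D))); last by ring.
  rewrite ler_wpM2l //; apply: lerD; rewrite ler_wpM2r ?mulr_ge0 //; exact: aM.
apply: (@le_trans _ _ (\sum_(i < n) \sum_(j < n) ((if nat_of_ord i == j then T * a i ^+ 2 else 0) +
    (if nat_of_ord i == j then 0 else 2 * M * (a i * `|i%:R - j%:R|^-1 + a j * `|j%:R - i%:R|^-1))))).
  by apply: ler_sum => i _; rewrite -sumrB; apply: ler_sum => j _; apply: qd.
under eq_bigr => i _ do rewrite big_split /=.
rewrite big_split /=; apply: lerD.
  rewrite mulr_sumr; apply: ler_sum => i _.
  rewrite (bigD1 i) //= eqxx big1 ?addr0 // => j ji.
  by rewrite (_ : (nat_of_ord i == j) = false) // eq_sym; apply: negbTE.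
have M0 i : (i < n)%N -> 0 <= M.
  move=> ni; apply: le_trans (aM i ni); apply: mulr_ge0 => //; exact: ltW (shift_gt0 i a0).
have half : \sum_(i < n) \sum_(j < n | nat_of_ord j != i) a i * `|i%:R - j%:R|^-1 <= 2 * harm n * \sum_(j < n) a j.
  rewrite mulr_sumr; apply: ler_sum => i _; rewrite -mulr_sumr mulrC ler_wpM2r //.
  exact: inner_harm.
have half2 : \sum_(i < n) \sum_(j < n | nat_of_ord j != i) a j * `|j%:R - i%:R|^-1 <= 2 * harm n * \sum_(j < n) a j.
  apply: le_trans half; rewrite (exchange_big_dep xpredT) //=.
  apply: ler_sum => i _; rewrite le_eqVlt; apply/orP; left; apply/eqP.
  by apply: eq_bigl => j; rewrite eq_sym.
case: n aM qd M0 half half2 => [|n] aM qd M0 half half2; first by rewrite !big_ord0 mulr0.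
have MM := M0 0 isT.
rewrite (_ : 8 * M * harm n.+1 * _ = 2 * M * (2 * harm n.+1 * (\sum_(j < n.+1) a j) + 2 * harm n.+1 * (\sum_(j < n.+1) a j))); last by ring.
apply: (@le_trans _ _ (2 * M * (\sum_(i < n.+1) \sum_(j < n.+1 | nat_of_ord j != i) a i * `|i%:R - j%:R|^-1
   + \sum_(i < n.+1) \sum_(j < n.+1 | nat_of_ord j != i) a j * `|j%:R - i%:R|^-1))); last first.
  by rewrite ler_wpM2l ?mulr_ge0 // lerD.
rewrite -big_split mulr_sumr /=; apply: ler_sum => i _.
rewrite -big_split mulr_sumr /= big_mkcond /= le_eqVlt; apply/orP; left; apply/eqP.
rewrite [RHS]big_mkcond; apply: eq_bigr => j _ /=.
by rewrite eq_sym; case: ifP.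
Qed.

End MeanSquare.

(** * Selection of the height *)

Section Selection.
Context {R : realType}.
Implicit Types (z : R[i]) (x y h e d r alpha M : R) (o a w : nat -> R).

(** Coefficients below [m] are set to 0 rather than omitted, so that blocks are sums over initial
    segments, as Abel summation requires. *)
Definition block_sum alpha a m n (t : R) : R[i] :=
  \sum_(j < n) (if (m <= j)%N then a j else 0)%:C * cis (- (t * shift_log alpha j)).

Lemma block_sumB alpha a m N n (t : R) : (m <= N)%N -> (N <= n)%N ->
  block_sum alpha a m n t - block_sum alpha a m N t = block_sum alpha a N n t.
Proof.
move=> mN Nn; rewrite /block_sum.
pose F m j := (if (m <= j)%N then a j else 0)%:C * cis (- (t * shift_log alpha j)) : R[i].
rewrite -(big_mkord xpredT (F m)) -(big_mkord xpredT (F N)) -[X in _ - X](big_mkord xpredT (F m)).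
rewrite (@big_cat_nat _ _ _ N) //= [X in _ = X](@big_cat_nat _ _ _ N) //=.
have Z : \sum_(0 <= i < N) F N i = 0.
  rewrite big_nat_cond big1 // => i /andP[iN _].
  by rewrite /F leqNgt (andP iN).2 /= mul0r.
rewrite Z add0r addrAC subrr add0r.
apply: eq_big_nat => i /andP[Ni _]; by rewrite /F Ni (leq_trans mN).
Qed.

(** The factors 1 for K < n < N keep all [N] frequencies of [hasmean_prod] in the product, so that
    cosines of the later frequencies can be multiplied in. *)
Definition weight J N K o alpha (t : R) : R :=
  \prod_(n < N) (if (n <= K)%N then complex.Re (fejer J (o n) (t * shift_log alpha n)) else 1).

Lemma weight_ge0 J N K o alpha t : 0 <= weight J N K o alpha t.
Proof. by apply: prodr_ge0 => n _; case: ifP => // _; apply: fejer_ge0. Qed.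

Lemma prod_if N K c : (K < N)%N -> \prod_(n < N) (if (n <= K)%N then c else 1) = c ^+ K.+1 :> R.
Proof.
move=> KN; rewrite -(big_mkcond (fun n : 'I_N => (n <= K)%N) (fun=> c)) /=.
by rewrite -(big_ord_widen N (fun=> c) KN) prodr_const card_ord.
Qed.

Lemma weight_le J N K o alpha t : (K < N)%N -> (forall n, `|o n| = 1) ->
  weight J N K o alpha t <= (J%:R ^+ 2) ^+ K.+1.
Proof.
move=> KN o1; rewrite -(prod_if _ KN); apply: ler_prod => n _.
case: ifP => _; last by rewrite ler01 lexx.
by rewrite fejer_ge0 fejer_le.
Qed.

Definition factor J K o (n : nat) (x : R) : R[i] := if (n <= K)%N then fejer J (o n) x else 1.

Lemma weightE J N K o alpha t :
  \prod_(n < N) factor J K o n (t * shift_log alpha n) = (weight J N K o alpha t)%:C.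
Proof.
rewrite /weight rmorph_prod; apply: eq_bigr => n _.
by rewrite /factor; case: ifP => // _; rewrite fejerE.
Qed.

Section Means.
Variables (J N K O : nat) (o : nat -> R) (alpha : R).
Hypotheses (KN : (K < N)%N) (J0 : (0 < J)%N) (JO : (J <= O)%N) (o1 : forall n, o n ^+ 2 = 1)
  (ind : independent_upto O (fun n : 'I_N => shift_log alpha n)).

Lemma trigpoly_factor n : trigpoly O (factor J K o n) (if (n <= K)%N then J%:R else 1).
Proof.
rewrite /factor; case: ifP => _; last exact: trigpoly_cst.
exact: trigpoly_fejer.
Qed.

Lemma Re_realM x z : complex.Re (x%:C * z) = x * complex.Re z.
Proof. by case: z => p q /=; rewrite mul0r subr0. Qed.

Lemma weight_mean : hasmean (weight J N K o alpha) (J%:R ^+ K.+1).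
Proof.
have := @hasmean_prod R N O _ (fun n => factor J K o n) _ ind (fun n => trigpoly_factor n).
move/hasmean_eq; apply => [t|]; first by rewrite weightE.
rewrite (eq_bigr (fun n : 'I_N => (if (n <= K)%N then J%:R else 1 : R)%:C)).
  by rewrite -rmorph_prod /= prod_if.
by move=> n _; case: ifP => _; rewrite ?rmorph_nat.
Qed.

(** Only the factor of index [m] changes, from mean [J] to mean 2. *)
Lemma weight_dist_mean (m : nat) : (m <= K)%N ->
  hasmean (fun t => weight J N K o alpha t * modc (cis (t * shift_log alpha m) - (o m)%:C) ^+ 2)
    (J%:R ^+ K.+1 * (2 / J%:R)).
Proof.
move=> mK; have mN : (m < N)%N by apply: leq_ltn_trans KN.
pose G n (x : R) : R[i] := if n == m then ((modc (cis x - (o n)%:C)) ^+ 2)%:C else 1.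
have hq (n : 'I_N) : trigpoly O (fun x => factor J K o n x * G n x)
    (if nat_of_ord n == m then 2 else (if (n <= K)%N then J%:R else 1)).
  rewrite /G; have [nm|nm] := eqVneq (nat_of_ord n) m.
    rewrite nm /factor mK; apply: trigpoly_fejer_dist => //; by rewrite J0.
  by apply: (trigpoly_eq (trigpoly_factor n)) => // x; rewrite mulr1.
have := hasmean_prod ind hq.
move/hasmean_eq; apply => [t|].
  rewrite big_split /= weightE.
  rewrite [X in _ * X](bigD1 (Ordinal mN)) //= big1 ?mulr1.
    by rewrite /G eqxx -rmorphM.
  by move=> n nm; rewrite /G (_ : (nat_of_ord n == m) = false) //; apply: contraNF nm => /eqP h; apply/eqP/val_inj.
have J0' : J%:R != 0 :> R by rewrite pnatr_eq0 -lt0n.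
rewrite -(prod_if _ KN) (bigD1 (Ordinal mN)) //= [in RHS](bigD1 (Ordinal mN)) //= eqxx mK.
rewrite mulrAC mulrCA divff // mulr1.
rewrite (eq_bigr (fun n : 'I_N => (if (n <= K)%N then J%:R else 1 : R)%:C)).
  by rewrite -rmorph_prod -(rmorph_nat (real_complex R)) -rmorphM.
move=> n nm; rewrite (_ : (nat_of_ord n == m) = false).
  by case: ifP => _; rewrite ?rmorph_nat.
by apply: contraNF nm => /eqP h; apply/eqP/val_inj.
Qed.

(** The frequencies [i] and [j] do not occur in the weight, so by independence the cosine is
    orthogonal to it unless i = j. *)
Lemma weight_cos_mean (i j : nat) : (K < i)%N -> (K < j)%N -> (i < N)%N -> (j < N)%N ->
  hasmean (fun t => weight J N K o alpha t * cos (- (t * shift_log alpha i) - - (t * shift_log alpha j)))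
    (if i == j then J%:R ^+ K.+1 else 0).
Proof.
move=> Ki Kj iN jN.
have O0 : (0 < O)%N by apply: leq_trans JO.
pose G n (x : R) : R[i] := cis (((n == j)%:R - (n == i)%:R) * x).
have hq (n : 'I_N) : trigpoly O (fun x => factor J K o n x * G n x)
    ((if (n <= K)%N then J%:R else 1) * ((nat_of_ord n == j) == (nat_of_ord n == i))%:R).
  have [nK|nK] := leqP n K.
    have ni : (nat_of_ord n == i) = false by rewrite ltn_eqF // (leq_ltn_trans nK).
    have nj : (nat_of_ord n == j) = false by rewrite ltn_eqF // (leq_ltn_trans nK).
    rewrite ni nj eqxx mulr1.
    have := trigpoly_factor n; rewrite nK => h; apply: (trigpoly_eq h) => // x.
    by rewrite /G ni nj subrr mul0r cis0 mulr1.
  have b2 (b c : bool) : (b <= O + c)%N.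
    by apply: leq_trans (leq_addr _ _); apply: leq_trans O0; case: b.
  have := @trigpoly_cis R O (nat_of_ord n == j) (nat_of_ord n == i) (b2 _ _) (b2 _ _).
  move/trigpoly_eq; apply => [x|]; first by rewrite /factor leqNgt nK /= mul1r.
  by rewrite mul1r; case: (nat_of_ord n == j); case: (nat_of_ord n == i).
have := hasmean_prod ind hq.
move/hasmean_eq; apply => [t|].
  rewrite big_split /= weightE Re_realM -Re_cis; congr (_ * complex.Re _).
  rewrite /G -cis_sum; congr (cis _).
  have S k : (k < N)%N -> \sum_(n < N) (nat_of_ord n == k)%:R * (t * shift_log alpha n) = t * shift_log alpha k.
    move=> kN; rewrite (bigD1 (Ordinal kN)) //= eqxx mul1r big1 ?addr0 // => n nk.
    rewrite (_ : (nat_of_ord n == k) = false) ?mul0r //.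
    by apply: contraNF nk => /eqP h; apply/eqP/val_inj.
  under eq_bigr => n _ do rewrite mulrBl.
  by rewrite sumrB !S // opprK addrC.
have [ij|ij] := eqVneq i j.
  rewrite ij (eq_bigr (fun n : 'I_N => (if (n <= K)%N then J%:R else 1 : R)%:C)).
    by rewrite -rmorph_prod /= prod_if.
  by move=> n _; rewrite eqxx mulr1; case: ifP => _; rewrite ?rmorph_nat.
rewrite (bigD1 (Ordinal jN)) //= eqxx eq_sym (_ : (j == i) = false) ?mulr0 ?mul0r //.
by rewrite eq_sym; apply: negbTE.
Qed.

Lemma weight_block_mean (a : nat -> R) n : (n <= N)%N ->
  hasmean (fun t => weight J N K o alpha t * modc (block_sum alpha a K.+1 n t) ^+ 2)
   (J%:R ^+ K.+1 * \sum_(j < n) (if (K < j)%N then a j ^+ 2 else 0)).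
Proof.
move=> nN.
pose b j := if (K < j)%N then a j else 0.
have h : hasmean (fun t => \sum_(i < n) \sum_(j < n) (b i * b j) *
   (weight J N K o alpha t * cos (- (t * shift_log alpha i) - - (t * shift_log alpha j))))
   (\sum_(i < n) \sum_(j < n) b i * b j * (if nat_of_ord i == j then J%:R ^+ K.+1 else 0)).
  apply: hasmean_sum => i _; apply: hasmean_sum => j _.
  rewrite /b; case: ifP => Ki; last first.
    by apply: (hasmean_eq (hasmean_cst 0)) => [t|]; rewrite !mul0r.
  case: ifP => Kj; last first.
    by apply: (hasmean_eq (hasmean_cst 0)) => [t|]; rewrite mulr0 !mul0r.
  by apply: hasmeanZ; apply: weight_cos_mean => //; apply: leq_trans nN.
apply: (hasmean_eq h) => [t|].
  rewrite /block_sum (modc_sqr_sum n b (fun j => - (t * shift_log alpha j))).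
  rewrite mulr_sumr; apply: eq_bigr => i _; rewrite mulr_sumr; apply: eq_bigr => j _.
  by rewrite mulrCA.
rewrite mulr_sumr; apply: eq_bigr => i _.
rewrite (bigD1 i) //= eqxx big1 ?addr0; last first.
  move=> j ji; rewrite (_ : (nat_of_ord i == j) = false) ?mulr0 //.
  by rewrite eq_sym; apply: negbTE.
by rewrite mulrC /b; case: ifP; rewrite ?mul0r.
Qed.

End Means.

(* The weighted average of the energies is below the threshold, hence so is
   their value at some point. *)
Lemma good_height (J N K O : nat) o alpha a w (A B W S M0 : R) :
  0 < alpha -> (K < N)%N -> (0 < J)%N -> (J <= O)%N -> (forall n, o n ^+ 2 = 1) ->
  (forall n, `|o n| = 1) ->
  independent_upto O (fun n : 'I_N => shift_log alpha n) ->
  (forall j, 0 <= a j) -> (forall i, 0 <= w i) -> (forall n, \sum_(i < n) w i <= W) ->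
  0 <= A -> 0 <= B ->
  (forall n, \sum_(j < n) (if (K < j)%N then a j ^+ 2 else 0) <= S) ->
  A * (K.+1%:R * (2 / J%:R)) + 2 * B * ((2 * W + 1) * S) <= 1 / 2 ->
  2 * B * (J%:R ^+ 2) ^+ K.+1 * ((W + 1) * M0) <= J%:R ^+ K.+1 / 8 ->
  (forall n, \sum_(j < n) (if (N <= j)%N then a j ^+ 2 else 0) <= M0) ->
  (forall e, 0 < e -> exists T1 : nat, forall T n : nat, (T1 <= T)%N -> (n <= T ^ 2)%N ->
     exists2 M, (forall j, (j < n)%N -> (if (N <= j)%N then a j else 0) * (j%:R + alpha) <= M) &
     8 * M * harm n * \sum_(j < n) (if (N <= j)%N then a j else 0) <= e * T%:R) ->
  exists T0 : nat, forall T : nat, (T0 <= T)%N -> exists2 t : R, T%:R <= t <= 2 * T%:R &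
    A * (\sum_(n < K.+1) modc (cis (t * shift_log alpha n) - (o n)%:C) ^+ 2) +
    B * (modc (block_sum alpha a K.+1 (T ^ 2) t) ^+ 2 +
         \sum_(i < (T ^ 2)%N) w i * modc (block_sum alpha a K.+1 i.+1 t) ^+ 2) < 1.
Proof.
move=> a0 KN J0 JO o1 on ind apos wpos wW A0 B0 hS c1 c2 hM0 hoff.
pose P t := weight J N K o alpha t.
pose D t := \sum_(n < K.+1) modc (cis (t * shift_log alpha n) - (o n)%:C) ^+ 2.
pose blk n t := modc (block_sum alpha a K.+1 n t) ^+ 2.
(* [E1] gathers the blocks ending at or before [N], whose weighted means are exact; the coefficient
   [W + 1] anticipates that every longer block is split at [N]. *)
pose E1 t := (W + 1) * blk N t + \sum_(i < N) w i * blk i.+1 t.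
have W0 : 0 <= W by have := wW 0; rewrite big_ord0.
have S0 : 0 <= S by have := hS 0; rewrite big_ord0.
have M00 : 0 <= M0 by have := hM0 0; rewrite big_ord0.
set p := J%:R ^+ K.+1 in c2.
have p0 : 0 < p by rewrite exprn_gt0 // ltr0n.
pose sq n := \sum_(j < n) (if (K < j)%N then a j ^+ 2 else 0).
pose m1 := p - A * (\sum_(n < K.+1) p * (2 / J%:R)) -
   2 * B * ((W + 1) * (p * sq N) + \sum_(i < N) w i * (p * sq i.+1)).
have mean1 : hasmean (fun t => P t * (1 - A * D t - 2 * B * E1 t)) m1.
  have h1 : hasmean P p by apply: (@weight_mean J N K O).
  have h2 : hasmean (fun t => \sum_(n < K.+1) P t * modc (cis (t * shift_log alpha n) - (o n)%:C) ^+ 2)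
      (\sum_(n < K.+1) p * (2 / J%:R)).
    by apply: hasmean_sum => n _; apply: (@weight_dist_mean J N K O) => //; rewrite -ltnS.
  have h3 n : (n <= N)%N -> hasmean (fun t => P t * blk n t) (p * sq n).
    by move=> nN; apply: (@weight_block_mean J N K O).
  have h4 : hasmean (fun t => (W + 1) * (P t * blk N t) + \sum_(i < N) w i * (P t * blk i.+1 t))
      ((W + 1) * (p * sq N) + \sum_(i < N) w i * (p * sq i.+1)).
    apply: hasmeanD; first by apply: hasmeanZ; apply: h3.
    by apply: hasmean_sum => i _; apply: hasmeanZ; apply: h3.
  apply: (hasmean_eq (hasmeanD (hasmeanD h1 (hasmeanZ (- A) h2)) (hasmeanZ (- (2 * B)) h4))) => [t|].
    rewrite -mulr_sumr -/(D t).
    have -> : \sum_(i < N) w i * (P t * blk i.+1 t) = P t * \sum_(i < N) w i * blk i.+1 t.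
      by rewrite mulr_sumr; apply: eq_bigr => i _; rewrite mulrCA.
    by rewrite /E1; ring.
  by rewrite /m1; ring.
(* By [c1], phase errors and energy up to [N] cost at most half of the mean [p] of the weight. *)
have m1big : p / 2 <= m1.
  rewrite /m1 sumr_const card_ord -[X in A * X]mulr_natl.
  have h1 : (W + 1) * (p * sq N) + \sum_(i < N) w i * (p * sq i.+1) <= p * ((2 * W + 1) * S).
    have -> : p * ((2 * W + 1) * S) = (W + 1) * (p * S) + W * (p * S) by ring.
    apply: lerD; first by rewrite ler_wpM2l ?addr_ge0 // ler_wpM2l ?(ltW p0) // hS.
    apply: (@le_trans _ _ (\sum_(i < N) w i * (p * S))).
      by apply: ler_sum => i _; rewrite ler_wpM2l // ler_wpM2l ?(ltW p0) // hS.
    by rewrite -mulr_suml ler_wpM2r ?mulr_ge0 ?(ltW p0).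
  have h2 : 2 * B * ((W + 1) * (p * sq N) + \sum_(i < N) w i * (p * sq i.+1)) <= 2 * B * (p * ((2 * W + 1) * S)).
    by rewrite ler_wpM2l // mulr_ge0.
  have h3 : p * (A * (K.+1%:R * (2 / J%:R)) + 2 * B * ((2 * W + 1) * S)) <= p * (1 / 2).
    by rewrite ler_wpM2l // ltW.
  have E : A * (K.+1%:R * (p * (2 / J%:R))) = p * (A * (K.+1%:R * (2 / J%:R))) by ring.
  rewrite E.
  set X := (W + 1) * _ + _ in h2 *; set y := A * _ in h3 *; set v := (2 * W + 1) * S in h2 h3.
  have E2 : p * (2 * B * v) = 2 * B * (p * v) by ring.
  rewrite mulrDr E2 in h3; clear -h2 h3; lra.
have [Q1 [C1 [dQ1 bQ1]]] := mean1.
pose Pm : R := (J%:R ^+ 2) ^+ K.+1.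
have Pm0 : 0 <= Pm by rewrite exprn_ge0 // exprn_ge0.
pose cc := 2 * B * Pm * (W + 1).
have cc0 : 0 <= cc by rewrite !mulr_ge0 // addr_ge0.
have e0 : 0 < p / (8 * (cc + 1)) by rewrite divr_gt0 // mulr_gt0 // ltr_wpDl.
have [T1 hT1] := hoff _ e0.
have [n0 hn0] := natr_unbounded (16 * C1 / p).
exists (T1 + n0 + N + 1)%N => T hT.
have TT1 : (T1 <= T)%N by apply: leq_trans hT; rewrite -!addnA leq_addr.
have TT2 : (n0 <= T)%N by apply: leq_trans hT; rewrite -addnA [(T1 + n0)%N]addnC -addnA leq_addr.
have TN : (N <= T)%N by apply: leq_trans hT; rewrite -addnA [(N + 1)%N]addnC addnA leq_addl.
have T0 : (1 <= T)%N by apply: leq_trans hT; rewrite leq_addl.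
have NX : (N <= T ^ 2)%N by apply: (leq_trans TN); rewrite -{1}[T]expn1 leq_pexp2l.
set X := (T ^ 2)%N in NX *.
pose blk2 n t := modc (block_sum alpha a N n t) ^+ 2.
pose c n := \sum_(j < n) (if (N <= j)%N then a j ^+ 2 else 0).
have tpos : 0 < T%:R :> R by rewrite ltr0n.
(* Beyond [N] the unweighted [mean_square] is used. The default primitive 0 for n > X makes the
   family total for [choice]. *)
have hQ n : exists Q : R -> R, (n <= X)%N -> (forall t : R, is_derive t (1 : R) Q (blk2 n t)) /\
    Q (2 * T%:R) - Q T%:R <= T%:R * (M0 + p / (8 * (cc + 1))).
  have [nX|nX] := leqP n X; last by exists (fun=> 0).
  have [M hM1 hM2] := hT1 T n TT1 nX.
  have b0 j : 0 <= (if (N <= j)%N then a j else 0) by case: ifP.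
  have [Q [q1 q2]] := mean_square a0 b0 hM1.
  exists Q => _; split => //; apply: (le_trans (q2 _)); rewrite mulrDr; apply: lerD.
    rewrite ler_wpM2l ?(ltW tpos) //; apply: le_trans (hM0 n); apply: ler_sum => j _.
    by case: ifP => // _; rewrite expr0n.
  by rewrite [leRHS]mulrC.
have [Q2 hQ2] := choice hQ.
pose E2 t := blk2 X t + \sum_(i < X) (if (N <= i)%N then w i else 0) * blk2 i.+1 t.
pose QE t := Q2 X t + \sum_(i < X) (if (N <= i)%N then w i else 0) * Q2 i.+1 t.
have dQE t : is_derive t (1 : R) QE (E2 t).
  apply: is_deriveD; first by have [h _] := hQ2 X (leqnn _); apply: h.
  apply: (@is_derive_bigsum R 'I_X _ xpredT (fun i t => (if (N <= i)%N then w i else 0) * Q2 i.+1 t)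
     (fun i => (if (N <= i)%N then w i else 0) * blk2 i.+1 t)) => i _.
  by apply: is_deriveZ; have [h _] := hQ2 i.+1 (ltn_ord i); apply: h.
have bQE : QE (2 * T%:R) - QE T%:R <= (W + 1) * (T%:R * (M0 + p / (8 * (cc + 1)))).
  rewrite [leLHS](_ : _ = (Q2 X (2 * T%:R) - Q2 X T%:R) +
     (\sum_(i < X) (if (N <= i)%N then w i else 0) * Q2 i.+1 (2 * T%:R) -
      \sum_(i < X) (if (N <= i)%N then w i else 0) * Q2 i.+1 T%:R)); last by rewrite /QE; ring.
  set V := T%:R * (M0 + _).
  have -> : (W + 1) * V = V + W * V by ring.
  rewrite -sumrB; apply: lerD; first by have [_ h] := hQ2 X (leqnn _).
  have V0 : 0 <= V by rewrite mulr_ge0 ?(ltW tpos) // addr_ge0 // ltW.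
  apply: (@le_trans _ _ (\sum_(i < X) w i * V)); last by rewrite -mulr_suml ler_wpM2r.
  apply: ler_sum => i _; rewrite -mulrBr.
  apply: (@le_trans _ _ ((if (N <= i)%N then w i else 0) * V)).
    rewrite ler_wpM2l //; first by case: ifP.
    by have [_ h] := hQ2 i.+1 (ltn_ord i).
  by rewrite ler_wpM2r //; case: ifP.
(* The derivative [f] is a minorant of the weighted quantity, the weight being replaced by its
   maximum [Pm] past [N]. If [F] grows over [T, 2T], then [f] is positive somewhere. *)
pose F t := Q1 t - 2 * B * Pm * QE t.
pose f t := P t * (1 - A * D t - 2 * B * E1 t) - 2 * B * Pm * E2 t.
have dF t : is_derive t (1 : R) F (f t).
  by apply: is_deriveB; apply: is_deriveZ.
have T2T : T%:R <= 2 * T%:R :> R by rewrite mulr_natl mulr2n lerDl ltW.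
have cF : {within `[T%:R, 2 * T%:R], continuous F}.
  by apply: derivable_within_continuous => t _; have [] := dF t.
have [t tT Ft] := @MVT_segment R F f T%:R (2 * T%:R) T2T (fun t _ => dF t) cF.
(* The main term is at least p T / 2, the bounded errors cost p T / 8, and the terms beyond [N] cost
   p T / 4. *)
have inc : 0 < F (2 * T%:R) - F T%:R.
  have hC : 2 * C1 <= p / 8 * T%:R.
    have : 16 * C1 / p <= T%:R by apply: (le_trans hn0); rewrite ler_nat.
    rewrite ler_pdivrMr // => h; clear -h; lra.
  have q1 := bQ1 (2 * T%:R); have q2 := bQ1 T%:R.
  move: q1 q2; rewrite !ler_norml => /andP[q1 q1'] /andP[q2 q2'].
  have hm : p / 2 * T%:R <= m1 * T%:R by rewrite ler_wpM2r // ltW.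
  have hE : 2 * B * Pm * (QE (2 * T%:R) - QE T%:R) <= cc * (T%:R * (M0 + p / (8 * (cc + 1)))).
    rewrite /cc -[X in _ <= X]mulrA; apply: ler_wpM2l => //; by rewrite !mulr_ge0.
  have hc : cc * (T%:R * (M0 + p / (8 * (cc + 1)))) <= p / 4 * T%:R.
    rewrite mulrCA mulrC ler_wpM2r ?(ltW tpos) // mulrDr.
    have c2' : cc * M0 <= p / 8 by apply: le_trans c2; rewrite /cc /Pm -[X in _ <= X]mulrA !mulrA.
    have c3 : cc * (p / (8 * (cc + 1))) <= p / 8.
      have -> : cc * (p / (8 * (cc + 1))) = (p / 8) * (cc / (cc + 1)).
        by field; rewrite gt_eqF // ltr_wpDl.
      rewrite -[leRHS]mulr1 ler_wpM2l ?divr_ge0 ?(ltW p0) //.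
      by rewrite ler_pdivrMr ?ltr_wpDl // mul1r lerDl.
    clear -c2' c3; lra.
  rewrite /F; move: hE; rewrite mulrBr.
  have pT : 0 < p * T%:R by rewrite mulr_gt0.
  set u := 2 * B * Pm * QE (2 * T%:R); set v := 2 * B * Pm * QE T%:R => h.
  clear -h q1 q1' q2 q2' hm hc hC pT; lra.
exists t; first by move: tT; rewrite in_itv.
have tp : 2 * T%:R - T%:R = T%:R :> R by ring.
rewrite tp in Ft; rewrite Ft in inc.
have fpos : 0 < f t by move: inc; rewrite pmulr_lgt0.
have P0 : 0 <= P t by apply: weight_ge0.
have PPm : P t <= Pm by apply: weight_le.
have blk20 n : 0 <= blk2 n t by apply: sqr_ge0.
have E20 : 0 <= E2 t.
  rewrite /E2 addr_ge0 //; apply: sumr_ge0 => i _; rewrite mulr_ge0 //; by case: ifP.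
have key : 0 < P t * (1 - A * D t - 2 * B * E1 t - 2 * B * E2 t).
  have : 2 * B * (P t * E2 t) <= 2 * B * (Pm * E2 t) by rewrite ler_wpM2l ?mulr_ge0 // ler_wpM2r.
  move: fpos; rewrite /f -/(E2 t).
  set u := E2 t; set v := D t; set v' := E1 t; set q := P t => h1 h2.
  clear -h1 h2; lra.
have key2 : 0 < 1 - A * D t - 2 * B * E1 t - 2 * B * E2 t.
  rewrite ltNge; apply/negP => h.
  have : P t * (1 - A * D t - 2 * B * E1 t - 2 * B * E2 t) <= 0 by rewrite mulr_ge0_le0.
  by rewrite leNgt key.
(* This splitting of a block at [N] is the origin of the 2 in [2 * B]. *)
have tri n : (N <= n)%N -> blk n t <= 2 * blk N t + 2 * blk2 n t.
  move=> Nn; rewrite /blk /blk2 -(block_sumB alpha a t KN Nn).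
  set u := block_sum alpha a K.+1 n t; set v := block_sum alpha a K.+1 N t.
  have h : modc u <= modc v + modc (u - v) by rewrite -{1}(subrK v u) addrC; apply: modcD.
  have h0 := modc_ge0 u; have h1 := modc_ge0 v; have h2 := modc_ge0 (u - v).
  have : modc u ^+ 2 <= (modc v + modc (u - v)) ^+ 2 by rewrite ler_pXn2r // nnegrE // addr_ge0.
  have := sqr_ge0 (modc v - modc (u - v)).
  rewrite !expr2 => k1 k2; clear -k1 k2; lra.
have blk0 n : 0 <= blk n t by apply: sqr_ge0.
have sumE : \sum_(i < X) w i * blk i.+1 t <= 2 * W * blk N t + 2 * (\sum_(i < N) w i * blk i.+1 t)
    + 2 * (\sum_(i < X) (if (N <= i)%N then w i else 0) * blk2 i.+1 t).
  apply: (@le_trans _ _ (\sum_(i < X) (2 * w i * blk N t + 2 * (if (i < N)%N then w i * blk i.+1 t else 0)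
     + 2 * ((if (N <= i)%N then w i else 0) * blk2 i.+1 t)))).
    apply: ler_sum => i _; case: (ltnP i N) => iN /=.
      rewrite mul0r mulr0 addr0.
      have q1 : 0 <= w i * blk i.+1 t by rewrite mulr_ge0.
      have q2 : 0 <= w i * blk N t by rewrite mulr_ge0.
      clear -q1 q2; lra.
    have := tri i.+1 (leq_trans iN (leqnSn _)) => h.
    have := ler_wpM2l (wpos i) h; rewrite mulrDr => h'; clear -h'; lra.
  rewrite !big_split /= -!mulr_suml -!mulr_sumr lerD2r; apply: lerD.
    by rewrite -!mulrA ler_wpM2l // ler_wpM2r // wW.
  rewrite ler_wpM2l // -big_mkcond /=.
  by rewrite -(big_ord_widen X (fun i => w i * blk i.+1 t) NX).
have triX := tri X NX.
have fin : blk X t + \sum_(i < X) w i * blk i.+1 t <= 2 * E1 t + 2 * E2 t.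
  apply: (le_trans (lerD triX sumE)); rewrite le_eqVlt; apply/orP; left; apply/eqP.
  by rewrite /E1 /E2; ring.
have := ler_wpM2l B0 fin; rewrite -/(D t) => h.
have key3 : A * D t + B * (2 * E1 t + 2 * E2 t) < 1.
  rewrite (_ : _ + _ = 1 - (1 - A * D t - 2 * B * E1 t - 2 * B * E2 t)); last by ring.
  by rewrite gtrBl.
apply: le_lt_trans key3; by rewrite lerD2l.
Qed.

End Selection.

(** * Approximation of the zeta function near the selected height *)

Section Bounds.
Context {R : realType}.
Implicit Types (z w s : R[i]) (x y h e d q r alpha M t : R).

Lemma abel_sum (b v : nat -> R[i]) n :
  \sum_(j < n) b j * v j = (\sum_(j < n) b j) * v n +
     \sum_(i < n) (\sum_(j < i.+1) b j) * (v i - v i.+1).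
Proof.
elim: n => [|n IH]; first by rewrite !big_ord0 mul0r addr0.
by rewrite !(big_ord_recr n) /= IH; ring.
Qed.

Definition tele_cst d : R := 2 `^ (d + 1) / d.

Lemma tele_cst_ge0 d : 0 < d -> 0 <= tele_cst d.
Proof. by move=> d0; rewrite divr_ge0 ?powR_ge0 // ltW. Qed.

Lemma sum_powR d m n alpha : 0 < d -> 0 <= alpha -> (0 < m)%N ->
  \sum_(j < n) (if (m <= j)%N then (j%:R + alpha) `^ (- d - 1) else 0) <= tele_cst d * m%:R `^ (- d).
Proof.
move=> d0 a0 m0; have C0 := tele_cst_ge0 d0.
have main : \sum_(j < n) (if (m <= j)%N then (j%:R + alpha) `^ (- d - 1) else 0) <=
    (if (m <= n)%N then tele_cst d * (m%:R `^ (- d) - n%:R `^ (- d)) else 0).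
  elim: n => [|n IH]; first by rewrite big_ord0; case: ifP => //; rewrite leqn0 eqn0Ngt m0.
  rewrite big_ord_recr /=; case: (leqP m n) IH => mn IH.
    rewrite (leqW mn).
    have n1 : 1 <= n%:R :> R by rewrite ler1n (leq_trans m0).
    have t := @powR_tele R d n%:R d0 n1; rewrite -/(tele_cst d) natr1 in t.
    have h : (n%:R + alpha) `^ (- d - 1) <= n%:R `^ (- d - 1).
      rewrite -opprD; apply: powR_antimono; [lra|lra|by rewrite lerDl].
    rewrite mulrBr in t IH *; rewrite mulrBr; lra.
  rewrite addr0; case: ifP => // mn1.
  have -> : n.+1%:R = m%:R :> R by congr (_%:R); apply/eqP; rewrite eqn_leq mn1 mn.
  by rewrite subrr mulr0.
apply: (le_trans main); case: ifP => _; last by rewrite mulr_ge0 ?powR_ge0.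
by rewrite ler_wpM2l // gerBl powR_ge0.
Qed.

Lemma xpow_cis x q t : 0 < x -> xpow x (q +i* t) = (x `^ (- q))%:C * cis (- (t * ln x)).
Proof.
move=> x0; rewrite xpowE /cis.
have -> : - (q +i* t) * (ln x)%:C = (- q * ln x)%:C + 'i * (- (t * ln x))%:C.
  by apply/eqP; rewrite eq_complex /=; apply/andP; split; apply/eqP; ring.
by rewrite cexpD cexpR /powR gt_eqF.
Qed.

(** 4 is [rem_cst 0 2], and the second factor is that of [log_powR] at e = 1/64. *)
Definition abel_cst : R := 4 * (1 + 2 / (1 / 64)).

Lemma abel_cst_ge1 : 1 <= abel_cst.
Proof. by rewrite /abel_cst; lra. Qed.

(** On the disc the real part is at least 1 + 1/16 - 1/64, and the logarithm takes another 1/64;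
    what remains is 1 + 1/32. *)
Definition abel_weight i : R := abel_cst * i%:R `^ (- (1 / 32) - 1).

Lemma abel_weight_ge0 i : 0 <= abel_weight i.
Proof. by rewrite mulr_ge0 ?powR_ge0 //; have := abel_cst_ge1; lra. Qed.

Definition abel_total : R := abel_cst * tele_cst (1 / 32).

Lemma abel_total_ge0 : 0 <= abel_total.
Proof.
by apply: mulr_ge0; [have := abel_cst_ge1; lra|apply: tele_cst_ge0; lra].
Qed.

Lemma abel_weight_sum n : \sum_(i < n) abel_weight i <= abel_total.
Proof.
have d0 : (0 : R) < 1 / 32 by lra.
have := @sum_powR (1 / 32) 1 n 0 d0 (lexx _) isT.
rewrite powR1 mulr1 => h.
rewrite /abel_weight -mulr_sumr ler_wpM2l //; first by have := abel_cst_ge1; lra.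
apply: le_trans h; apply: ler_sum => j _.
rewrite addr0; case: (nat_of_ord j) => //=.
(* At index 0 the weight vanishes, by the convention on powers of 0. *)
rewrite powR0 //; lra.
Qed.

Definition tail_poly alpha (s0 : R) t K n z : R[i] :=
  \sum_(j < n) (if (K < j)%N then xpow (j%:R + alpha) ((s0 +i* t) + z) else 0).

(** Splitting 1/16 off the exponent leaves a factor that decays on the whole disc |z| <= 1/64, while
    for s0 near 1 the coefficients remain square summable. *)
Lemma tail_poly_block alpha (s0 : R) t K n z : 0 < alpha ->
  tail_poly alpha s0 t K n z =
  \sum_(j < n) ((if (K.+1 <= j)%N then (j%:R + alpha) `^ (- (s0 - 1 / 16)) else 0)%:C *
     cis (- (t * shift_log alpha j))) * xpow (j%:R + alpha) ((1 / 16)%:C + z).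
Proof.
move=> a0; apply: eq_bigr => j _; case: ifP => Kj; last by rewrite !mul0r.
have -> : (s0 +i* t) + z = ((s0 - 1 / 16) +i* t) + ((1 / 16)%:C + z).
  rewrite addrA; congr (_ + _); apply/eqP; rewrite eq_complex /=.
  by apply/andP; split; apply/eqP; ring.
by rewrite xpowD xpow_cis // shift_gt0.
Qed.

Lemma modc_small_Re z r : modc z <= r -> - r <= complex.Re z.
Proof.
by move=> h; have := le_trans (modc_Re z) h; rewrite ler_norml => /andP[].
Qed.

(** A difference of consecutive powers is a Taylor remainder of order 0 at 1 + 1/16 + z, for which
    both bounds are available. *)
Lemma abel_diff alpha (i : nat) z w : 0 < alpha < 1 -> (0 < i)%N ->
  modc z <= 1 / 64 -> modc w <= 1 / 64 ->
  let v i z := xpow (i%:R + alpha) ((1 / 16)%:C + z) in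
  modc ((v i z - v i.+1 z) - (v i w - v i.+1 w)) <= modc (z - w) * abel_weight i /\
  modc (v i z - v i.+1 z) <= abel_weight i.
Proof.
move=> /andP[a0 a1] i0 hz hw v.
have x1 := shift_ge1 a0 i0; set x := i%:R + alpha in x1.
have E (u : R[i]) : v i u - v i.+1 u = - taylor_rem 0 x (1 + (1 / 16)%:C + u) 1.
  rewrite /taylor_rem big_ord1 cbin0 addr0 expr0 mulr1 [1 * xpow _ _]mul1r opprB.
  have -> : 1 + (1 / 16)%:C + u - 1 = (1 / 16)%:C + u by ring.
  by rewrite /v shift1.
have i01 : 0 <= (1 : R) <= 1 by rewrite ler01 lexx.
have hq (u : R[i]) : modc u <= 1 / 64 -> 67 / 64 <= complex.Re (1 + (1 / 16)%:C + u).
  by move=> /modc_small_Re; rewrite !raddfD /=; lra.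
have hS (u : R[i]) : modc u <= 1 / 64 -> modc (1 + (1 / 16)%:C + u) <= 2.
  move=> hu; apply: (le_trans (modcD _ _)); have := modcD 1 (1 / 16 : R)%:C.
  by rewrite Normc.normc1 modcR ger0_norm; lra.
have q0 : 0 <= 67 / 64 + 0%:R :> R by lra.
have e0 : (0 : R) < 1 / 64 by lra.
have e1 : (1 / 64 : R) <= 1 by lra.
have lg := @log_powR R (1 / 64) x e0 e1 x1.
have L0 : 0 <= ln (x + 1) by rewrite ln_ge0 //; lra.
have wt : 4 * (1 + ln (x + 1)) * x `^ (- (67 / 64 + 0%:R)) <= abel_weight i.
  apply: (@le_trans _ _ (abel_cst * x `^ (- (1 / 32) - 1))).
    have -> : x `^ (- (1 / 32) - 1) = x `^ (1 / 64) * x `^ (- (67 / 64 + 0%:R)).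
      by rewrite powR_add; [congr (powR x _); lra|lra].
    rewrite [leRHS]mulrA ler_wpM2r ?powR_ge0 // /abel_cst; move: lg; set X := x `^ _; lra.
  rewrite ler_wpM2l //; first by have := abel_cst_ge1; lra.
  rewrite -opprD; apply: powR_antimono; [lra|by rewrite ltr0n|by rewrite lerDl ltW].
have wt2 : 4 * x `^ (- (67 / 64 + 0%:R)) <= abel_weight i.
  apply: le_trans wt; rewrite ler_wpM2r ?powR_ge0 //; lra.
have c0 : rem_cst 0 (2 : R) = 4 by rewrite rem_cst0; ring.
split.
  rewrite !E -opprD modcN.
  have := @taylor_rem_lip R 0 (67 / 64) 2 x _ _ 1 x1 i01 (hq _ hz) (hq _ hw) (hS _ hz) (hS _ hw) q0.
  rewrite c0 (_ : 1 + (1 / 16)%:C + z - (1 + (1 / 16)%:C + w) = z - w); last by ring.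
  by move=> h; apply: (le_trans h); rewrite ler_wpM2l ?modc_ge0.
rewrite E modcN.
have := @taylor_rem_bound R 0 (67 / 64) 2 x _ 1 x1 i01 (hq _ hz) (hS _ hz) q0.
by rewrite c0 => h; apply: le_trans h wt2.
Qed.

Lemma abel_last alpha (n : nat) z w : 0 < alpha < 1 -> (0 < n)%N ->
  modc z <= 1 / 64 -> modc w <= 1 / 64 ->
  let v z := xpow (n%:R + alpha) ((1 / 16)%:C + z) in
  modc (v z - v w) <= modc (z - w) * abel_cst /\ modc (v z) <= abel_cst.
Proof.
move=> /andP[a0 a1] n0 hz hw v.
have x1 := shift_ge1 a0 n0; rewrite /v; set x := n%:R + alpha in x1 *.
have hq (u : R[i]) : modc u <= 1 / 64 -> 3 / 64 <= complex.Re ((1 / 16)%:C + u).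
  by move=> /modc_small_Re; rewrite !raddfD /=; lra.
have e0 : (0 : R) < 1 / 64 by lra.
have e1 : (1 / 64 : R) <= 1 by lra.
have lg := @log_powR R (1 / 64) x e0 e1 x1.
have le1 q : q <= 0 -> x `^ q <= 1 by move=> q0; rewrite -(powRr0 x); apply: ler_powR.
split; last first.
  rewrite modc_xpow; last by lra.
  apply: (@le_trans _ _ 1); last exact: abel_cst_ge1.
  apply: le1; have := hq _ hz; lra.
apply: (le_trans (xpow_lip x1 (hq _ hz) (hq _ hw))).
rewrite (_ : (1 / 16)%:C + z - ((1 / 16)%:C + w) = z - w); last by ring.
rewrite ler_wpM2l ?modc_ge0 //.
apply: (@le_trans _ _ ((1 + 2 / (1 / 64)) * x `^ (1 / 64) * x `^ (- (3 / 64)))).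
  rewrite ler_wpM2r ?powR_ge0 //; apply: le_trans lg.
  apply: (@le_trans _ _ (ln (x + 1))); last by rewrite lerDr.
  by rewrite ler_ln ?posrE; lra.
rewrite -mulrA powR_add; last by lra.
have h : x `^ (1 / 64 + - (3 / 64)) <= 1 by apply: le1; lra.
move: h; rewrite /abel_cst; set X := x `^ _; lra.
Qed.

(* Abel summation controls the tail on a whole disc by the energy of its partial sums. *)
Lemma tail_poly_small alpha (s0 : R) t K n (lam : R) : 0 < alpha < 1 -> (0 < n)%N -> 0 < lam ->
  let a j := (j%:R + alpha) `^ (- (s0 - 1 / 16)) in
  modc (block_sum alpha a K.+1 n t) ^+ 2 +
    \sum_(i < n) abel_weight i * modc (block_sum alpha a K.+1 i.+1 t) ^+ 2 <= lam ^+ 2 ->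
  (forall z w, modc z <= 1 / 64 -> modc w <= 1 / 64 ->
    modc (tail_poly alpha s0 t K n z - tail_poly alpha s0 t K n w) <=
      modc (z - w) * (lam * (abel_total + abel_cst + 1))) /\
  modc (tail_poly alpha s0 t K n 0) <= lam * (abel_total + abel_cst + 1).
Proof.
move=> a01 n0 l0 a hE; have /andP[a0 a1] := a01.
pose bl i := block_sum alpha a K.+1 i t.
pose v i z := xpow (i%:R + alpha) ((1 / 16)%:C + z).
have S0 : 0 <= \sum_(i < n) abel_weight i * modc (bl i.+1) ^+ 2.
  by apply: sumr_ge0 => i _; rewrite mulr_ge0 ?abel_weight_ge0 ?sqr_ge0.
have hX : modc (bl n) <= lam.
  rewrite -(@ler_pXn2r _ 2) ?nnegrE ?modc_ge0 ?(ltW l0) //.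
  by apply: le_trans hE; rewrite lerDl.
have hsum : \sum_(i < n) abel_weight i * modc (bl i.+1) <= lam * (abel_total + 1).
  (* From m <= lam + m^2 / lam, which passes from the energy to the sum of moduli. *)
  have am i : abel_weight i * modc (bl i.+1) <= lam * abel_weight i + lam^-1 * (abel_weight i * modc (bl i.+1) ^+ 2).
    have w0 := abel_weight_ge0 i.
    rewrite [lam * _]mulrC [X in _ + X]mulrCA -mulrDr ler_wpM2l //.
    set m := modc _.
    have m0 : 0 <= m by apply: modc_ge0.
    have : 0 <= lam^-1 * (m - lam) ^+ 2 by rewrite mulr_ge0 ?sqr_ge0 // invr_ge0 ltW.
    have -> : lam^-1 * (m - lam) ^+ 2 = lam^-1 * m ^+ 2 - 2 * m + lam by field; rewrite gt_eqF.
    lra.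
  apply: (@le_trans _ _ (\sum_(i < n) (lam * abel_weight i + lam^-1 * (abel_weight i * modc (bl i.+1) ^+ 2)))).
    by apply: ler_sum => i _; apply: am.
  rewrite big_split /= -[X in X + _]mulr_sumr -[X in _ + X]mulr_sumr mulrDr mulr1; apply: lerD.
    by rewrite ler_wpM2l ?(ltW l0) // abel_weight_sum.
  rewrite mulrC ler_pdivrMr // -expr2; apply: le_trans hE.
  by rewrite lerDr sqr_ge0.
have rep z : tail_poly alpha s0 t K n z = bl n * v n z + \sum_(i < n) bl i.+1 * (v i z - v i.+1 z).
  rewrite tail_poly_block //.
  exact: (abel_sum (fun j => (if (K.+1 <= j)%N then a j else 0)%:C * cis (- (t * shift_log alpha j))) (v ^~ z)).
(* This disposes of the index 0, which [abel_diff] excludes. *)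
have bl1 : bl 1 = 0 by rewrite /bl /block_sum big_ord1 mul0r.
split.
  move=> z w hz hw; rewrite !rep.
  have -> : bl n * v n z + \sum_(i < n) bl i.+1 * (v i z - v i.+1 z) -
     (bl n * v n w + \sum_(i < n) bl i.+1 * (v i w - v i.+1 w)) =
     bl n * (v n z - v n w) + \sum_(i < n) bl i.+1 * ((v i z - v i.+1 z) - (v i w - v i.+1 w)).
    have -> : \sum_(i < n) bl i.+1 * ((v i z - v i.+1 z) - (v i w - v i.+1 w)) =
      \sum_(i < n) bl i.+1 * (v i z - v i.+1 z) - \sum_(i < n) bl i.+1 * (v i w - v i.+1 w).
      by rewrite -sumrB; apply: eq_bigr => i _; rewrite mulrBr.
    ring.
  apply: (le_trans (modcD _ _)); apply: (@le_trans _ _ (modc (z - w) * (lam * abel_cst) +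
      modc (z - w) * (\sum_(i < n) abel_weight i * modc (bl i.+1)))).
    apply: lerD.
      rewrite modcM mulrCA; apply: ler_pM; rewrite ?modc_ge0 //.
      by have [] := @abel_last alpha n z w a01 n0 hz hw.
    apply: (le_trans (modc_sum _ _ _)); rewrite mulr_sumr; apply: ler_sum => i _.
    rewrite modcM; case: (posnP i) => [->|i0]; first by rewrite bl1 Normc.normc0 mul0r !mulr0.
    rewrite mulrA [leRHS]mulrC ler_wpM2l ?modc_ge0 //.
    by have [] := @abel_diff alpha i z w a01 i0 hz hw.
  rewrite -mulrDr ler_wpM2l ?modc_ge0 //; lra.
have z0 : modc (0 : R[i]) <= 1 / 64 by rewrite Normc.normc0; lra.
rewrite rep; apply: (le_trans (modcD _ _)); apply: (@le_trans _ _ (lam * abel_cst +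
      (\sum_(i < n) abel_weight i * modc (bl i.+1)))); last by lra.
apply: lerD.
  rewrite modcM; apply: ler_pM; rewrite ?modc_ge0 //.
  by have [] := @abel_last alpha n 0 0 a01 n0 z0 z0.
apply: (le_trans (modc_sum _ _ _)); apply: ler_sum => i _.
rewrite modcM; case: (posnP i) => [->|i0]; first by rewrite bl1 Normc.normc0 mul0r !mulr0.
rewrite [leRHS]mulrC ler_wpM2l ?modc_ge0 //.
by have [] := @abel_diff alpha i 0 0 a01 i0 z0 z0.
Qed.

End Bounds.

(** * Off-diagonal bound and linearization of the leading sum *)

Section MainPart.
Context {R : realType}.
Implicit Types (z w : R[i]) (x y h e d q r alpha t : R).

(** Since sg >= 7/8 and j + alpha <= T^2, one may take M = T^(1/4). The sum of coefficients is at
    most 2 M times a harmonic sum, itself O(T^(1/8)), so the total is O(T^(3/4)). *)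
Lemma off_diag_small sg alpha N e : 7 / 8 <= sg <= 1 -> 0 < alpha < 1 -> (0 < N)%N -> 0 < e ->
  exists T1 : nat, forall T n : nat, (T1 <= T)%N -> (n <= T ^ 2)%N ->
     exists2 M, (forall j, (j < n)%N -> (if (N <= j)%N then (j%:R + alpha) `^ (- sg) else 0) * (j%:R + alpha) <= M) &
     8 * M * harm n * \sum_(j < n) (if (N <= j)%N then (j%:R + alpha) `^ (- sg) else 0) <= e * T%:R.
Proof.
move=> /andP[sg0 sg1] /andP[a0 a1] N0 e0.
pose c : R := 1 + 2 / (1 / 16); have c0 : 0 <= c by rewrite /c; lra.
pose C := 16 * (c * c); have C0 : 0 <= C by rewrite mulr_ge0 // mulr_ge0.
have d0 : (0 : R) < 1 / 4 by lra.
have eC : 0 < e / (C + 1) by rewrite divr_gt0 // ltr_wpDl.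
have [L L1 HL] := powR_small d0 eC.
have [n0 hn0] := natr_unbounded L.
exists n0.+1 => T n hT nT.
have T0 : (0 < T)%N by apply: leq_trans hT.
have t1 : 1 <= T%:R :> R by rewrite ler1n.
have small : T%:R `^ (- (1 / 4)) <= e / (C + 1).
  by apply: HL; apply: (le_trans hn0); rewrite ler_nat; apply: ltnW.
set t := T%:R in t1 small *.
have t0 : 0 <= t by apply: le_trans t1.
have t2 : t ^+ 2 = t `^ 2 by rewrite powR_mulrn.
have tt : 1 <= t ^+ 2 by rewrite expr_ge1.
have M0 : 0 <= t `^ (1 / 4) by apply: powR_ge0.
have key j : (j < n)%N -> (N <= j)%N -> (j%:R + alpha) `^ (- sg) * (j%:R + alpha) <= t `^ (1 / 4).
  move=> jn Nj; have j0 : (0 < j)%N by apply: leq_trans Nj.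
  have x1 := shift_ge1 a0 j0.
  have xt : j%:R + alpha <= t ^+ 2.
    apply: (@le_trans _ _ j.+1%:R); first by rewrite -natr1 lerD2l ltW.
    by rewrite -natrX ler_nat; apply: leq_trans nT.
  set x := j%:R + alpha in x1 xt *.
  have x0 : 0 < x by apply: lt_le_trans x1.
  rewrite -{2}[x]powRr1 ?(ltW x0) // powR_add //.
  apply: (@le_trans _ _ (x `^ (1 / 8))); first by apply: ler_powR => //; clear -sg0; lra.
  apply: (@le_trans _ _ ((t ^+ 2) `^ (1 / 8))).
    by apply: ge0_ler_powR; rewrite ?nnegrE; clear -x0 xt; lra.
  rewrite t2 -powRrM; apply: ler_powR => //; clear; lra.
exists (t `^ (1 / 4)) => [j jn|]; first by case: ifP => [/(key j jn)//|_]; rewrite mul0r.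
have hsum : \sum_(j < n) (if (N <= j)%N then (j%:R + alpha) `^ (- sg) else 0) <= 2 * t `^ (1 / 4) * harm n.
  rewrite /harm mulr_sumr; apply: ler_sum => j _; case: ifP => Nj; last first.
    by rewrite !mulr_ge0 // invr_ge0.
  have j0 : (0 < j)%N by apply: leq_trans Nj.
  have x0 := shift_gt0 j a0.
  have h := key j (ltn_ord j) Nj.
  have : (j%:R + alpha) `^ (- sg) <= t `^ (1 / 4) / (j%:R + alpha) by rewrite ler_pdivlMr.
  move=> h2; apply: (le_trans h2).
  have hj : j.+1%:R <= 2 * (j%:R + alpha).
    have : 1 <= (nat_of_ord j)%:R :> R by rewrite ler1n.
    by rewrite -natr1; clear -a0; lra.
  apply: (@le_trans _ _ (t `^ (1 / 4) * (2 / j.+1%:R))); last by rewrite le_eqVlt mulrA [_ * 2]mulrC eqxx.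
  by rewrite ler_wpM2l // ler_pdivlMr ?ltr0n // mulrC ler_pdivrMr.
have hh : harm n <= c * t `^ (1 / 8).
  have X0 : (0 < T ^ 2)%N by rewrite expn_gt0 T0.
  apply: (le_trans (harm_mono nT)); rewrite -(prednK X0); apply: (le_trans (harm_log _)).
  rewrite (prednK X0) natrX -/t.
  have f0 : (0 : R) < 1 / 16 by lra.
  have f1 : (1 / 16 : R) <= 1 by lra.
  have lg := @log_powR R (1 / 16) (t ^+ 2) f0 f1 tt.
  apply: (@le_trans _ _ (1 + ln (t ^+ 2 + 1))).
    by rewrite lerD2l ler_ln ?posrE; clear -tt; lra.
  apply: (le_trans lg); rewrite -/c ler_wpM2l // t2 -powRrM; apply: ler_powR => //; clear; lra.
have h0 := @harm_ge0 R n.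
apply: (@le_trans _ _ (8 * t `^ (1 / 4) * harm n * (2 * t `^ (1 / 4) * harm n))).
  by rewrite ler_wpM2l // !mulr_ge0.
have -> : 8 * t `^ (1 / 4) * harm n * (2 * t `^ (1 / 4) * harm n) =
   16 * (t `^ (1 / 4) * t `^ (1 / 4)) * (harm n * harm n) by ring.
apply: (@le_trans _ _ (16 * (t `^ (1 / 4) * t `^ (1 / 4)) * ((c * t `^ (1 / 8)) * (c * t `^ (1 / 8))))).
  by rewrite ler_wpM2l ?mulr_ge0 // ler_pM.
have E : (t `^ (1 / 4) * t `^ (1 / 4)) * (t `^ (1 / 8) * t `^ (1 / 8)) = t * t `^ (- (1 / 4)).
  have tp : 0 < t by apply: lt_le_trans t1.
  rewrite -[X in _ = X * _]powRr1 // !powR_add //; congr (powR t _); clear; lra.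
rewrite [leLHS](_ : _ = C * ((t `^ (1 / 4) * t `^ (1 / 4)) * (t `^ (1 / 8) * t `^ (1 / 8)))); last by rewrite /C; ring.
rewrite E.
have C1 : 0 < C + 1 by clear -C0; lra.
have P0 : 0 <= t `^ (- (1 / 4)) by apply: powR_ge0.
have Ce : C * t `^ (- (1 / 4)) <= e by move: small; rewrite ler_pdivlMr // mulrDr mulr1 [_ * C]mulrC => h; clear -h P0; lra.
have -> : C * (t * t `^ (- (1 / 4))) = (C * t `^ (- (1 / 4))) * t by ring.
by rewrite ler_wpM2r.
Qed.

Lemma expR_eighth : expR (1 / 8) - 1 <= 1 / 4 :> R.
Proof.
have h := @expR_ge1Dx R (- (1 / 8)).
have e0 := @expR_gt0 R (1 / 8).
rewrite expRN in h.
have : (expR (1 / 8))^-1 * expR (1 / 8) = 1 :> R by rewrite mulVf ?gt_eqF.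
move: h; set E := expR (1 / 8) in e0 *; set F := E^-1 => h1 h2.
have : (1 + - (1 / 8)) * E <= F * E by rewrite ler_wpM2r // ltW.
rewrite h2; lra.
Qed.

Lemma xpow_split x (s0 : R) z : 0 < x ->
  xpow x (s0%:C + z) = (x `^ (- s0))%:C * cexp (- z * (ln x)%:C).
Proof.
move=> x0; rewrite !xpowE opprD mulrDl cexpD; congr (_ * _).
by rewrite -rmorphN -rmorphM cexpR /powR gt_eqF.
Qed.

(** In this range the power is linear up to a quarter of its slope, by [cexp_sub_id_lip] and
    [expR_eighth]. *)
Lemma xpow_near x (s0 r : R) z w : 0 < x -> r * `|ln x| <= 1 / 8 -> modc z <= r -> modc w <= r ->
  modc (xpow x (s0%:C + z) - xpow x (s0%:C + w) + (ln x * x `^ (- s0))%:C * (z - w)) <=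
     modc (z - w) * (`|ln x| * x `^ (- s0)) / 4 /\
  modc (xpow x (s0%:C + z) - xpow x (s0%:C + w)) <= modc (z - w) * (`|ln x| * x `^ (- s0)) * 2.
Proof.
move=> x0 rx zr wr.
set u := x `^ (- s0); have u0 : 0 <= u by apply: powR_ge0.
have h v : modc v <= r -> modc (- v * (ln x)%:C) <= 1 / 8.
  by move=> vr; apply: le_trans rx; rewrite modcM modcN modcR ler_wpM2r.
have E : xpow x (s0%:C + z) - xpow x (s0%:C + w) + (ln x * u)%:C * (z - w) =
   u%:C * (cexp (- z * (ln x)%:C) - cexp (- w * (ln x)%:C) - (- z * (ln x)%:C - - w * (ln x)%:C)).
  by rewrite !xpow_split // -/u rmorphM; ring.
have b1 : modc (xpow x (s0%:C + z) - xpow x (s0%:C + w) + (ln x * u)%:C * (z - w)) <=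
     modc (z - w) * (`|ln x| * u) / 4.
  rewrite E modcM modcR ger0_norm //.
  have := cexp_sub_id_lip (h _ zr) (h _ wr).
  rewrite -mulrBl modcM modcR (_ : - z - - w = - (z - w)); last by ring.
  rewrite modcN => h1.
  have h2 : modc (z - w) * `|ln x| * (expR (1 / 8) - 1) <= modc (z - w) * `|ln x| * (1 / 4).
    by rewrite ler_wpM2l ?expR_eighth // mulr_ge0 ?modc_ge0.
  have h3 := le_trans h1 h2.
  apply: (le_trans (ler_wpM2l u0 h3)).
  by rewrite le_eqVlt; apply/orP; left; apply/eqP; ring.
split => //.
have -> : xpow x (s0%:C + z) - xpow x (s0%:C + w) =
  (xpow x (s0%:C + z) - xpow x (s0%:C + w) + (ln x * u)%:C * (z - w)) - (ln x * u)%:C * (z - w) by ring.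
apply: (le_trans (modcB _ _)).
have -> : modc ((ln x * u)%:C * (z - w)) = modc (z - w) * (`|ln x| * u).
  by rewrite modcM modcR normrM (ger0_norm u0) mulrC.
have : 0 <= modc (z - w) * (`|ln x| * u) by rewrite mulr_ge0 ?modc_ge0 // mulr_ge0.
lra.
Qed.

Definition main_poly alpha (s0 : R) t K z : R[i] :=
  \sum_(n < K.+1) xpow (n%:R + alpha) ((s0 +i* t) + z).

Definition slope alpha (s0 : R) K : R :=
  \sum_(n < K.+1) `|shift_log alpha n| * (n%:R + alpha) `^ (- s0).

Lemma main_polyE alpha s0 t K z : 0 < alpha ->
  main_poly alpha s0 t K z = \sum_(n < K.+1) cis (- (t * shift_log alpha n)) * xpow (n%:R + alpha) (s0%:C + z).
Proof.
move=> a0; apply: eq_bigr => n _.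
have -> : (s0 +i* t) + z = (0 +i* t) + (s0%:C + z).
  rewrite addrA; congr (_ + _); apply/eqP; rewrite eq_complex /=.
  by rewrite add0r addr0 !eqxx.
rewrite xpowD xpow_cis ?shift_gt0 // oppr0 powRr0 mul1r //.
Qed.

(** Since [o n] is the sign of the logarithm, replacing phases by signs makes all derivatives at s0
    negative, so that their moduli add up to [slope]. The 1/4 is the nonlinearity, [2 * eta] the
    phase error. *)
Lemma main_poly_near alpha (s0 t r eta : R) K (o : nat -> R) : 0 < alpha ->
  (forall n, (n <= K)%N -> r * `|shift_log alpha n| <= 1 / 8) ->
  (forall n, (n <= K)%N -> o n * shift_log alpha n = `|shift_log alpha n|) ->
  (forall n, `|o n| = 1) ->
  (forall n, (n <= K)%N -> modc (cis (t * shift_log alpha n) - (o n)%:C) <= eta) ->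
  (forall z w, modc z <= r -> modc w <= r ->
    modc (main_poly alpha s0 t K z - main_poly alpha s0 t K w - (- slope alpha s0 K)%:C * (z - w)) <=
    modc (z - w) * (slope alpha s0 K * (1 / 4 + 2 * eta))) /\
  modc (main_poly alpha s0 t K 0) <= `|\sum_(n < K.+1) o n * (n%:R + alpha) `^ (- s0)| +
    eta * \sum_(n < K.+1) (n%:R + alpha) `^ (- s0).
Proof.
move=> a0 hr ho o1 heta.
have heta' n : (n <= K)%N -> modc (cis (- (t * shift_log alpha n)) - (o n)%:C) <= eta.
  move=> nK; have := heta n nK; rewrite cisN -[in X in _ -> X](conjc_real (o n)) -conjcB.
  by case: (_ - _) => p q /=; rewrite sqrrN.
split.
  move=> z w zr wr; rewrite !main_polyE // /slope.
  have -> : (- \sum_(n < K.+1) `|shift_log alpha n| * (n%:R + alpha) `^ (- s0))%:C * (z - w) =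
    - \sum_(n < K.+1) (`|shift_log alpha n| * (n%:R + alpha) `^ (- s0))%:C * (z - w).
    by rewrite rmorphN mulNr rmorph_sum mulr_suml.
  rewrite opprK -sumrB -big_split /=; apply: (le_trans (modc_sum _ _ _)).
  rewrite mulr_suml mulr_sumr; apply: ler_sum => n _.
  have nK : (n <= K)%N by rewrite -ltnS.
  have x0 := shift_gt0 n a0.
  have [b1 b2] := @xpow_near _ s0 r z w x0 (hr n nK) zr wr.
  set x := n%:R + alpha in x0 b1 b2 *; rewrite -/(shift_log alpha n) -/x in b1 b2 *.
  set u := x `^ (- s0) in b1 b2 *; set D := xpow x _ - _ in b1 b2.
  rewrite -mulrBr -/D.
  set c := cis _; set l := shift_log alpha n in b1 b2 *.
  have hol : o n * l = `|l| by apply: ho.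
  have -> : c * D + (`|l| * u)%:C * (z - w) = (o n)%:C * (D + (l * u)%:C * (z - w)) + (c - (o n)%:C) * D.
    by rewrite -hol -mulrA rmorphM; ring.
  apply: (le_trans (modcD _ _)); rewrite (modcM (o n)%:C) (modcM (c - _)) modcR o1 [X in X + _]mul1r.
  have hc : modc (c - (o n)%:C) <= eta by apply: heta'.
  have b3 : modc (c - (o n)%:C) * modc D <= eta * (modc (z - w) * (`|l| * u) * 2) by apply: ler_pM; rewrite ?modc_ge0.
  apply: (le_trans (lerD b1 b3)).
  by rewrite le_eqVlt; apply/orP; left; apply/eqP; field.
rewrite main_polyE //.
have -> : \sum_(n < K.+1) cis (- (t * shift_log alpha n)) * xpow (n%:R + alpha) (s0%:C + 0) =
   (\sum_(n < K.+1) o n * (n%:R + alpha) `^ (- s0))%:C +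
   \sum_(n < K.+1) (cis (- (t * shift_log alpha n)) - (o n)%:C) * ((n%:R + alpha) `^ (- s0))%:C.
  rewrite rmorph_sum -big_split /=; apply: eq_bigr => n _.
  rewrite xpow_split ?shift_gt0 // oppr0 mul0r cexp0 mulr1 rmorphM; ring.
apply: (le_trans (modcD _ _)); rewrite modcR lerD2l.
apply: (le_trans (modc_sum _ _ _)); rewrite mulr_sumr; apply: ler_sum => n _.
rewrite modcM modcR (ger0_norm (powR_ge0 _ _)) ler_wpM2r ?powR_ge0 // heta' // -ltnS //.
Qed.

End MainPart.

(** * Integer relations between the logarithms *)

Section Algebraic.
Context {R : realType}.
Implicit Types (alpha : R).

Definition shift_poly N D (k : {ffun 'I_N -> 'I_D}) : {poly R} :=
  \prod_(n < N) ('X - (- n%:R)%:P) ^+ (k n).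

(** The exponent [k n] is recovered as the multiplicity of the root [- n]. *)
Lemma shift_poly_inj N D (k k' : {ffun 'I_N -> 'I_D}) : shift_poly k = shift_poly k' -> k = k'.
Proof.
move=> E; apply/ffunP => n; apply/val_inj => /=.
have H (l : {ffun 'I_N -> 'I_D}) : mup (- n%:R) (shift_poly l) = l n.
  have M : mup (- n%:R) (shift_poly l) = (\sum_(i < N) mup (- n%:R) (('X - (- i%:R)%:P) ^+ (l i) : {poly R}))%N.
    rewrite /shift_poly; elim: (index_enum 'I_N) => [|i s IH].
      by rewrite !big_nil mupNroot // root1.
    rewrite !big_cons mupM ?IH //; first by rewrite expf_neq0 // polyXsubC_eq0.
    elim: (s) => [|j s' IH']; first by rewrite big_nil oner_eq0.
    by rewrite big_cons mulf_neq0 // expf_neq0 // polyXsubC_eq0.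
  rewrite M (bigD1 n) //= mup_XsubCX eqxx big1 ?addn0 // => i ni.
  rewrite mup_XsubCX eqr_opp eqr_nat; case: eqP => // h.
  by case/eqP: ni; apply/val_inj; rewrite /= h.
by rewrite -H E H.
Qed.

(** A relation with coefficients k_n - O exponentiates to an equality between the products of (n +
    alpha)^(k_n) and of (n + alpha)^O. So alpha is a root of one of finitely many nonzero
    polynomials, whose product is [p]. *)
Lemma independent_cofinite N O : exists2 p : {poly R}, p != 0 &
  forall alpha, 0 < alpha -> ~~ root p alpha ->
  independent_upto O (fun n : 'I_N => shift_log alpha n).
Proof.
have OO : (O < O.*2.+1)%N by rewrite ltnS -addnn leq_addr.
pose k0 : {ffun 'I_N -> 'I_(O.*2.+1)} := [ffun=> Ordinal OO].
pose p := \prod_(k | k != k0) (shift_poly k - shift_poly k0).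
exists p.
  apply/prodf_neq0 => k kk; rewrite subr_eq0; apply: contra kk => /eqP /shift_poly_inj ->.
  exact: eqxx.
move=> alpha a0 np k hk n.
suff -> : k = k0 by rewrite ffunE.
apply/eqP; apply/negPn/negP => kk; case/negP: np.
have val (l : {ffun 'I_N -> 'I_(O.*2.+1)}) : (shift_poly l).[alpha] = expR (\sum_i (l i)%:R * shift_log alpha i).
  rewrite /shift_poly horner_prod expR_sum; apply: eq_bigr => i _.
  rewrite horner_exp hornerXsubC opprK expRM_natl /shift_log lnK ?posrE ?shift_gt0 //.
  by rewrite addrC.
rewrite /p /root horner_prod; apply/prodf_eq0; exists k => //.
rewrite hornerD hornerN !val subr_eq0; apply/eqP; congr expR.
apply/eqP; rewrite -subr_eq0 -sumrB; apply/eqP; rewrite -[RHS]hk; apply: eq_bigr => i _.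
by rewrite ffunE /= mulrBl.
Qed.

End Algebraic.

(** * Choice of the parameters *)

Section Target.
Context {R : realType}.
Implicit Types (x y e r alpha t : R).

(** The sign of ln (n + alpha) for 0 < alpha < 1. *)
Definition target_sign (n : nat) : R := if n == 0%N then -1 else 1.

Lemma target_sign_norm n : `|target_sign n| = 1.
Proof. by rewrite /target_sign; case: ifP; rewrite ?normrN normr1. Qed.

Lemma target_sign_sqr n : target_sign n ^+ 2 = 1.
Proof. by rewrite /target_sign; case: ifP; rewrite ?sqrrN expr1n. Qed.

Definition target (s0 : R) K alpha : R := \sum_(n < K.+1) target_sign n * (n%:R + alpha) `^ (- s0).

Lemma targetE s0 K alpha : target s0 K alpha = - alpha `^ (- s0) + \sum_(n < K) (n.+1%:R + alpha) `^ (- s0).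
Proof.
rewrite /target big_ord_recl /= /target_sign /= add0r mulN1r; congr (_ + _).
by apply: eq_bigr => n _; rewrite mul1r.
Qed.

Lemma is_derive_target s0 K alpha : 0 < alpha -> derivable (target s0 K) alpha 1.
Proof.
move=> a0.
have H : is_derive alpha (1 : R) (target s0 K)
   (\sum_(n < K.+1) target_sign n * (- s0 * (n%:R + alpha) `^ (- s0 - 1))).
  apply: (@is_derive_bigsum R 'I_K.+1 _ xpredT (fun n alpha => target_sign n * (n%:R + alpha) `^ (- s0))
     (fun n => target_sign n * (- s0 * (n%:R + alpha) `^ (- s0 - 1)))) => n _.
  apply: is_deriveZ.
  have h1 : is_derive alpha (1 : R) (fun y => n%:R + y) 1.
    apply: (is_derive_eq2 (is_deriveD (is_derive_cst (n%:R : R) alpha (1 : R)) (is_derive_id alpha (1 : R)))) => //.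
    by rewrite add0r.
  have := @is_derive1_comp R (fun y => y `^ (- s0)) (fun y => n%:R + y) alpha _ _ (is_derive1_powR (- s0) (shift_gt0 n a0)) h1.
  by rewrite mulr1.
by have [] := H.
Qed.

Lemma powR_ge_inv s0 x : s0 <= 1 -> 1 <= x -> x^-1 <= x `^ (- s0).
Proof.
move=> s1 x1; rewrite -powR_inv1; last by lra.
by apply: ler_powR => //; rewrite lerN2.
Qed.

(** Intermediate values. At alpha = (K + 2)^(-2) the negative term has size at least K + 2, because
    s0 >= 1/2, against K terms of size at most 1; at alpha = 1 the positive terms exceed 1 through
    1/2 + 1/3 + 1/4, whence K >= 3. The explicit lower end later bounds |ln alpha|. *)
Lemma target_root s0 K : (3 <= K)%N -> 1 / 2 <= s0 <= 1 ->
  let lo : R := (K.+2%:R ^+ 2)^-1 in exists2 alpha0, lo < alpha0 < 1 & target s0 K alpha0 = 0.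
Proof.
move=> K3 /andP[s1 s2] lo.
have k2 : 2 <= K.+2%:R :> R by rewrite ler_nat.
have q0 : 0 < K.+2%:R ^+ 2 :> R by rewrite exprn_gt0 // ltr0n.
have lo0 : 0 < lo by rewrite invr_gt0.
have lo1 : lo < 1.
  rewrite invf_lt1 //; have : (2 : R) ^+ 2 <= K.+2%:R ^+ 2 by rewrite ler_pXn2r // nnegrE.
  rewrite !expr2; lra.
have flo : target s0 K lo < 0.
  rewrite targetE.
  have h1 : K.+2%:R <= lo `^ (- s0).
    rewrite /lo -powR_inv1; last by rewrite ltW.
    rewrite -powRrM mulN1r opprK -powR_mulrn; last by lra.
    rewrite -powRrM -{1}[K.+2%:R]powRr1; last by lra.
    apply: ler_powR; lra.
  have h2 : \sum_(n < K) (n.+1%:R + lo) `^ (- s0) <= K%:R.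
    apply: (@le_trans _ _ (\sum_(n < K) 1)); last by rewrite sumr_const card_ord.
    apply: ler_sum => n _; apply: (@le_trans _ _ ((n.+1%:R + lo) `^ 0)); last by rewrite powRr0.
    apply: ler_powR; last by lra.
    have : 1 <= n.+1%:R :> R by rewrite ler1n.
    lra.
  have h3 : K.+2%:R = K%:R + 2 :> R by rewrite -!natr1; ring.
  lra.
have f1 : 0 < target s0 K 1.
  rewrite targetE powR1.
  have term (n : nat) : n.+2%:R^-1 <= (n.+1%:R + 1) `^ (- s0).
    by rewrite natr1; apply: powR_ge_inv => //; rewrite ler1n.
  case: K K3 {k2 q0 lo0 lo1 flo lo} => [|[|[|K]]] // _.
  rewrite !big_ord_recl /= /bump /= !add1n.
  have t0 := term 0%N; have t1 := term 1%N; have t2 := term 2%N.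
  have rest : 0 <= \sum_(i < K) (i.+4%:R + 1) `^ (- s0) :> R by apply: sumr_ge0 => i _; apply: powR_ge0.
  move: t0 t1 t2 rest; lra.
have cont : {within `[lo, 1], continuous (target s0 K)}.
  apply: derivable_within_continuous => x; rewrite in_itv /= => /andP[x1 x2].
  by apply: is_derive_target; lra.
have [|a ai fa] := @IVT R (target s0 K) lo 1 0 (ltW lo1) cont.
  by rewrite ge_min le_max (ltW flo) (ltW f1) orbT.
exists a => //; move: ai; rewrite in_itv /= !le_eqVlt => /andP[/orP[/eqP e1|->] /orP[/eqP e2|->]] //.
- by rewrite -e2 fa ltxx in f1.
- by move: flo; rewrite e1 fa ltxx.
- by rewrite -e2 fa ltxx in f1.
Qed.

Lemma target_continuous s0 K alpha0 e : 0 < alpha0 -> 0 < e -> exists2 d, 0 < d &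
  forall alpha, `|alpha0 - alpha| < d -> `|target s0 K alpha0 - target s0 K alpha| <= e.
Proof.
move=> a0 e0.
have dd := @is_derive_target s0 K alpha0 a0.
have /cvgrPdist_le/(_ e e0) : {for alpha0, continuous (target s0 K)}.
  by apply: differentiable_continuous; apply/derivable1_diffP.
move=> /nbhs_ballP[d /= d0 H]; exists d => // alpha h; exact: H.
Qed.

(** The k + 1 terms with k <= n <= 2k suffice, each being at least ln k / (2k + 1). *)
Lemma slope_lower alpha (s0 : R) k : 0 < alpha < 1 -> 0 <= s0 <= 1 -> (3 <= k)%N ->
  ln k%:R / 2 <= slope alpha s0 k.*2.
Proof.
move=> /andP[a0 a1] /andP[s1 s2] k3.
have k1 : 3 <= k%:R :> R by rewrite ler_nat.
have L0 : 0 <= ln k%:R :> R by rewrite ln_ge0 //; lra.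
apply: (@le_trans _ _ (\sum_(n < k.*2.+1) (if (k <= n)%N then ln k%:R / k.*2.+1%:R else 0))).
  rewrite -(big_mkord xpredT (fun n => if (k <= n)%N then ln k%:R / k.*2.+1%:R else 0)).
  rewrite (big_cat_nat (n := k)) //=; last by rewrite -addnn ltnW // ltnS leq_addr.
  rewrite [X in X + _]big_nat_cond big1 ?add0r; last by move=> i /andP[ik _]; rewrite leqNgt (andP ik).2.
  rewrite big_nat_cond (eq_bigr (fun=> ln k%:R / k.*2.+1%:R)); last by move=> i /andP[ik _]; rewrite (andP ik).1.
  rewrite -big_nat_cond sumr_const_nat -(mulr_natr (ln k%:R / _)).
  have -> : (k.*2.+1 - k)%N = k.+1 by rewrite -addnn subSn ?leq_addr // addnK.
  rewrite -mulrA ler_wpM2l // ler_pdivlMl ?ltr0n //.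
  have -> : k.*2.+1%:R = 2 * k%:R + 1 :> R by rewrite -natr1 -mul2n natrM.
  have -> : k.+1%:R = k%:R + 1 :> R by rewrite natr1.
  lra.
apply: ler_sum => n _; case: ifP => kn; last by rewrite mulr_ge0 ?powR_ge0.
have n1 : k%:R <= (nat_of_ord n)%:R :> R by rewrite ler_nat.
have x1 : 1 <= (nat_of_ord n)%:R + alpha by lra.
apply: ler_pM => //.
  rewrite /shift_log ger0_norm; last by rewrite ln_ge0.
  by rewrite ler_ln ?posrE; lra.
apply: le_trans (powR_ge_inv s2 x1); rewrite lef_pV2 ?posrE ?ltr0n //; last by lra.
have : (nat_of_ord n)%:R <= k.*2%:R :> R by rewrite ler_nat -ltnS.
by rewrite -natr1; lra.
Qed.

Lemma tail_square_sum sg alpha m n : 7 / 8 <= sg -> 0 < alpha -> (0 < m)%N ->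
  \sum_(j < n) (if (m <= j)%N then ((j%:R + alpha) `^ (- sg)) ^+ 2 else 0) <=
   tele_cst (3 / 4) * m%:R `^ (- (3 / 4)).
Proof.
move=> s0 a0 m0; have d0 : (0 : R) < 3 / 4 by lra.
apply: le_trans (@sum_powR R (3 / 4) m n alpha d0 (ltW a0) m0); apply: ler_sum => j _.
case: ifP => // mj.
have x1 := shift_ge1 a0 (leq_trans m0 mj).
rewrite expr2 powR_add; last by lra.
apply: ler_powR => //; lra.
Qed.

Lemma shift_log_target alpha K n : (K.+2%:R ^+ 2)^-1 < alpha < 1 -> (n <= K)%N ->
  target_sign n * shift_log alpha n = `|shift_log alpha n| /\
  `|shift_log alpha n| <= 2 * ln K.+2%:R.
Proof.
move=> /andP[a0 a1] nK.
have q0 : 0 < K.+2%:R ^+ 2 :> R by rewrite exprn_gt0 // ltr0n.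
have al0 : 0 < alpha by apply: lt_trans a0; rewrite invr_gt0.
have L0 : 0 <= ln K.+2%:R :> R by rewrite ln_ge0 // ler1n.
rewrite /target_sign /shift_log; case: eqP => [->|/eqP n0].
  rewrite add0r; have h : ln alpha <= 0 by rewrite ln_le0 // ltW.
  rewrite ler0_norm // mulN1r; split => //.
  rewrite -lnV ?posrE // mulr_natl -lnXn ?ltr0n //.
  rewrite ler_ln ?posrE ?invr_gt0 // -[leRHS]invrK lef_pV2 ?posrE ?invr_gt0 //.
  exact: ltW.
have x1 : 1 <= n%:R + alpha by apply: shift_ge1; rewrite // lt0n.
have h : 0 <= ln (n%:R + alpha) by apply: ln_ge0.
rewrite ger0_norm // mul1r; split => //.
have : ln (n%:R + alpha) <= ln K.+2%:R.
  rewrite ler_ln ?posrE ?ltr0n //; last by lra.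
  have : n%:R <= K%:R :> R by rewrite ler_nat.
  by rewrite -!natr1; lra.
lra.
Qed.

Lemma modulus_sum_le alpha (s0 : R) K : (K.+2%:R ^+ 2)^-1 < alpha < 1 -> 0 <= s0 <= 1 ->
  \sum_(n < K.+1) (n%:R + alpha) `^ (- s0) <= K.+2%:R ^+ 2 + K%:R.
Proof.
move=> /andP[a0 a1] /andP[s1 s2].
have q0 : 0 < K.+2%:R ^+ 2 :> R by rewrite exprn_gt0 // ltr0n.
have al0 : 0 < alpha by apply: lt_trans a0; rewrite invr_gt0.
rewrite big_ord_recl add0r; apply: lerD.
  apply: (@le_trans _ _ alpha^-1).
    rewrite powRN lef_pV2 ?posrE ?powR_gt0 //.
    have : ln alpha <= 0 by rewrite ln_le0 // ltW.
    move=> h; rewrite /powR gt_eqF // -{1}[alpha]lnK ?posrE // ler_expR; nra.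
  by rewrite -[leRHS]invrK lef_pV2 ?posrE ?invr_gt0 // ltW.
apply: (@le_trans _ _ (\sum_(n < K) 1)); last by rewrite sumr_const card_ord.
apply: ler_sum => n _; apply: (@le_trans _ _ (((lift ord0 n)%:R + alpha) `^ 0)); last by rewrite powRr0.
apply: ler_powR; last by lra.
by apply: shift_ge1.
Qed.

End Target.

(** * Algebraic irrationals avoiding finitely many values *)

Section AlgebraicNumbers.
Context {R : realType}.

(** Compare the parities of the 2-adic valuations. *)
Lemma rat_sqr_neq2 (q : rat) : q ^+ 2 != 2.
Proof.
apply/negP => /eqP h.
have hd : (denq q)%:~R != 0 :> rat by rewrite intr_eq0 denq_neq0.
have E : (numq q ^+ 2 = 2 * denq q ^+ 2)%R.
  apply: (@intr_inj rat); rewrite !expr2 !intrM.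
  have hn : (numq q)%:~R = q * (denq q)%:~R by rewrite -{2}[q]divq_num_den divfK.
  by rewrite hn; move: h; rewrite expr2; set d := (denq q)%:~R => h; rewrite -[2%:~R]/(2 : rat) -h; ring.
have E2 : (`|numq q| ^ 2 = 2 * `|denq q| ^ 2)%N.
  by have := congr1 absz E; rewrite abszM !abszX.
have d0 : (0 < `|denq q|)%N by rewrite absz_gt0 denq_neq0.
have := congr1 (logn 2) E2.
rewrite lognM ?expn_gt0 ?d0 // !lognX => h2.
by have := congr1 odd h2; rewrite oddD !oddM.
Qed.

Lemma algebraic_irrational_sqrt2 (q : rat) : 0 < q -> ratr q * Num.sqrt 2 < 1 :> R ->
  algebraic_irrationals (ratr q * Num.sqrt 2 : R).
Proof.
move=> q0 q1.
have s2 : Num.sqrt 2 ^+ 2 = 2 :> R by rewrite sqr_sqrtr.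
split.
- by rewrite q1 andbT mulr_gt0 ?ltr0q // sqrtr_gt0.
- exists ('X^2 - (2 * q ^+ 2)%:P); first by rewrite monic_neq0 // monicXnsubC.
  rewrite rmorphB /= map_polyXn map_polyC /= /root hornerD hornerN hornerXn hornerC subr_eq0; apply/eqP.
  have -> : ratr (2 * q ^+ 2) = 2 * ratr q ^+ 2 :> R by rewrite rmorphM rmorphXn /= rmorph_nat.
  by rewrite exprMn s2 mulrC.
- move=> [x _ hx].
  have rq : ratr q != 0 :> R by rewrite fmorph_eq0 gt_eqF.
  have E : Num.sqrt 2 = ratr (x / q) :> R.
    by rewrite fmorph_div /= hx mulrAC divff // mul1r.
  have : ratr ((x / q) ^+ 2) = ratr 2 :> R by rewrite rmorphXn /= -E s2 rmorph_nat.
  by move=> /fmorph_inj /eqP; apply/negP; apply: rat_sqr_neq2.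
Qed.

(** The interval contains infinitely many rational multiples of sqrt 2, while [p] has fewer than
    [size p] roots. *)
Lemma algebraic_irrational_avoid (u v : R) (p : {poly R}) : 0 <= u -> u < v -> v <= 1 -> p != 0 ->
  exists alpha, [/\ u < alpha < v, algebraic_irrationals alpha & ~~ root p alpha].
Proof.
move=> u0 uv v1 p0.
have r2 : 0 < Num.sqrt 2 :> R by rewrite sqrtr_gt0.
have ab : u / Num.sqrt 2 < v / Num.sqrt 2 by rewrite ltr_pM2r ?invr_gt0.
have [q1] := rat_in_itvoo ab; rewrite in_itv /= => /andP[a1 b1].
have [q2] := rat_in_itvoo b1; rewrite in_itv /= => /andP[a2 b2].
have q12 : q1 < q2 by rewrite -(ltr_rat R).
pose f (j : nat) : rat := q1 + (q2 - q1) / j.+1%:R.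
have qd : 0 < q2 - q1 by rewrite subr_gt0.
have f1 j : q1 < f j by rewrite /f ltrDl divr_gt0 // ltr0n.
have f2 j : f j <= q2.
  rewrite /f -lerBrDl ler_pdivrMr ?ltr0n // ler_peMr ?ler1n // ltW //.
have finj : injective f.
  move=> i j /addrI /(mulfI (lt0r_neq0 qd)) /invr_inj /eqP.
  by rewrite eqr_nat eqSS => /eqP.
pose g j : R := ratr (f j) * Num.sqrt 2.
have ginj : injective g.
  by move=> i j /(mulIf (lt0r_neq0 r2)) /fmorph_inj /finj.
have [j hj] : exists j, ~~ root p (g j).
  apply: contrapT => H.
  have all_root : all (root p) [seq g j | j <- iota 0 (size p)].
    apply/allP => _ /mapP[j _ ->]; apply/negPn/negP => h; apply: H; by exists j.
  have uq : uniq [seq g j | j <- iota 0 (size p)] by rewrite map_inj_uniq // iota_uniq.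
  by have := max_poly_roots p0 all_root uq; rewrite size_map size_iota ltnn.
have h1 : ratr q1 < ratr (f j) :> R by rewrite ltr_rat.
have h2 : ratr (f j) <= ratr q2 :> R by rewrite ler_rat.
have b : u < g j < v.
  by rewrite /g -ltr_pdivrMr // (lt_trans a1 h1) /= -ltr_pdivlMr // (le_lt_trans h2 b2).
exists (g j); split => //.
apply: algebraic_irrational_sqrt2; last by have /andP[_ h] := b; apply: lt_le_trans v1.
rewrite -(ltr0q R); apply: le_lt_trans h1; apply: ltW; apply: le_lt_trans a1.
by rewrite divr_ge0 // ltW.
Qed.

End AlgebraicNumbers.

(** * Detection of zeros *)

Section ZeroDetection.
Context {R : realType}.
Implicit Types (z w : R[i]) (x y e r alpha t : R).

Lemma sum_split_ge (V : zmodType) (m n : nat) (f : nat -> V) : (m <= n)%N ->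
  \sum_(k < n) f k = \sum_(k < m) f k + \sum_(j < n) (if (m <= j)%N then f j else 0).
Proof.
move=> mn; rewrite -(big_mkord xpredT f) (big_cat_nat (n := m)) //= big_mkord; congr (_ + _).
rewrite -(big_mkord xpredT (fun j => if (m <= j)%N then f j else 0)) [in RHS](big_cat_nat (n := m)) //=.
rewrite [X in _ = X + _]big_nat_cond [X in _ = X + _]big1 ?add0r; last first.
  by move=> i /andP[/andP[_ im] _]; rewrite leqNgt im.
rewrite big_nat_cond [RHS]big_nat_cond; apply: eq_bigr => i /andP[/andP[mi _] _].
by rewrite mi.
Qed.

(** Newton iteration with slope [- slope alpha s0 K]. Increments: slope / 4 for the nonlinearity,
    slope / 256 for the phases and twice 1/512 for tail and remainder stay below slope / 2, as slope
    >= 1. Starting value: four errors of 1/512 give 1/128 <= slope * r / 2. Since s0 = 1 - 2r, the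
    disc of radius r remains in Re s < 1. *)
Lemma zero_near alpha (s0 : R) r t eta lam (K T : nat) (H : R[i] -> R[i]) :
  0 < alpha < 1 -> is_entire_part alpha H ->
  0 < r <= 1 / 64 -> s0 = 1 - 2 * r -> 1 <= slope alpha s0 K -> 1 / 64 <= slope alpha s0 K * r ->
  (forall n, (n <= K)%N -> r * `|shift_log alpha n| <= 1 / 8) ->
  (forall n, (n <= K)%N -> @target_sign R n * shift_log alpha n = `|shift_log alpha n|) ->
  `|target s0 K alpha| <= 1 / 512 ->
  0 < eta <= 1 / 512 -> eta * \sum_(n < K.+1) (n%:R + alpha) `^ (- s0) <= 1 / 512 ->
  (forall n, (n <= K)%N -> modc (cis (t * shift_log alpha n) - (target_sign n)%:C) <= eta) ->
  0 < lam -> lam * (abel_total + abel_cst + 1) <= 1 / 512 ->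
  (let a := fun j : nat => (j%:R + alpha) `^ (- (s0 - 1 / 16)) in
   modc (block_sum alpha a K.+1 (T ^ 2) t) ^+ 2 +
   \sum_(i < T ^ 2) abel_weight i * modc (block_sum alpha a K.+1 i.+1 t) ^+ 2 <= lam ^+ 2) ->
  (forall s w : R[i], 3 / 4 <= complex.Re s <= 1 -> 3 / 4 <= complex.Re w <= 1 ->
    T%:R / 2 <= complex.Im s <= 3 * T%:R -> T%:R / 2 <= complex.Im w <= 3 * T%:R ->
    modc (zeta_rem alpha H (T ^ 2) s) <= 1 / 512 /\
    modc (zeta_rem alpha H (T ^ 2) s - zeta_rem alpha H (T ^ 2) w) <= modc (s - w) * (1 / 512)) ->
  (K < T)%N -> T%:R <= t <= 2 * T%:R ->
  exists s, [/\ 1 / 2 < complex.Re s < 1, T%:R - 1 <= complex.Im s & H s / (s - 1) = 0].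
Proof.
move=> a01 Hent /andP[r0 r1] s0E sl1 slr hr ho htar /andP[eta0 eta1] heta hcis lam0 hlam hen hrem KT /andP[t1 t2].
have a0 : 0 < alpha by case/andP: a01.
have T0 : (0 < T)%N by apply: leq_ltn_trans KT.
have TR : 1 <= T%:R :> R by rewrite ler1n.
have XX : (K.+1 <= T ^ 2)%N by apply: (leq_trans KT); rewrite -{1}[T]expn1 leq_pexp2l.
pose sh z : R[i] := (s0 +i* t) + z.
have Rsh z : complex.Re (sh z) = s0 + complex.Re z by case: z.
have Ish z : complex.Im (sh z) = t + complex.Im z by case: z.
have loc z : modc z <= r -> [/\ - r <= complex.Re z <= r, - r <= complex.Im z <= r,
   3 / 4 <= complex.Re (sh z) <= 1 & T%:R / 2 <= complex.Im (sh z) <= 3 * T%:R].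
  move=> zr; have := le_trans (modc_Re z) zr; have := le_trans (modc_Im z) zr.
  rewrite Rsh Ish !ler_norml => /andP[i1 i2] /andP[q1 q2].
  split; first (by apply/andP); first (by apply/andP); apply/andP; split; clear -i1 i2 q1 q2 s0E r0 r1 t1 t2 TR; lra.
pose F z := main_poly alpha s0 t K z + tail_poly alpha s0 t K (T ^ 2) z + zeta_rem alpha H (T ^ 2) (sh z).
have X0 : (0 < T ^ 2)%N by rewrite expn_gt0 T0.
have [m1 m2] := main_poly_near s0 a0 hr ho (@target_sign_norm R) hcis.
have [p1 p2] := @tail_poly_small R alpha s0 t K (T ^ 2) lam a01 X0 lam0 hen.
set sl := slope alpha s0 K in sl1 slr m1 *.
have modc_sl : modc (- sl)%:C = sl by rewrite modcR normrN ger0_norm //; clear -sl1; lra.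
have r64 z : modc z <= r -> modc z <= 1 / 64 by move=> h; apply: le_trans r1.
have lipF z w : modc z <= r -> modc w <= r ->
    modc (F z - F w - (- sl)%:C * (z - w)) <= modc (- sl)%:C / 2 * modc (z - w).
  move=> zr wr; rewrite modc_sl.
  have [_ _ zz1 zz2] := loc z zr; have [_ _ ww1 ww2] := loc w wr.
  have [_] := hrem _ _ zz1 ww1 zz2 ww2.
  have -> : sh z - sh w = z - w by rewrite /sh; ring.
  move=> h3; have h1 := m1 z w zr wr; have h2 := p1 z w (r64 _ zr) (r64 _ wr).
  have -> : F z - F w - (- sl)%:C * (z - w) =
    (main_poly alpha s0 t K z - main_poly alpha s0 t K w - (- sl)%:C * (z - w)) +
    (tail_poly alpha s0 t K (T ^ 2) z - tail_poly alpha s0 t K (T ^ 2) w) +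
    (zeta_rem alpha H (T ^ 2) (sh z) - zeta_rem alpha H (T ^ 2) (sh w)) by rewrite /F; ring.
  apply: (le_trans (modcD _ _)); apply: (le_trans (lerD (le_trans (modcD _ _) (lerD h1 h2)) h3)).
  rewrite -!mulrDr [leRHS]mulrC; apply: ler_wpM2l; first exact: modc_ge0.
  have : sl * (2 * eta) <= sl * (1 / 256) by apply: ler_wpM2l; clear -eta1 sl1; lra.
  clear -hlam sl1; lra.
have F0 : modc (F 0) <= modc (- sl)%:C / 2 * r.
  have z0 : modc (0 : R[i]) <= r by rewrite (_ : modc 0 = 0); [apply: ltW|apply/eqP; rewrite modc_eq0].
  have [_ _ zz1 zz2] := loc 0 z0.
  have [h3 _] := hrem _ _ zz1 zz1 zz2 zz2.
  have h1 : modc (main_poly alpha s0 t K 0) <= 1 / 512 + 1 / 512.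
    by apply: (le_trans m2); apply: lerD.
  have h2 := le_trans p2 hlam.
  apply: (le_trans (modcD _ _)); apply: (le_trans (lerD (le_trans (modcD _ _) (lerD h1 h2)) h3)).
  rewrite modc_sl; clear -slr; lra.
have sl0 : (- sl)%:C != 0 :> R[i] by rewrite -modc_eq0 modc_sl; apply/eqP; clear -sl1; lra.
have [z zr Fz] := newton_zero r0 sl0 lipF F0.
have [/andP[q1 q2] /andP[i1 i2] _ _] := loc z zr.
have Re1 : complex.Re (sh z) < 1 by rewrite Rsh; clear -q2 s0E r0; lra.
exists (sh z); split.
- by rewrite Re1 andbT Rsh; clear -q1 s0E r0 r1; lra.
- by rewrite Ish; clear -i1 r1 t1; lra.
- have s1 : sh z != 1 by apply/negP => /eqP h; move: Re1; rewrite h /= ltxx.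
  by rewrite (zeta_remE alpha H (T ^ 2) s1) (sum_split_ge (fun k => xpow (k%:R + alpha) (sh z)) XX) -[RHS]Fz.
Qed.

Lemma le_sqr_of_inv e x y : 0 < e -> 0 <= y -> (e ^+ 2)^-1 * x + y < 1 -> x <= e ^+ 2.
Proof.
move=> e0 y0 h; have q0 : 0 < e ^+ 2 by rewrite exprn_gt0.
have : (e ^+ 2)^-1 * x <= 1 by lra.
by rewrite mulrC ler_pdivrMr // mul1r.
Qed.

(** [k] will be half of [K], as in [slope_lower]. The bound on the logarithm yields r <= 1/64; the
    last one makes the energy beyond [K] small against constants that do not depend on [K]. *)
Lemma cutoff_exists (C : R) : 0 <= C -> exists k : nat,
  [/\ (3 <= k)%N, 4 <= ln (k.*2.+2%:R : R) & C * (k.*2.+1)%:R `^ (- (3 / 4)) <= 1 / 4].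
Proof.
move=> C0; have d0 : (0 : R) < 3 / 4 by lra.
have e0 : (0 : R) < 1 / 4 by lra.
have [n0 h0] := powR_small_nat (ltr01 : (0 : R) < 1) d0 e0 C0.
have [n1 h1] := natr_unbounded (expR (4 : R)).
exists (n0 + n1 + 3)%N; split; first by rewrite leq_addl.
  rewrite -[4]expRK ler_ln ?posrE ?expR_gt0 ?ltr0n //.
  apply: (le_trans h1); rewrite ler_nat -addnn.
  by rewrite -!addnS -!addnA addnCA leq_addr.
rewrite -natr1; apply: h0.
by rewrite -addnn -!addnA leq_addr.
Qed.

Lemma square_sum_le_term (K : nat) (f : nat -> R) (e : R) : 0 < e -> (forall n, 0 <= f n) ->
  \sum_(n < K.+1) f n ^+ 2 <= e ^+ 2 -> forall n, (n <= K)%N -> f n <= e.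
Proof.
move=> e0 f0 h n nK.
have nK' : (n < K.+1)%N by [].
have : f n ^+ 2 <= e ^+ 2.
  apply: le_trans h; rewrite (bigD1 (Ordinal nK')) //= lerDl.
  by apply: sumr_ge0 => i _; apply: sqr_ge0.
by rewrite ler_pXn2r ?nnegrE // ltW.
Qed.

(** The interval and the polynomial precede alpha, which leaves an algebraic irrational to be chosen
    afterwards; zeros of arbitrarily large imaginary part are infinitely many. *)
Lemma zeros_of_generic : exists u v (p : {poly R}), [/\ 0 <= u, u < v, v <= 1, p != 0 &
  forall alpha H, u < alpha < v -> ~~ root p alpha -> is_entire_part alpha H ->
  forall x, exists s, [/\ 1 / 2 < complex.Re s < 1, x <= complex.Im s & H s / (s - 1) = 0]].
Proof.
pose cst : R := abel_total + abel_cst + 1.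
have cst1 : 0 < cst by have := @abel_total_ge0 R; have := @abel_cst_ge1 R; rewrite /cst; lra.
have e512 : (0 : R) < 1 / 512 by lra.
(* [lam] involves only the Abel constants, so the energy threshold does not move when [K] grows. *)
pose lam : R := (1 / 512) / cst; have lam0 : 0 < lam by apply: divr_gt0.
have lamE : lam * cst <= 1 / 512 by rewrite /lam divfK // gt_eqF.
pose B : R := (lam ^+ 2)^-1; have B0 : 0 <= B by rewrite invr_ge0 sqr_ge0.
pose W : R := abel_total; have W0 : 0 <= W by apply: abel_total_ge0.
have d34 : (0 : R) < 3 / 4 by lra.
pose tc : R := tele_cst (3 / 4); have tc0 : 0 <= tc by apply: tele_cst_ge0.
have C0 : 0 <= 2 * B * ((2 * W + 1) * tc).
  by rewrite !mulr_ge0 // addr_ge0 // mulr_ge0.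
have [k [k3 lnk tailk]] := cutoff_exists C0.
pose K := k.*2; pose L : R := ln K.+2%:R.
have L4 : 4 <= L by [].
have L0 : 0 < L by apply: lt_le_trans L4; rewrite ltr0n.
(* As |ln (n + alpha)| <= 2 L for n <= K, this is the largest radius for which that bound gives the
   1/8 of [xpow_near]. *)
pose r : R := (16 * L)^-1.
have r0 : 0 < r by rewrite invr_gt0 mulr_gt0.
have rL : r * L = 1 / 16.
  by rewrite /r invfM divfK ?gt_eqF // div1r.
have r1 : r <= 1 / 64.
  have : r * 4 <= r * L by rewrite ler_wpM2l // ltW.
  clear -rL; lra.
pose s0 : R := 1 - 2 * r.
have s01 : 1 / 2 <= s0 <= 1 by apply/andP; rewrite /s0; clear -r0 r1; split; lra.
have s02 : 0 <= s0 <= 1 by apply/andP; rewrite /s0; clear -r0 r1; split; lra.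
have sg01 : 7 / 8 <= s0 - 1 / 16 <= 1 by apply/andP; rewrite /s0; clear -r0 r1; split; lra.
have K3 : (3 <= K)%N by apply: (leq_trans k3); rewrite /K -addnn leq_addr.
pose lo : R := (K.+2%:R ^+ 2)^-1.
have lo0 : 0 < lo by rewrite invr_gt0 exprn_gt0 // ltr0n.
have [alpha0 /andP[lo_a0 a0_1] root0] := target_root K3 s01.
have a00 : 0 < alpha0 by apply: lt_trans lo_a0.
have [d d0 hd] := target_continuous s0 K a00 e512.
(* [lo] controls |ln alpha| and the moduli of the terms, [d] keeps the signed sum below 1/512. *)
pose u := Num.max lo (alpha0 - d); pose v := Num.min 1 (alpha0 + d).
have u1 : u < alpha0 by rewrite gt_max lo_a0 /= ltrBlDr ltrDl.
have v1 : alpha0 < v by rewrite lt_min a0_1 /= ltrDl.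
pose U : R := K.+2%:R ^+ 2 + K%:R.
have U1 : 1 <= U.
  by rewrite /U -natrX -natrD ler1n addn_gt0 expn_gt0.
have U0 : 0 < U by apply: lt_le_trans U1.
(* [U] bounds the sum of the moduli for every alpha above [lo], so [eta] does not depend on
   alpha. *)
have [eta eta0 etaU] : exists2 eta : R, 0 < eta & eta * U = 1 / 512.
  by exists (1 / 512 / U); [apply: divr_gt0 | rewrite divfK // gt_eqF].
have eta1 : eta <= 1 / 512.
  by have := ler_wpM2l (ltW eta0) U1; rewrite mulr1 etaU.
pose A : R := (eta ^+ 2)^-1; have A0 : 0 <= A by rewrite invr_ge0 sqr_ge0.
(* [J] brings the phase term of [good_height] down to 1/4; the energy term received the other 1/4
   from [cutoff_exists]. *)
have [j hj] := natr_unbounded (8 * A * K.+1%:R).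
pose J := j.+1.
have hJ : A * (K.+1%:R * (2 / J%:R)) <= 1 / 4.
  have J0 : 0 < J%:R :> R by rewrite ltr0n.
  have : 8 * A * K.+1%:R <= J%:R by apply: (le_trans hj); rewrite ler_nat.
  have -> : A * (K.+1%:R * (2 / J%:R)) = (2 * A * K.+1%:R) / J%:R by ring.
  rewrite ler_pdivrMr // => h; clear -h; lra.
have J0 : 0 < J%:R ^+ K.+1 / 8 :> R by rewrite divr_gt0 // exprn_gt0 // ltr0n.
have C1 : 0 <= 2 * B * J%:R ^+ 2 ^+ K.+1 * ((W + 1) * tc).
  by rewrite !mulr_ge0 ?exprn_ge0 // addr_ge0.
have [n0 hn0] := powR_small_nat (ltr01 : (0 : R) < 1) d34 J0 C1.
(* [N] comes after [J], because the energy beyond it must beat the ratio of the maximum J^(2(K + 1))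
   of the weight to its mean J^(K + 1). *)
pose N := (n0 + K).+1.
have KN : (K < N)%N by rewrite ltnS leq_addl.
have hN : 2 * B * J%:R ^+ 2 ^+ K.+1 * ((W + 1) * (tc * N%:R `^ (- (3 / 4)))) <= J%:R ^+ K.+1 / 8.
  have -> : 2 * B * J%:R ^+ 2 ^+ K.+1 * ((W + 1) * (tc * N%:R `^ (- (3 / 4)))) =
     2 * B * J%:R ^+ 2 ^+ K.+1 * ((W + 1) * tc) * N%:R `^ (- (3 / 4)) by ring.
  have -> : N%:R = (n0 + K)%:R + 1 :> R by rewrite natr1.
  by apply: hn0; rewrite leq_addr.
have [p p0 hp] := @independent_cofinite R N J.
exists u, v, p; split => //.
- by rewrite le_max ltW.
- exact: lt_trans v1.
- by rewrite ge_min lexx.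
move=> alpha H /andP[ua av] np Hent x.
have alo : lo < alpha by apply: le_lt_trans ua; rewrite le_max lexx.
have a0 : 0 < alpha by apply: lt_trans alo.
have a1 : alpha < 1 by apply: (lt_le_trans av); rewrite ge_min lexx.
have a01 : 0 < alpha < 1 by rewrite a0.
have alo1 : lo < alpha < 1 by rewrite alo.
have ad : `|alpha0 - alpha| < d.
  have h1 : alpha0 - d < alpha by apply: le_lt_trans ua; rewrite le_max lexx orbT.
  have h2 : alpha < alpha0 + d by apply: (lt_le_trans av); rewrite ge_min lexx orbT.
  by rewrite ltr_norml; apply/andP; split; clear -h1 h2; lra.
have htar : `|target s0 K alpha| <= 1 / 512.
  by have := hd alpha ad; rewrite root0 sub0r normrN.
pose a (j : nat) : R := (j%:R + alpha) `^ (- (s0 - 1 / 16)).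
have sumS m n : (0 < m)%N ->
    \sum_(j < n) (if (m <= j)%N then a j ^+ 2 else 0) <= tc * m%:R `^ (- (3 / 4)).
  move=> m0; apply: tail_square_sum => //; by case/andP: sg01.
have hAB : A * (K.+1%:R * (2 / J%:R)) + 2 * B * ((2 * W + 1) * (tc * K.+1%:R `^ (- (3 / 4)))) <= 1 / 2.
  have -> : 2 * B * ((2 * W + 1) * (tc * K.+1%:R `^ (- (3 / 4)))) =
     2 * B * ((2 * W + 1) * tc) * K.+1%:R `^ (- (3 / 4)) by ring.
  have t1 : 2 * B * ((2 * W + 1) * tc) * K.+1%:R `^ (- (3 / 4)) <= 1 / 4 by [].
  clear -hJ t1; lra.
have [T1 hT1] := @good_height R J N K J (@target_sign R) alpha a (@abel_weight R) A B W
  (tc * K.+1%:R `^ (- (3 / 4))) (tc * N%:R `^ (- (3 / 4))) a0 KN isT (leqnn J)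
  (@target_sign_sqr R) (@target_sign_norm R) (hp alpha a0 np) (fun j => powR_ge0 _ _)
  (@abel_weight_ge0 R) (@abel_weight_sum R) A0 B0 (fun n => sumS K.+1 n isT) hAB hN
  (fun n => sumS N n isT) (fun e => @off_diag_small R (s0 - 1 / 16) alpha N e sg01 a01 isT).
have [T2 hT2] := zeta_rem_small e512.
have [T3 hT3] := natr_unbounded (x + 1).
pose T := (T1 + T2 + T3 + K).+1.
have TT1 : (T1 <= T)%N by rewrite /T -!addnA -addnS leq_addr.
have TT2 : (T2 <= T)%N by rewrite /T -!addnA -!addnS addnCA leq_addr.
have TT3 : (T3 <= T)%N by rewrite /T -!addnA -!addnS addnA addnCA leq_addr.
have KT : (K < T)%N by rewrite ltnS leq_addl.
have [t ht] := hT1 T TT1.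
set D := \sum_(n < K.+1) _; set E := (_ ^+ 2 + _) => hDE.
have D0 : 0 <= D by apply: sumr_ge0 => i _; apply: sqr_ge0.
have E0 : 0 <= E.
  rewrite addr_ge0 ?sqr_ge0 //; apply: sumr_ge0 => i _.
  by rewrite mulr_ge0 ?sqr_ge0 // abel_weight_ge0.
have hD : D <= eta ^+ 2 by apply: (le_sqr_of_inv eta0 _ hDE); rewrite mulr_ge0.
have hE : E <= lam ^+ 2 by apply: (@le_sqr_of_inv lam E (A * D) lam0); rewrite ?mulr_ge0 // addrC.
have hcis := @square_sum_le_term K (fun n => modc (cis (t * shift_log alpha n) - (target_sign n)%:C))
   eta eta0 (fun n => modc_ge0 _) hD.
have k0 : 0 < ln (k%:R : R) by rewrite ln_gt0 // ltr1n; apply: leq_trans k3.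
(* K + 2 <= 3k <= k^2 since k >= 3. Hence the slope is at least L / 4, which is at least 1, and its
   product with [r] is at least 1/64. *)
have Lk : L <= 2 * ln k%:R.
  rewrite mulr_natl -lnXn ?ltr0n; last by apply: leq_trans k3.
  rewrite /L ler_ln ?posrE ?exprn_gt0 ?ltr0n //; last by apply: leq_trans k3.
  rewrite -natrX ler_nat; apply: (@leq_trans (3 * k)); last by rewrite expnS expn1 leq_mul2r k3 orbT.
  by rewrite mulSn mul2n -[K.+2]/(2 + K)%N leq_add2r ltnW.
have slo := slope_lower a01 s02 k3.
have sl1 : 1 <= slope alpha s0 K by apply: le_trans slo; clear -Lk L4; lra.
have slr : 1 / 64 <= slope alpha s0 K * r.
  have h1 : ln k%:R / 2 * r <= slope alpha s0 K * r by rewrite ler_wpM2r // ltW.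
  have h2 : r * L <= r * (2 * ln k%:R) by rewrite ler_wpM2l // ltW.
  clear -h1 h2 rL; lra.
have hU : eta * \sum_(n < K.+1) (n%:R + alpha) `^ (- s0) <= 1 / 512.
  by rewrite -etaU ler_wpM2l ?(ltW eta0) // modulus_sum_le.
have hr n : (n <= K)%N -> r * `|shift_log alpha n| <= 1 / 8.
  move=> nK; have [_ h] := shift_log_target alo1 nK.
  have : r * `|shift_log alpha n| <= r * (2 * L) by rewrite ler_wpM2l // ltW.
  clear -rL; lra.
have rr : 0 < r <= 1 / 64 by rewrite r0.
have ee : 0 < eta <= 1 / 512 by rewrite eta0.
have [s [h1 h2 h3]] := @zero_near alpha s0 r t eta lam K T H a01 Hent rr erefl sl1 slr hr
  (fun n nK => (shift_log_target alo1 nK).1) htar ee hU hcis lam0 lamE hE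
  (fun s w => hT2 T alpha H s w TT2 a01 Hent) KT ht.
exists s; split => //; apply: le_trans h2.
have : T3%:R <= T%:R :> R by rewrite ler_nat.
clear -hT3; lra.
Qed.

End ZeroDetection.

Theorem theorem2 (R : realType) :
  infinite_set
    [set alpha : R | algebraic_irrationals alpha /\
      exists Z : Cplx R -> Cplx R,
        is_hurwitz_zeta alpha Z /\
        infinite_set [set s : Cplx R | critical_half_strip s /\ Z s = 0]].
Proof.
have [u [v [p [u0 uv v1 p0 hz]]]] := @zeros_of_generic R.
move=> /finite_seqP[X hX].
(* The added factors exclude the finitely many values supposed to be all, so the alpha found is a
   new one. *)
have q0 : p * \prod_(x <- X) ('X - x%:P) != 0.
  by rewrite mulf_neq0 // monic_neq0 // monic_prod_XsubC.
have [alpha [uav alg]] := algebraic_irrational_avoid u0 uv v1 q0.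
rewrite rootM root_prod_XsubC negb_or => /andP[np nX].
have a0 : 0 < alpha by case/andP: uav => ua _; apply: le_lt_trans ua.
have [H hH] := hurwitz_entire_exists a0.
case/negP: nX; have : [set` X] alpha; last by [].
rewrite -hX; split => //; exists (fun s => H s / (s - 1)); split.
  exact: is_hurwitz_zetaP.
move=> /finite_seqP[Y hY].
(* The sum exceeds the imaginary part of every listed zero, so a zero at this height cannot be in
   the list. *)
have [s [s1 s2 s3]] := hz alpha H uav np hH (\sum_(y <- Y) `|complex.Im y| + 1).
have sY : s \in Y.
  have : [set` Y] s by rewrite -hY; split => //; rewrite /critical_half_strip /= -div1r.
  by [].
have : `|complex.Im s| <= \sum_(y <- Y) `|complex.Im y|.
  by rewrite (big_rem s sY) /= lerDl sumr_ge0.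
have := ler_norm (complex.Im s); lra.
Qed.
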